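(* An analytic isotropic channel Weingarten surface is an isotropic rotational surface or an isotropic pipe surface. In particular, an analytic isotropic channel surface with a constant nonzero ratio of isotropic principal curvatures is a subset of an isotropic rotational surface or of a parabolic rotational surface.
   Context: We work in $\mathbb{R}^3$ with coordinates $x,y,z$. A surface is an embedded connected 2-dimensional $C^3$ submanifold of $\mathbb{R}^3$, possibly with boundary and possibly non-compact. A surface is admissible if none of its tangent planes is parallel to the $z$-axis; it is then locally a graph $z=f(x,y)$. The isotropic principal curvatures $\kappa_1,\kappa_2$ at a point are the eigenvalues of the Hessian $\nabla^2 f$; $H=\frac{\kappa_1+\kappa_2}{2}$ and $K=\kappa_1\kappa_2$ are the isotropic mean and Gaussian curvatures. An admissible surface has a constant ratio $a$ of isotropic principal curvatures if $K\neq0$ and ($\kappa_1/\kappa_2=a$ or $\kappa_2/\kappa_1=a$) at each of its points. A surface is Weingarten (in the isotropic sense) if there is a fixed functional relation $F(H,K)=0$ satisfied by the isotropic mean and Gaussian curvatures at each point, where the zero set of $F$ is an analytic curve. A parabolic isotropic sphere is a surface $2z=A(x^2+y^2)+Bx+Cy+D$ with $A\neq0$, $B,C,D\in\mathbb{R}$; its radius is $1/A$. An isotropic channel surface is the envelope of a smooth one-parameter family of parabolic isotropic spheres $S(t)$, i.e. a surface $C$ tangent to each $S(t)$ along a single curve $c(t)$ without endpoints so that the curves $c(t)$ cover $C$. The curves $c(t)$ are called characteristics. If the radii of the $S(t)$ are constant, $C$ is an isotropic pipe surface. An analytic isotropic channel surface is an analytic surface that is the envelope of a one-parameter analytic family of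 parabolic isotropic spheres. An isotropic congruence is an affine map $\mathbf{x}\mapsto A\mathbf{x}+\mathbf{b}$ with $A=\begin{pmatrix}\pm\cos\phi&\mp\sin\phi&0\\ \sin\phi&\cos\phi&0\\ c_1&c_2&1\end{pmatrix}$. A surface invariant under all rotations about the $z$-axis, and the image of such a surface under any isotropic congruence, is called isotropic rotational. A parabolic rotation is a map $(x,y,z)\mapsto(x+t,\;y,\;t^2/2+(x+by)t+z)$ with parameters $b,t\in\mathbb{R}$. A surface invariant under all parabolic rotations with $b$ fixed and $t$ running through $\mathbb{R}$, and the image of such a surface under any isotropic congruence, is called parabolic rotational.
   Formalization: ''Parabolic rotational'' is taken up to a scaling of the z-axis: literally, 2z=3x^2+2y^2 (a pipe surface with ratio 2/3) is a counterexample. The characteristics ''without endpoints'' are read as complete curves (closed subsets of space), since otherwise a sector refutes the first sentence. *)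

(* Defs.v *)
(* Points of R^n are row vectors of type 'rV[R]_n, where R : realType. *)
From HB Require Import structures.
From mathcomp Require Import all_boot all_order all_algebra.
From mathcomp Require Import all_classical all_reals all_analysis.

Set Implicit Arguments.
Unset Strict Implicit.
Unset Printing Implicit Defensive.

Import Order.TTheory GRing.Theory Num.Theory.
Import numFieldNormedType.Exports.

Local Open Scope classical_set_scope.
Local Open Scope ring_scope.

Definition pt2 {R : realType} (x y : R) : 'rV[R]_2 :=
  \row_(i < 2) [:: x; y]`_i.

Definition pt3 {R : realType} (x y z : R) : 'rV[R]_3 :=
  \row_(i < 3) [:: x; y; z]`_i.

(** * Regularity classes *)

(* f is of class C^k on the open set U *)
Fixpoint Cr {R : realType} {n : nat} (k : nat) (U : set 'rV[R]_n)
    (f : 'rV[R]_n -> R) : Prop :=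
  match k with
  | 0 => forall x, U x -> {for x, continuous f}
  | k'.+1 => (forall x, U x -> differentiable f x) /\
             (forall v : 'rV[R]_n, Cr k' U ('D_v f))
  end.

(* f is real analytic on the open set U. The multi-indices of the N-th partial
   sum are those with all entries < N; the first condition says that the series
   converges absolutely on the closed polydisc of polyradius r. *)
Definition analytic {R : realType} {n : nat} (U : set 'rV[R]_n)
    (f : 'rV[R]_n -> R) : Prop :=
  forall x, U x -> exists (r M : R) (a : ('I_n -> nat) -> R),
    [/\ 0 < r,
        forall N, \sum_(m : {ffun 'I_n -> 'I_N})
          `|a (fun i => m i)| * r ^+ (\sum_i m i)%N <= M
      & forall h : 'rV[R]_n, (forall i, `|h 0 i| < r) ->
          (fun N : nat => \sum_(m : {ffun 'I_n -> 'I_N})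
             a (fun i => m i) * \prod_i h 0 i ^+ m i) @ \oo --> f (x + h)].

(* On an interval I, which need not be open: f extends smoothly past each
   point of I. *)
Definition smooth_on {R : realType} (I : set R) (f : R -> R) : Prop :=
  forall t, I t -> exists (r : R) (g : R -> R),
    [/\ 0 < r,
        forall (n : nat) s, `|s - t| < r -> derivable (derive1n n g) s 1
      & forall s, I s -> `|s - t| < r -> f s = g s].

Definition analytic_on {R : realType} (I : set R) (f : R -> R) : Prop :=
  forall t, I t -> exists (r : R) (a : nat -> R), 0 < r /\
    forall s, I s -> `|s - t| < r ->
      series (fun k => a k * (s - t) ^+ k) @ \oo --> f s.

(** * Embedded submanifolds *)

(* R^k x {0}, or its half R_{>=0} x R^(k-1) x {0} when h is true *)
Definition slice {R : realType} {n : nat} (h : bool) (k : nat) :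
    set 'rV[R]_n.+1 :=
  [set y | (forall i : 'I_n.+1, (k <= i)%N -> y 0 i = 0) /\
           (h -> 0 <= y 0 0)].

(* phi : W -> W' is a diffeomorphism (of the class cls) between open sets, with
   inverse psi, which maps M `&` W onto the part of the slice lying in W'. *)
Definition slice_chart {R : realType} {n : nat}
    (cls : set 'rV[R]_n.+1 -> ('rV[R]_n.+1 -> R) -> Prop) (h : bool) (k : nat)
    (M : set 'rV[R]_n.+1) (W W' : set 'rV[R]_n.+1)
    (phi psi : 'rV[R]_n.+1 -> 'rV[R]_n.+1) : Prop :=
  [/\ open W /\ open W',
      (forall q, W q -> W' (phi q) /\ psi (phi q) = q),
      (forall y, W' y -> W (psi y) /\ phi (psi y) = y),
      (forall i, cls W (fun q => phi q 0 i) /\ cls W' (fun y => psi y 0 i))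
    & forall q, W q -> (M q <-> slice h k (phi q))].

(* k-dimensional embedded submanifold of R^(n+1); with boundary if bd *)
Definition submanifold {R : realType} {n : nat}
    (cls : set 'rV[R]_n.+1 -> ('rV[R]_n.+1 -> R) -> Prop) (bd : bool) (k : nat)
    (M : set 'rV[R]_n.+1) : Prop :=
  forall p, M p -> exists (h : bool) W W' phi psi,
    [/\ h ==> bd, W p & slice_chart cls h k M W W' phi psi].

(* At a boundary point this is still the whole k-dimensional tangent space. *)
Definition tangent_space {R : realType} {n : nat} (k : nat)
    (M : set 'rV[R]_n.+1) (p : 'rV[R]_n.+1) : set 'rV[R]_n.+1 :=
  [set v | exists (h : bool) W W' phi psi,
    [/\ W p, slice_chart (Cr 1) h k M W W' phi psi
      & forall i : 'I_n.+1, (k <= i)%N -> 'D_v (fun q => phi q 0 i) p = 0]].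

(** * Surfaces and curves *)

Definition surface {R : realType} (M : set 'rV[R]_3) : Prop :=
  [/\ M !=set0, connected M & submanifold (Cr 3) true 2 M].

Definition analytic_surface {R : realType} (M : set 'rV[R]_3) : Prop :=
  surface M /\ submanifold analytic true 2 M.

Definition tangent_plane {R : realType} (M : set 'rV[R]_3) (p : 'rV[R]_3) :=
  tangent_space 2 M p.

Definition admissible {R : realType} (M : set 'rV[R]_3) : Prop :=
  forall p, M p -> ~ tangent_plane M p (pt3 0 0 1).

(* A complete curve: closedness excludes, e.g., open arcs of a circle, whose
   endpoints are merely removed. *)
Definition curve_without_endpoints {R : realType} (c : set 'rV[R]_3) : Prop :=
  [/\ c !=set0, connected c, closed c & submanifold (Cr 1) false 1 c].

(** * Isotropic curvatures *)

(* Near p the surface M is the graph of f over D; D need not be open when p is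
   a boundary point, but f is C^3 on the open set U containing D and, D lying in
   the closure of its interior, the derivatives of f on D depend only on M. *)
Definition local_graph {R : realType} (M : set 'rV[R]_3) (p : 'rV[R]_3)
    (f : 'rV[R]_2 -> R) : Prop :=
  exists (W : set 'rV[R]_3) (U D : set 'rV[R]_2),
    [/\ open W /\ W p, open U /\ Cr 3 U f, D `<=` U, D `<=` closure D°
      & M `&` W = [set pt3 (u 0 0) (u 0 1) (f u) | u in D]].

Definition hessian {R : realType} {n : nat} (f : 'rV[R]_n -> R)
    (u : 'rV[R]_n) : 'M[R]_n :=
  \matrix_(i < n, j < n) 'D_(delta_mx 0 i) ('D_(delta_mx 0 j) f) u.

(* k1, k2 are the isotropic principal curvatures of M at p, i.e. the eigenvalues
   of the Hessian counted with multiplicity. *)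
Definition principal_curvatures {R : realType} (M : set 'rV[R]_3)
    (p : 'rV[R]_3) (k1 k2 : R) : Prop :=
  exists f, local_graph M p f /\
    char_poly (hessian f (pt2 (p 0 0) (p 0 1))) =
      ('X - k1%:P) * ('X - k2%:P).

Definition mean_curvature {R : realType} (k1 k2 : R) : R := (k1 + k2) / 2.

Definition gaussian_curvature {R : realType} (k1 k2 : R) : R := k1 * k2.

Definition constant_ratio {R : realType} (M : set 'rV[R]_3) (a : R) : Prop :=
  admissible M /\
  forall p, M p -> exists k1 k2 : R,
    [/\ principal_curvatures M p k1 k2, gaussian_curvature k1 k2 != 0
      & k1 / k2 = a \/ k2 / k1 = a].

(* Plane analytic curve, possibly singular, reducible or disconnected: locally
   the zero set of an analytic function which does not vanish identically. *)
Definition analytic_curve {R : realType} (Z : set 'rV[R]_2) : Prop :=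
  forall u, Z u -> exists (U : set 'rV[R]_2) (g : 'rV[R]_2 -> R),
    [/\ open U /\ U u, analytic U g, ~ (\forall v \near u, g v = 0)
      & forall v, U v -> (Z v <-> g v = 0)].

Definition weingarten {R : realType} (M : set 'rV[R]_3) : Prop :=
  admissible M /\
  exists F : R -> R -> R,
    analytic_curve [set u : 'rV[R]_2 | F (u 0 0) (u 0 1) = 0] /\
    forall p, M p -> exists k1 k2 : R,
      principal_curvatures M p k1 k2 /\
      F (mean_curvature k1 k2) (gaussian_curvature k1 k2) = 0.

(** * Isotropic channel surfaces *)

(* a parabolic isotropic sphere, of radius A^-1, if A != 0 *)
Definition parabolic_sphere {R : realType} (A B C D : R) : set 'rV[R]_3 :=
  [set p | 2 * p 0 2 =
           A * (p 0 0 ^+ 2 + p 0 1 ^+ 2) + B * p 0 0 + C * p 0 1 + D].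

Definition smooth_sphere_family {R : realType} (I : set R)
    (A B C D : R -> R) : Prop :=
  [/\ is_interval I, exists s t, [/\ I s, I t & s < t],
      [/\ smooth_on I A, smooth_on I B, smooth_on I C & smooth_on I D]
    & forall t, I t -> A t != 0].

Definition tangent_at {R : realType} (M N : set 'rV[R]_3) (p : 'rV[R]_3) :=
  [/\ M p, N p & tangent_plane M p = tangent_plane N p].

Definition envelope {R : realType} (I : set R) (A B C D : R -> R)
    (M : set 'rV[R]_3) : Prop :=
  exists c : R -> set 'rV[R]_3,
    [/\ forall t, I t -> curve_without_endpoints (c t),
        forall t, I t -> forall p, c t p ->
          tangent_at M (parabolic_sphere (A t) (B t) (C t) (D t)) p
      & M = \bigcup_(t in I) c t].

Definition isotropic_pipe {R : realType} (M : set 'rV[R]_3) : Prop :=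
  surface M /\ exists (I : set R) (A B C D : R -> R),
    [/\ smooth_sphere_family I A B C D, envelope I A B C D M
      & forall s t, I s -> I t -> (A s)^-1 = (A t)^-1].

Definition analytic_isotropic_channel {R : realType} (M : set 'rV[R]_3) :
    Prop :=
  analytic_surface M /\ exists (I : set R) (A B C D : R -> R),
    [/\ smooth_sphere_family I A B C D,
        [/\ analytic_on I A, analytic_on I B, analytic_on I C
          & analytic_on I D]
      & envelope I A B C D M].

(** * Rotational surfaces *)

(* s selects the sign in the first row of the matrix; (b1, b2, b3) is the
   translation vector. *)
Definition isotropic_congruence {R : realType} (s : bool)
    (phi c1 c2 b1 b2 b3 : R) (p : 'rV[R]_3) : 'rV[R]_3 :=
  pt3 ((-1) ^+ s * (cos phi * p 0 0 - sin phi * p 0 1) + b1)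
      (sin phi * p 0 0 + cos phi * p 0 1 + b2)
      (c1 * p 0 0 + c2 * p 0 1 + p 0 2 + b3).

Definition rotation {R : realType} (phi : R) (p : 'rV[R]_3) : 'rV[R]_3 :=
  pt3 (cos phi * p 0 0 - sin phi * p 0 1)
      (sin phi * p 0 0 + cos phi * p 0 1) (p 0 2).

Definition parabolic_rotation {R : realType} (b t : R) (p : 'rV[R]_3) :
    'rV[R]_3 :=
  pt3 (p 0 0 + t) (p 0 1) (t ^+ 2 / 2 + (p 0 0 + b * p 0 1) * t + p 0 2).

Definition z_scaling {R : realType} (l : R) (p : 'rV[R]_3) : 'rV[R]_3 :=
  pt3 (p 0 0) (p 0 1) (l * p 0 2).

Definition isotropic_rotational {R : realType} (M : set 'rV[R]_3) : Prop :=
  exists (M0 : set 'rV[R]_3) (s : bool) (phi c1 c2 b1 b2 b3 : R),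
    [/\ surface M0, forall theta, rotation theta @` M0 = M0
      & M = isotropic_congruence s phi c1 c2 b1 b2 b3 @` M0].

(* A parabolic rotation fixes the unit of length along the z-axis, since a graph
   invariant under all parabolic_rotation b t has f_xx = 1, and isotropic
   congruences preserve this unit. The scaling by l makes the notion independent
   of it; equivalently, one considers all groups
   (x, y, z) |-> (x + t, y, l t^2 / 2 + (l x + b y) t + z). Without l, the
   surface 2 z = 3 x^2 + 2 y^2, all of whose normal curvatures exceed 1, would
   not be parabolic rotational. *)
Definition parabolic_rotational {R : realType} (M : set 'rV[R]_3) : Prop :=
  exists (M0 : set 'rV[R]_3) (b l : R) (s : bool) (phi c1 c2 b1 b2 b3 : R),
    [/\ surface M0, forall t, parabolic_rotation b t @` M0 = M0, l != 0
      & M = isotropic_congruence s phi c1 c2 b1 b2 b3 @` (z_scaling l @` M0)].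

(* Main.v *)
Require Import Defs.
From HB Require Import structures.
From mathcomp Require Import all_boot all_order all_algebra.
From mathcomp Require Import all_classical all_reals all_analysis.
From mathcomp Require Import ring lra.

Import Order.TTheory GRing.Theory Num.Theory.
Import numFieldNormedType.Exports.

(** Let the surface M be the envelope of the spheres
    S(t): 2 z = A (x^2 + y^2) + B x + C y + D with characteristics c(t), and
    suppose that the mean and Gaussian curvatures of M satisfy a relation Z
    without interior points. If A is constant, M is a pipe surface. Assume that
    A is not constant; the goal is that M is rotational.

    Along c(t) the gradient of a local graph f of M is that of S(t), namely
    A u + (B, C) / 2. Differentiating along c(t) shows that the tangent of c(t)
    is an eigenvector of the Hessian of f with eigenvalue A (channel_eigen,
    curvature_root). So A(t) is one of the two principal curvatures, and these
    are differentiable functions on a suitable disc. No countable set of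
    characteristics covers an open piece of M (characteristics_meager, by the
    Baire property), and A' has countably many zeros by analyticity; a second
    application of the Baire property (local_family) yields a disc on which the
    parameter of the sphere touching M above u is a differentiable function of
    u, or equivalently of the curvature k = A(t).

    On such a disc, reparametrise the family by k. The top views of the
    characteristics are circles about the points - (b1 k, b2 k), where b1 and b2
    are half the derivatives of B and C by k. If this centre moves, then the two
    curvatures are independent, and the pair of mean and Gaussian curvature fills
    an open set (centre_moves), against the choice of Z. Hence b1 and b2 are
    constant on an interval, that is, B / 2 = b1 A + c1 and C / 2 = b2 A + c2
    there, and by analyticity everywhere (affine_relation).

    All spheres now have the isotropic axis over (- b1, - b2) in common, and the
    gradient of f, after subtraction of (c1, c2), is radial. The rotation field
    is then an eigenvector of the Hessian as well, with the same eigenvalue A as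
    the tangent of c(t), so the two directions agree off the umbilics
    (curve_dichotomy). The trace of the Hessian is constant along the rotation
    field (angular_trace). Therefore a characteristic through a point which is
    not umbilic is a full circle (nonumbilic_circle). A characteristic which is
    somewhere not orthogonal to the radius would meet all full circles nearby,
    so all points nearby would be umbilic and A constant there, which is
    impossible (no_umbilic_ball, orthogonal_characteristic). Hence all
    characteristics are arcs of circles; being closed, they are full circles, and
    M is invariant under the rotations about the axis (turn_invariant).

    A constant ratio a of the principal curvatures gives the relation
    (1 + a)^2 K = 4 a H^2, so the case of nonconstant A is settled. If A is a
    constant k, both principal curvatures take finitely many values and are
    locally constant, and the equality of mixed third derivatives forces the
    Hessian to be locally constant (third_derivatives_zero). Following paths in
    M, the coefficients of the quadratic polynomial osculating the graph do not
    change (jet_path), so the connected surface M lies on one quadric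
    (constant_radius_quadric), which is parabolic rotational
    (quadric_parabolic_rotational). *)

Local Open Scope classical_set_scope.
Local Open Scope ring_scope.

Set Implicit Arguments.
Unset Strict Implicit.
Unset Printing Implicit Defensive.

(** * Calculus along lines *)

Section Calculus.
Context {R : realType}.

Lemma near_continuous (T : topologicalType) (g : T -> R) x e :
  {for x, continuous g} -> 0 < e -> \forall y \near x, `|g x - g y| < e.
Proof. by move=> cg e0; exact: ((cvgrPdist_lt _ _).1 cg). Qed.

Lemma near_neq0 (T : topologicalType) (g : T -> R) x :
  {for x, continuous g} -> g x != 0 -> \forall y \near x, g y != 0.
Proof. by move=> cg g0; exact: (cvgr_neq0 (g x)). Qed.

Lemma is_derive_rV n (g : R -> 'rV[R]_n) (t : R) (v : 'rV[R]_n) :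
  (forall i, is_derive t 1 (fun s => g s 0 i) (v 0 i)) <-> is_derive t 1 g v.
Proof.
split => [H|H].
  have dg : derivable g t 1.
    by apply/derivable_mxP => i j; rewrite ord1; case: (H j).
  apply: DeriveDef => //; rewrite derive_mx//.
  by apply/rowP => j; rewrite mxE; case: (H j).
have [dg <-] := H => i.
apply: DeriveDef; first by move/derivable_mxP : dg; apply.
by rewrite derive_mx// mxE.
Qed.

Lemma differentiable_rV n (V : normedModType R) (g : V -> 'rV[R]_n) (x : V) :
  (forall i, differentiable (fun q => g q 0 i) x) -> differentiable g x.
Proof.
move=> H.
have -> : g = \sum_(i < n) (fun q => g q 0 i *: (delta_mx 0 i : 'rV[R]_n)).
  by apply/funext => q; rewrite fct_sumE -row_sum_delta.
by apply: differentiable_sum => i; exact: differentiableZl.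
Qed.

Lemma derive_coord n (f : 'rV[R]_n -> R) (x v : 'rV[R]_n) :
  differentiable f x -> 'D_v f x = \sum_i v 0 i * 'D_(delta_mx 0 i) f x.
Proof.
move=> df; rewrite deriveE// {1}[v]row_sum_delta raddf_sum/=.
by apply: eq_bigr => i _; rewrite linearZ/= deriveE.
Qed.

Lemma derive_coord2 (f : 'rV[R]_2 -> R) (x v : 'rV[R]_2) :
  differentiable f x ->
  'D_v f x = v 0 0 * 'D_(delta_mx 0 0) f x + v 0 1 * 'D_(delta_mx 0 1) f x.
Proof.
move=> df; rewrite derive_coord// big_ord_recl big_ord1.
by have -> : lift ord0 (ord0 : 'I_1) = 1 by apply/val_inj.
Qed.

Lemma is_derive_along n (f : 'rV[R]_n -> R) (g : R -> 'rV[R]_n) (t : R)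
    (v : 'rV[R]_n) :
  is_derive t 1 g v -> differentiable f (g t) ->
  is_derive t 1 (f \o g) ('D_v f (g t)).
Proof.
move=> [/derivable1_diffP dg <-] df.
apply: DeriveDef; first exact/derivable1_diffP/differentiable_comp.
rewrite deriveE; last exact/differentiable_comp.
by rewrite diff_comp//= deriveE// deriveE.
Qed.

(** One-sided information suffices, the two-sided derivative being assumed to
    exist. A curve which starts at a boundary point stays in a surface on one
    side only. *)
Lemma is_derive_right0 (f : R -> R) (t l e : R) : 0 < e ->
  is_derive t 1 f l -> (forall s, t <= s < t + e -> f s = 0) -> l = 0.
Proof.
move=> e0 /is_derive1_caratheodory[g [fE cg <-]] f0.
have ft : f t = 0 by apply: f0; rewrite lexx/= ltrDl.
apply/eqP/negPn/negP => gt0.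
have : \forall s \near t, g s != 0 /\ `|t - s| < e.
  near=> s; split; near: s.
    by apply: (cvgr_neq0 (g t)).
  by apply/nbhs_ballP; exists e.
move=> /nbhs_ballP[d /= d0 H].
have m0 : 0 < Num.min d e by rewrite lt_min d0.
pose s := t + Num.min d e / 2.
have sd : `|t - s| < Num.min d e.
  by rewrite distrC /s addrC addKr gtr0_norm ?divr_gt0// ltr_pdivrMr// mulr_natr mulr2n ltrDr.
have [gs _] : g s != 0 /\ `|t - s| < e.
  by apply: H; rewrite /ball/= (lt_le_trans sd)// ge_min lexx.
have ts : t < s by rewrite /s ltrDl divr_gt0.
have := fE s; rewrite f0 ?ft ?subr0.
  move/esym/eqP; rewrite mulf_eq0 (negbTE gs)/= subr_eq0 => /eqP st.
  by rewrite st ltxx in ts.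
rewrite (ltW ts)/= -ltrBlDl -[ltLHS]gtr0_norm ?subr_gt0// distrC.
by rewrite (lt_le_trans sd)// ge_min lexx orbT.
Unshelve. all: by end_near. Qed.

Lemma continuous_rV n (T : topologicalType) (g : T -> 'rV[R]_n) (x : T) :
  (forall i, {for x, continuous (fun q => g q 0 i)}) -> {for x, continuous g}.
Proof.
move=> H; apply/cvgrPdist_lt => /= e e0.
near=> y.
rewrite /Num.Def.normr/= mx_normrE bigmax_lt//= => -[i j] _; rewrite !mxE/= ord1.
move: j; near: y; apply: filter_forall => /= j.
exact: ((cvgrPdist_lt _ _).1 (H j)).
Unshelve. all: by end_near. Qed.

Lemma is_derive_line (V : normedModType R) (F : V -> R) (y u : V) s :
  derivable F (y + s *: u) u ->
  is_derive s 1 (fun s => F (y + s *: u)) ('D_u F (y + s *: u)).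
Proof.
move=> dF.
have E : (fun h0 => h0^-1 *: (((fun s => F (y + s *: u)) \o shift s) (h0 *: 1) - F (y + s *: u)))
    = (fun h0 => h0^-1 *: ((F \o shift (y + s *: u)) (h0 *: u) - F (y + s *: u))).
  apply/funext => k /=; congr (_ *: (F _ - _)).
  by rewrite [_%:A]mulr1 scalerDl addrCA.
by apply: DeriveDef; [rewrite /derivable|rewrite /derive]; rewrite E.
Qed.

Lemma mean_value (f df : R -> R) (a b : R) : a < b ->
  (forall x, a <= x <= b -> is_derive x 1 f (df x)) ->
  exists2 c, a < c < b & f b - f a = df c * (b - a).
Proof.
move=> ab H.
have [c + E] : exists2 c, c \in `]a, b[%R & f b - f a = df c * (b - a).
  apply: MVT => //.
    by move=> x; rewrite in_itv/= => /andP[/ltW ax /ltW xb]; apply: H; rewrite ax.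
  apply: derivable_within_continuous => x; rewrite in_itv/= => xab.
  by case: (H x xab).
by rewrite in_itv/= => cab; exists c.
Qed.

(** Both mixed partial derivatives are limits of the same second difference
    quotient. *)
Lemma second_difference (V : normedModType R) (f : V -> R) (x v w : V) (h : R) :
  0 < h ->
  (forall s t, 0 <= s <= h -> 0 <= t <= h ->
    derivable f (x + s *: v + t *: w) v /\
    derivable ('D_v f) (x + s *: v + t *: w) w) ->
  exists s t, [/\ 0 <= s <= h, 0 <= t <= h &
    f (x + h *: v + h *: w) - f (x + h *: v) - (f (x + h *: w) - f x) =
    h * (h * 'D_w ('D_v f) (x + s *: v + t *: w))].
Proof.
move=> h0 H.
have hh : 0 <= h <= h by rewrite lexx ltW.
have zh : 0 <= (0 : R) <= h by rewrite lexx ltW.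
pose G s := f (x + s *: v + h *: w) - f (x + s *: v).
have dG s : 0 <= s <= h -> is_derive s 1 G
    ('D_v f (x + s *: v + h *: w) - 'D_v f (x + s *: v)).
  move=> sh; apply: is_deriveB.
    have E r : x + r *: v + h *: w = (x + h *: w) + r *: v by rewrite addrAC.
    under eq_fun do rewrite E.
    rewrite E; have [+ _] := H s h sh hh; rewrite E; exact: is_derive_line.
  by have [+ _] := H s 0 sh zh; rewrite scale0r addr0; exact: is_derive_line.
have [s /andP[s0 sh] Es] := mean_value h0 dG.
have sh' : 0 <= s <= h by rewrite !ltW.
have dH t : 0 <= t <= h -> is_derive t 1 (fun t => 'D_v f (x + s *: v + t *: w))
    ('D_w ('D_v f) (x + s *: v + t *: w)).
  by move=> th; apply: is_derive_line; case: (H s t sh' th).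
have [t /andP[t0 th] Et] := mean_value h0 dH.
exists s, t; split => //; first by rewrite !ltW.
move: Es Et; rewrite /G !scale0r !addr0 !subr0 => -> ->.
by ring.
Qed.

Lemma Schwarz (V : normedModType R) (f : V -> R) (x v w : V) :
  (\forall y \near x, [/\ derivable f y v, derivable f y w,
     derivable ('D_v f) y w & derivable ('D_w f) y v]) ->
  {for x, continuous ('D_w ('D_v f))} -> {for x, continuous ('D_v ('D_w f))} ->
  'D_w ('D_v f) x = 'D_v ('D_w f) x.
Proof.
move=> H c1 c2; apply/eqP; rewrite -subr_eq0 -normr_le0; apply/ler_addgt0Pr => e e0; rewrite add0r.
have near_mid (a b m : R) : `|a - m| < e / 2 -> `|b - m| < e / 2 -> `|a - b| <= e.
  by rewrite !ltr_norml ler_norml; lra.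
have e20 : 0 < e / 2 by rewrite divr_gt0.
move/nbhs_ballP: H => [r1 /= r10 H1].
have /nbhs_ballP[r2 /= r20 H2] := near_continuous c1 e20.
have /nbhs_ballP[r3 /= r30 H3] := near_continuous c2 e20.
pose r := Num.min r1 (Num.min r2 r3).
have r0 : 0 < r by rewrite !lt_min r10 r20 r30.
have sub1 : ball x r `<=` ball x r1 by apply: le_ball; rewrite ge_min lexx.
have sub2 : ball x r `<=` ball x r2 by apply: le_ball; rewrite !ge_min lexx orbT.
have sub3 : ball x r `<=` ball x r3 by apply: le_ball; rewrite !ge_min lexx !orbT.
pose N := `|v| + `|w| + 1.
have N0 : 0 < N by rewrite /N ltr_wpDl// addr_ge0.
pose h : R := r / N.
have h0 : 0 < h by rewrite divr_gt0.
have inB (s t : R) : 0 <= s <= h -> 0 <= t <= h -> ball x r (x + s *: v + t *: w).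
  move=> /andP[s0 sh] /andP[t0 th].
  rewrite -ball_normE /ball_/= -addrA opprD addNKr normrN.
  apply: (le_lt_trans (ler_normD _ _)); rewrite !normrZ !ger0_norm//.
  apply: (@le_lt_trans _ _ (h * (`|v| + `|w|))).
    by rewrite mulrDr lerD// ler_wpM2r.
  by rewrite /h mulrAC ltr_pdivrMr// ltr_pM2l// /N ltrDl.
have quotient (a b c d p q : R) : a - b - (c - d) = h * (h * p) ->
    a - c - (b - d) = h * (h * q) -> p = q.
  move=> Ep Eq; have hh : h * h != 0 by rewrite mulf_neq0// lt0r_neq0.
  have : h * h * p = h * h * q by lra.
  by move/(mulfI hh).
have [|s [t [sh th E1]]] := @second_difference V f x v w h h0.
  by move=> s t sh th; have [a _ b _] := H1 _ (sub1 _ (inB s t sh th)); split; [exact: a|exact: b].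
have [|t' [s' [th' sh' E2]]] := @second_difference V f x w v h h0.
  move=> s1 t1 sh1 th1.
  have -> : x + s1 *: w + t1 *: v = x + t1 *: v + s1 *: w by rewrite addrAC.
  by have [_ a _ b] := H1 _ (sub1 _ (inB t1 s1 th1 sh1)); split; [exact: a|exact: b].
have E : 'D_w ('D_v f) (x + s *: v + t *: w) = 'D_v ('D_w f) (x + s' *: v + t' *: w).
  have EE : x + s' *: v + t' *: w = x + t' *: w + s' *: v by rewrite addrAC.
  have Eh : x + h *: w + h *: v = x + h *: v + h *: w by rewrite addrAC.
  by rewrite EE; rewrite Eh in E2; have := quotient _ _ _ _ _ _ E1 E2.
have {H1}H1 := H2 _ (sub2 _ (inB s t sh th)).
have {H3}H2 := H3 _ (sub3 _ (inB s' t' sh' th')).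
move: H1; rewrite /= E => H1.
exact: near_mid H1 H2.
Qed.

Lemma Cr_cont n k (U : set 'rV[R]_n) f x : Cr k U f -> U x -> {for x, continuous f}.
Proof.
case: k => [|k] H Ux; first exact: H.
by apply: differentiable_continuous; case: H => + _; apply.
Qed.

Lemma Cr_le n k l (U : set 'rV[R]_n) f : (l <= k)%N -> Cr k U f -> Cr l U f.
Proof.
elim: l k f => [k f _ H x Ux|l IH [//|k] f lk [H1 H2]]; first exact: Cr_cont H Ux.
by split => // v; apply: IH (H2 v).
Qed.

Lemma Cr_Schwarz n (U : set 'rV[R]_n) f x v w : open U -> Cr 2 U f -> U x ->
  'D_w ('D_v f) x = 'D_v ('D_w f) x.
Proof.
move=> oU [df H] Ux; apply: Schwarz.
- have := open_nbhs_nbhs (conj oU Ux); apply: filterS => y Uy; split.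
  + exact/diff_derivable/df.
  + exact/diff_derivable/df.
  + by apply/diff_derivable; have [+ _] := H v; apply.
  + by apply/diff_derivable; have [+ _] := H w; apply.
- by have [_ /(_ w)] := H v; apply.
- by have [_ /(_ v)] := H w; apply.
Qed.

(** Identities between continuous functions extend to the closure; derivatives
    of a graph at a boundary point are reached this way. *)
Lemma eq_on_closure (T : topologicalType) (U D : set T) (f g : T -> R) x :
  open U -> U x -> closure D x ->
  {for x, continuous f} -> {for x, continuous g} ->
  (forall y, U y -> D y -> f y = g y) -> f x = g x.
Proof.
move=> oU Ux cDx cf cg fg; apply/eqP/negPn/negP => fgx.
have d0 : f x - g x != 0 by rewrite subr_eq0.
have cfg : {for x, continuous (fun y => f y - g y)} by apply: continuousB.
have nU : nbhs x U by exact: open_nbhs_nbhs.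
have : \forall y \near x, f y - g y != 0 /\ U y.
  have n1 : \forall y \near x, f y - g y != 0 by exact: (cvgr_neq0 (f x - g x)).
  by near=> y; split; near: y; [exact: n1|exact: nU].
move=> /cDx[y [Dy [+ Uy]]].
by rewrite fg// subrr eqxx.
Unshelve. all: by end_near. Qed.

End Calculus.

(** * Coordinates and charts *)

Lemma continuous_at_ext (S T : topologicalType) (g h : S -> T) (x : S) :
  (forall y, g y = h y) -> {for x, continuous g} -> {for x, continuous h}.
Proof. by move/funext ->. Qed.

Section Coordinates.
Context {R : realType}.
Implicit Types (x y z : R) (p q : 'rV[R]_3) (u v : 'rV[R]_2).

Lemma pt2_0 x y : pt2 x y 0 0 = x. Proof. by rewrite mxE. Qed.
Lemma pt2_1 x y : pt2 x y 0 1 = y. Proof. by rewrite mxE. Qed.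
Lemma pt3_0 x y z : pt3 x y z 0 0 = x. Proof. by rewrite mxE. Qed.
Lemma pt3_1 x y z : pt3 x y z 0 1 = y. Proof. by rewrite mxE. Qed.
Lemma pt3_2 x y z : pt3 x y z 0 2 = z. Proof. by rewrite mxE. Qed.
Definition ptE := (pt2_0, pt2_1, pt3_0, pt3_1, pt3_2).

Lemma forall_I2 (P : 'I_2 -> Prop) : P 0 -> P 1 -> forall i, P i.
Proof.
move=> P0 P1 [[|[|i]] hi]//.
  by have -> : Ordinal hi = 0 by apply/val_inj.
by have -> : Ordinal hi = 1 by apply/val_inj.
Qed.

Lemma forall_I3 (P : 'I_3 -> Prop) : P 0 -> P 1 -> P 2 -> forall i, P i.
Proof.
move=> P0 P1 P2 [[|[|[|i]]] hi]//.
- by have -> : Ordinal hi = 0 by apply/val_inj.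
- by have -> : Ordinal hi = 1 by apply/val_inj.
- by have -> : Ordinal hi = 2 by apply/val_inj.
Qed.

Lemma rV2P (u v : 'rV[R]_2) : u 0 0 = v 0 0 -> u 0 1 = v 0 1 -> u = v.
Proof. by move=> e0 e1; apply/rowP; exact: forall_I2. Qed.

Lemma rV3P p q : p 0 0 = q 0 0 -> p 0 1 = q 0 1 -> p 0 2 = q 0 2 -> p = q.
Proof. by move=> e0 e1 e2; apply/rowP; exact: forall_I3. Qed.

Definition top p : 'rV[R]_2 := pt2 (p 0 0) (p 0 1).

Definition lift3 (f : 'rV[R]_2 -> R) u : 'rV[R]_3 := pt3 (u 0 0) (u 0 1) (f u).

Lemma top_lift3 f u : top (lift3 f u) = u.
Proof. by apply: rV2P; rewrite !ptE. Qed.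

Lemma lift3_top f p : f (top p) = p 0 2 -> lift3 f (top p) = p.
Proof. by move=> fp; apply: rV3P; rewrite !ptE. Qed.

Lemma continuous_top : continuous top.
Proof.
move=> p; apply: continuous_rV; apply: forall_I2.
- apply: (@continuous_at_ext _ _ (fun q : 'rV[R]_3 => q 0 0)) => [q|].
    by rewrite !ptE.
  exact: coord_continuous.
- apply: (@continuous_at_ext _ _ (fun q : 'rV[R]_3 => q 0 1)) => [q|].
    by rewrite !ptE.
  exact: coord_continuous.
Qed.

Lemma continuous_lift3 f u : {for u, continuous f} ->
  {for u, continuous (lift3 f)}.
Proof.
move=> cf; apply: continuous_rV; apply: forall_I3.
- apply: (@continuous_at_ext _ _ (fun q : 'rV[R]_2 => q 0 0)) => [q|].
    by rewrite !ptE.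
  exact: coord_continuous.
- apply: (@continuous_at_ext _ _ (fun q : 'rV[R]_2 => q 0 1)) => [q|].
    by rewrite !ptE.
  exact: coord_continuous.
- by apply: continuous_at_ext cf => q; rewrite !ptE.
Qed.

Lemma is_derive_top (g : R -> 'rV[R]_3) (t : R) (v : 'rV[R]_3) :
  is_derive t 1 g v -> is_derive t 1 (top \o g) (top v).
Proof.
move=> /is_derive_rV dg; apply/is_derive_rV; apply: forall_I2;
by under eq_fun do rewrite /= !ptE; rewrite !ptE; exact: dg.
Qed.

End Coordinates.

Lemma near_eq_differentiable (R : numFieldType) (V W : normedModType R)
    (f g : V -> W) (x : V) :
  (\near x, f x = g x) -> differentiable f x -> differentiable g x.
Proof.
move=> fg df.
have -> : g = f + (g - f) by rewrite addrC subrK.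
apply: differentiableD => //.
set k := g - f.
have kx : \near x, k x = 0.
  by apply: filterS fg => y fgy; rewrite /k !fctE fgy subrr.
have E : k \o shift x = cst (k x) + (\0 : V -> W) +o_ 0 id.
  apply/eqaddoP => e e0.
  rewrite (nbhs_singleton kx).
  move: kx; rewrite (near_shift (0 : V) x); apply: filterS => h /=.
  rewrite subr0 => kh.
  rewrite !fctE /= kh; by rewrite addr0 subr0 normr0 mulr_ge0// ltW.
have D0 : continuous (\0 : V -> W) by move=> ?; exact: cst_continuous.
pose Z : {linear V -> W} := \0.
have dE : 'd k x = Z :> (V -> W) by apply: diff_unique.
by apply/diff_locallyP; rewrite dE.
Qed.

Section CrAlgebra.
Context {R : realType}.
Variable n : nat.
Implicit Types (U : set 'rV[R]_n) (f g : 'rV[R]_n -> R).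

Lemma near_open U x (P : 'rV[R]_n -> Prop) : open U -> U x ->
  (forall y, U y -> P y) -> \near x, P x.
Proof. by move=> oU Ux H; apply: filterS (open_nbhs_nbhs (conj oU Ux)). Qed.

Lemma Cr_ext k U f g : open U -> (forall x, U x -> f x = g x) ->
  Cr k U f -> Cr k U g.
Proof.
move=> oU; elim: k f g => [|k IH] f g fg /=.
  move=> cf x Ux; have nfg := near_open oU Ux fg.
  rewrite /prop_for /continuous_at -(fg x Ux).
  by apply: cvg_trans (near_eq_cvg nfg) _; exact: cf.
move=> [df Df]; split.
  move=> x Ux; apply: near_eq_differentiable (df x Ux); exact: (near_open oU Ux fg).
move=> v; apply: IH (Df v) => x Ux; apply: near_eq_derive; exact: (near_open oU Ux fg).
Qed.

Lemma Cr_cst k U (a : R) : Cr k U (cst a).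
Proof.
elim: k a => [a x _|k IH a]; first exact: cst_continuous.
split=> [x _|v]; first exact: differentiable_cst.
have -> : 'D_v (cst a) = cst 0 :> ('rV[R]_n -> R); last exact: IH.
by apply/funext => x; rewrite derive_cst.
Qed.

Lemma derive_coordinate i (x v : 'rV[R]_n) :
  'D_v (fun x : 'rV[R]_n => x 0 i) x = v 0 i.
Proof.
have := derive_mx (@derivable_id _ _ x v); rewrite derive_id => /rowP/(_ i).
by rewrite mxE => ->.
Qed.

Lemma Cr_coord k U i : Cr k U (fun x : 'rV[R]_n => x 0 i).
Proof.
case: k => [x _|k]; first exact: coord_continuous.
split=> [x _|v]; first exact: differentiable_coord.
have -> : 'D_v (fun x : 'rV[R]_n => x 0 i) = cst (v 0 i); last exact: Cr_cst.
by apply/funext => x; exact: derive_coordinate.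
Qed.

Lemma Cr_add k U f g : open U -> Cr k U f -> Cr k U g ->
  Cr k U (fun x => f x + g x).
Proof.
move=> oU; elim: k f g => [f g cf cg x Ux|k IH f g [df Df] [dg Dg]].
  by apply: continuousD; [exact: cf|exact: cg].
split=> [x Ux|v]; first by apply: differentiableD; [exact: df|exact: dg].
apply: Cr_ext (IH _ _ (Df v) (Dg v)) => // x Ux /=.
by rewrite -deriveD//; apply: diff_derivable; [exact: df|exact: dg].
Qed.

Lemma Cr_mul k U f g : open U -> Cr k U f -> Cr k U g ->
  Cr k U (fun x => f x * g x).
Proof.
move=> oU; elim: k f g => [f g cf cg x Ux|k IH f g Hf Hg].
  by apply: continuousM; [exact: cf|exact: cg].
have [df Df] := Hf; have [dg Dg] := Hg.
split=> [x Ux|v]; first by apply: differentiableM; [exact: df|exact: dg].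
have f1 := Cr_le (leqnSn k) Hf; have g1 := Cr_le (leqnSn k) Hg.
apply: Cr_ext (Cr_add oU (IH _ _ f1 (Dg v)) (IH _ _ g1 (Df v))) => // x Ux /=.
by rewrite [RHS]deriveM//; apply: diff_derivable; [exact: df|exact: dg].
Qed.

Lemma Cr_sum k U m (f : 'I_m -> 'rV[R]_n -> R) : open U ->
  (forall i, Cr k U (f i)) -> Cr k U (fun x => \sum_i f i x).
Proof.
move=> oU; elim: m f => [|m IH] f H.
  by under eq_fun do rewrite big_ord0; exact: Cr_cst.
under eq_fun do rewrite big_ord_recl; apply: Cr_add => //.
by apply: IH => i; exact: H.
Qed.

End CrAlgebra.

Lemma Cr_affine (R : realType) n m k (U : set 'rV[R]_m) (A : 'M[R]_(n, m))
    (b : 'rV[R]_m) (f : 'rV[R]_m -> R) :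
  Cr k U f ->
  Cr k ((fun x : 'rV[R]_n => x *m A + b) @^-1` U) (fun x => f (x *m A + b)).
Proof.
set L := fun x : 'rV[R]_n => _.
have dL x : differentiable L x.
  apply: differentiable_rV => i;
  suff [] : Cr 1 setT (fun q => L q 0 i) by move=> /(_ x I).
  rewrite /L; under eq_fun do rewrite !mxE; apply: Cr_add; first exact: openT.
    apply: Cr_sum; first exact: openT.
    move=> j; apply: Cr_mul; [exact: openT|exact: Cr_coord|exact: Cr_cst].
  exact: Cr_cst.
elim: k f => [f cf x Ux|k IH f [df Df]].
  apply: (@continuous_comp _ _ _ L f); last exact: cf.
  exact: differentiable_continuous.
split=> [x Ux|v].
  by apply: (@differentiable_comp _ _ _ _ L f); [exact: dL|exact: df].
have -> : 'D_v (fun x => f (x *m A + b)) = fun x => 'D_(v *m A) f (x *m A + b);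
  last exact: (IH _ (Df (v *m A))).
apply/funext => x; rewrite /derive;
suff -> : (fun h : R => h^-1 *: (((fun x => f (x *m A + b)) \o shift x) (h *: v)
      - f (x *m A + b))) =
  (fun h => h^-1 *: ((f \o shift (x *m A + b)) (h *: (v *m A)) - f (x *m A + b))) by [].
apply/funext => h /=; congr (_ *: (f _ - _)).
by rewrite mulmxDl -scalemxAl addrA.
Qed.

Section Charts.
Context {R : realType}.
Variables (n k : nat) (h : bool) (d : nat).
Variables (M W W' : set 'rV[R]_n.+1) (phi psi : 'rV[R]_n.+1 -> 'rV[R]_n.+1).
Hypothesis chart : slice_chart (Cr k.+1) h d M W W' phi psi.

Lemma chart_differentiable p : W p -> differentiable phi p.
Proof.
move=> Wp; apply: differentiable_rV => i.
by have [_ _ _ /(_ i)[[+ _] _] _] := chart; apply.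
Qed.

Lemma chart_inv_differentiable y : W' y -> differentiable psi y.
Proof.
move=> Wp; apply: differentiable_rV => i.
by have [_ _ _ /(_ i)[_ [+ _]] _] := chart; apply.
Qed.

Lemma chart_derive p v : W p -> 'D_('D_v phi p) psi (phi p) = v.
Proof.
move=> Wp.
have [[oW oW'] H1 H2 _ _] := chart.
have W'p : W' (phi p) by case: (H1 p Wp).
have dphi := chart_differentiable Wp; have dpsi := chart_inv_differentiable W'p.
have E : 'D_v (psi \o phi) p = 'D_v id p.
  by apply: near_eq_derive; apply: near_open oW Wp _ => q /H1[_].
move: E; rewrite derive_id deriveE; last exact: differentiable_comp.
by rewrite diff_comp//= -!deriveE.
Qed.

Lemma chart_inv_derive y v : W' y -> 'D_('D_v psi y) phi (psi y) = v.
Proof.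
move=> W'y.
have [[oW oW'] H1 H2 _ _] := chart.
have Wp : W (psi y) by case: (H2 y W'y).
have dphi := chart_differentiable Wp; have dpsi := chart_inv_differentiable W'y.
have E : 'D_v (phi \o psi) y = 'D_v id y.
  by apply: near_eq_derive; apply: near_open oW' W'y _ => q /H2[_].
move: E; rewrite derive_id deriveE; last exact: differentiable_comp.
by rewrite diff_comp//= -!deriveE.
Qed.

Lemma chart_mem y : W' y -> slice h d y -> M (psi y).
Proof.
move=> W'y sy; have [_ _ H2 _ H] := chart.
by have [Wy E] := H2 y W'y; apply/H => //; rewrite E.
Qed.

Lemma chart_line (y v : 'rV[R]_n.+1) (s : R) : W' (y + s *: v) ->
  is_derive s 1 (fun s => psi (y + s *: v)) ('D_v psi (y + s *: v)).
Proof.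
move=> W's; have dpsi := chart_inv_differentiable W's.
apply/is_derive_rV => i.
have -> : 'D_v psi (y + s *: v) 0 i = 'D_v (fun q => psi q 0 i) (y + s *: v).
  by rewrite derive_mx ?mxE//; exact: diff_derivable.
apply: is_derive_line; apply: diff_derivable.
by have [_ _ _ /(_ i)[_ [+ _]] _] := chart; apply.
Qed.

Lemma chart_inv_coord (y v : 'rV[R]_n.+1) i : W' y ->
  'D_v psi y 0 i = 'D_v (fun q => psi q 0 i) y.
Proof.
move=> W'y; rewrite derive_mx ?mxE//.
exact/diff_derivable/chart_inv_differentiable.
Qed.

Lemma chart_coord (p v : 'rV[R]_n.+1) i : W p ->
  'D_v phi p 0 i = 'D_v (fun q => phi q 0 i) p.
Proof.
move=> Wp; rewrite derive_mx ?mxE//.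
exact/diff_derivable/chart_differentiable.
Qed.

End Charts.

Lemma line_near (R : realType) n (W : set 'rV[R]_n) (y v : 'rV[R]_n) :
  open W -> W y -> exists2 e : R, 0 < e & forall s, `|s| < e -> W (y + s *: v).
Proof.
move=> oW Wy.
have cL : {for (0 : R), continuous (fun s : R => y + s *: v)}.
  apply: continuousD; first exact: cst_continuous.
  exact: scalel_continuous.
have : \forall s \near (0 : R), W (y + s *: v).
  by apply: cL; rewrite scale0r addr0; exact: open_nbhs_nbhs.
move=> /nbhs_ballP[e /= e0 H]; exists e => // s se; apply: H.
by rewrite /ball/= sub0r normrN.
Qed.

(** * Local graphs, curves and spheres *)

Section Graphs.
Context {R : realType}.
Implicit Types (M : set 'rV[R]_3) (p q : 'rV[R]_3) (u v : 'rV[R]_2).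

(** The data hidden in local_graph. No point is singled out, so that one
    representation serves a whole neighbourhood. *)
Definition graph_on M (W : set 'rV[R]_3) (U D : set 'rV[R]_2) f : Prop :=
  [/\ open W, open U /\ Cr 3 U f, D `<=` U, D `<=` closure D°
    & M `&` W = [set pt3 (u 0 0) (u 0 1) (f u) | u in D]].

Lemma local_graphP M p f :
  local_graph M p f <-> exists W U D, W p /\ graph_on M W U D f.
Proof.
split=> [[W [U [D [[oW Wp] oU DU DD E]]]]|[W [U [D [Wp [oW oU DU DD E]]]]]].
  by exists W, U, D.
by exists W, U, D.
Qed.

Section GraphOn.
Variables (M W : set 'rV[R]_3) (U D : set 'rV[R]_2) (f : 'rV[R]_2 -> R).
Hypothesis G : graph_on M W U D f.

Lemma graph_top q : M q -> W q -> D (top q) /\ f (top q) = q 0 2.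
Proof.
move=> Mq Wq; have [_ _ _ _ E] := G.
have : (M `&` W) q by [].
rewrite E => -[u Du <-].
by rewrite -/(lift3 f u) top_lift3 ptE.
Qed.

Lemma graph_lift u : D u -> M (lift3 f u) /\ W (lift3 f u).
Proof.
move=> Du; have [_ _ _ _ E] := G.
suff : (M `&` W) (lift3 f u) by [].
by rewrite E; exists u.
Qed.

Lemma graph_local q : M q -> W q -> local_graph M q f.
Proof. by move=> Mq Wq; apply/local_graphP; exists W, U, D. Qed.

(** The height of the curve minus that of the graph below it vanishes on one
    side of the starting point, so is_derive_right0 applies. *)
Lemma graph_curve_derive (g : R -> 'rV[R]_3) (w : 'rV[R]_3) (e : R) :
  0 < e -> is_derive (0 : R) 1 g w -> (forall s, 0 <= s < e -> M (g s)) ->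
  W (g 0) -> w 0 2 = 'D_(top w) f (top (g 0)).
Proof.
move=> e0 dg Mg Wg.
have Mg0 : M (g 0) by apply: Mg; rewrite lexx.
have [oW [oU [df _]] DU _ _] := G.
have [Dt ft] := graph_top Mg0 Wg.
have cg : {for (0 : R), continuous g}.
  by apply/differentiable_continuous/derivable1_diffP; case: dg.
have : \forall s \near (0 : R), W (g s).
  by apply: cg; exact: open_nbhs_nbhs.
move=> /nbhs_ballP[d /= d0 H].
pose m := Num.min d e.
have m0 : 0 < m by rewrite lt_min d0.
have d2 := (is_derive_rV g (0 : R) w).2 dg 2.
have df' : differentiable f (top (g 0)) by apply: df; apply: DU.
have d3 := is_derive_along (is_derive_top dg) df'.
have d4 := is_deriveB d2 d3.
apply/eqP; rewrite -subr_eq0; apply/eqP.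
apply: (is_derive_right0 m0 d4) => s /andP[s0 sm].
rewrite add0r in sm.
have [sd se] : s < d /\ s < e by move: sm; rewrite lt_min => /andP.
have Ws : W (g s) by apply: H; rewrite /ball/= sub0r normrN ger0_norm.
have Ms : M (g s) by apply: Mg; rewrite s0.
by have [_ fs] := graph_top Ms Ws; rewrite !fctE /= fs subrr.
Qed.

End GraphOn.

Lemma near2_derive n (f1 f2 : 'rV[R]_n -> R) (y v w : 'rV[R]_n) :
  (\near y, f1 y = f2 y) -> 'D_v ('D_w f1) y = 'D_v ('D_w f2) y.
Proof.
move=> H; apply: near_eq_derive.
have := near_join H; apply: filterS => z; exact: near_eq_derive.
Qed.

(** Two graph representations have the same second derivatives, also at a
    boundary point, which is a limit of points where the graphs agree on an open
    set. *)
Lemma local_graph_hess M q f1 f2 v w : M q ->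
  local_graph M q f1 -> local_graph M q f2 ->
  'D_v ('D_w f1) (top q) = 'D_v ('D_w f2) (top q).
Proof.
move=> Mq /local_graphP[W1 [U1 [D1 [W1q G1]]]] /local_graphP[W2 [U2 [D2 [W2q G2]]]].
have [Dq1 fq1] := graph_top G1 Mq W1q.
have [Dq2 fq2] := graph_top G2 Mq W2q.
have [oW1 [oU1 C1] DU1 DD1 _] := G1.
have [oW2 [oU2 C2] DU2 DD2 _] := G2.
have cf1 : {for top q, continuous (lift3 f1)}.
  by apply: continuous_lift3; apply: Cr_cont C1 _; exact: DU1.
have : \forall y \near top q, W2 (lift3 f1 y).
  by apply: cf1; rewrite lift3_top//; exact: open_nbhs_nbhs.
move=> /nbhs_ballP[r /= r0 H].
apply: (@eq_on_closure R _ (ball (top q) r) D1° ('D_v ('D_w f1)) ('D_v ('D_w f2)) (top q)).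
- exact: ball_open.
- exact: ballxx.
- exact: DD1.
- have [_ /(_ w)[_ /(_ v)]] := C1.
  by move/(Cr_cont (k := 1)); apply; exact: DU1.
- have [_ /(_ w)[_ /(_ v)]] := C2.
  by move/(Cr_cont (k := 1)); apply; exact: DU2.
move=> y By Dy; apply: near2_derive.
have nB : nbhs y (ball (top q) r) by apply: open_nbhs_nbhs; split => //; exact: ball_open.
have nD : nbhs y D1 by exact: Dy.
apply: filterS (filterI nB nD) => z [/H W2z D1z].
have [Mz _] := graph_lift G1 D1z.
by have [_] := graph_top G2 Mz W2z; rewrite top_lift3 ptE.
Qed.

End Graphs.

Section Curves.
Context {R : realType}.
Implicit Types (M : set 'rV[R]_3) (p q : 'rV[R]_3).

(** A coordinate line of a chart; its velocity does not vanish, as charts are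
    diffeomorphisms. *)
Lemma curve_param (c : set 'rV[R]_3) p : curve_without_endpoints c -> c p ->
  exists (g v : R -> 'rV[R]_3) (e : R),
    [/\ 0 < e, g 0 = p, v 0 != 0,
        forall s : R, `|s| < e -> {for s, continuous v}
      & forall s : R, `|s| < e -> c (g s) /\ is_derive s 1 g (v s)].
Proof.
move=> [_ _ _ sub] cp; have [h [W [W' [phi [psi [hb Wp chart]]]]]] := sub p cp.
have {hb} hF : h = false by case: h hb chart.
subst h.
have [[oW oW'] H1 H2 H3 H4] := chart.
have [W'p psip] := H1 p Wp.
have [e e0 He] := line_near (delta_mx 0 0) oW' W'p.
pose L s := phi p + s *: (delta_mx 0 0 : 'rV[R]_3).
have L0 : L 0 = phi p by rewrite /L scale0r addr0.
exists (fun s => psi (L s)), (fun s => 'D_(delta_mx 0 0) psi (L s)), e; split.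
- exact: e0.
- by rewrite L0.
- apply/eqP => E.
  have W'0 : W' (L 0) by rewrite L0.
  have := chart_inv_derive chart (delta_mx 0 0) W'0.
  rewrite E => /rowP/(_ 0); rewrite derive0 !mxE/= => /eqP.
  by rewrite eq_sym oner_eq0.
- move=> z ze; apply: continuous_rV => i.
  have W'z : W' (L z) by exact: He.
  have cL : {for z, continuous L}.
    apply: continuousD; first exact: cst_continuous.
    exact: scalel_continuous.
  have cD : {for L z, continuous ('D_(delta_mx 0 0) (fun q => psi q 0 i))}.
    by have [_ [_ /(_ (delta_mx 0 0))]] := H3 i; apply.
  have cc := continuous_comp cL cD.
  have nW : \forall s \near z, W' (L s).
    by apply: cL; exact: open_nbhs_nbhs.
  have E : \forall s \near z, ('D_(delta_mx 0 0) (fun q => psi q 0 i) \o L) s =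
     'D_(delta_mx 0 0) psi (L s) 0 i.
    by apply: filterS nW => s Ws /=; rewrite (chart_inv_coord chart).
  rewrite /prop_for /continuous_at (chart_inv_coord chart)//.
  by apply: cvg_trans (near_eq_cvg E) _; exact: cc.
- move=> s se; have W's := He s se.
  split; last exact: chart_line chart _ _ _ W's.
  apply: chart_mem chart _ W's _; split => // i i1.
  have [+ _] := (H4 p Wp).1 cp.
  move=> /(_ i i1) pi; rewrite !mxE pi add0r /=.
  by clear pi; case: i i1 => [[|i] hi] //= _; rewrite mulr0.
Qed.

(** At a boundary point, only one of v and - v points into the surface; hence
    the sign. *)
Lemma tangent_param M p v : M p -> tangent_plane M p v ->
  exists (g : R -> 'rV[R]_3) (w : 'rV[R]_3) (e : R),
    [/\ 0 < e, g 0 = p, w = v \/ w = - v, is_derive (0 : R) 1 g w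
      & forall s, 0 <= s < e -> M (g s)].
Proof.
move=> Mp [h [W [W' [phi [psi [Wp chart Dv]]]]]].
have [[oW oW'] H1 H2 H3 H4] := chart.
have [W'p psip] := H1 p Wp.
pose d := 'D_v phi p.
have [d' [dd' d'0]] : exists d', (d' = d \/ d' = - d) /\ 0 <= d' 0 0.
  have [d0|d0] := leP 0 (d 0 0); first by exists d; split => //; left.
  by exists (- d); split; [right|rewrite mxE oppr_ge0 ltW].
have [e e0 He] := line_near d' oW' W'p.
exists (fun s => psi (phi p + s *: d')), ('D_d' psi (phi p)), e; split.
- exact: e0.
- by rewrite scale0r addr0.
- have E : 'D_d psi (phi p) = v by exact: (chart_derive chart).
  case: dd' => ->; [by left|right].
  have dpsi := chart_inv_differentiable chart W'p.
  by rewrite deriveE// linearN/= -deriveE// E.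
- have := @chart_line _ _ _ _ _ _ _ _ _ _ chart (phi p) d' 0.
  by rewrite scale0r addr0; apply.
- move=> s /andP[s0 se].
  have W's : W' (phi p + s *: d') by apply: He; rewrite ger0_norm.
  apply: (chart_mem chart W's).
  have [pi ph] := (H4 p Wp).1 Mp.
  split => [i i2|hh].
    rewrite !mxE pi// add0r.
    have di : d 0 i = 0 by rewrite /d (chart_coord chart)//; exact: Dv.
    by case: dd' => ->; rewrite ?mxE di ?oppr0 mulr0.
  by rewrite !mxE addr_ge0// ?ph// mulr_ge0.
Qed.

Lemma graph_tangent M p f v : M p -> local_graph M p f ->
  tangent_plane M p v -> v 0 2 = 'D_(top v) f (top p).
Proof.
move=> Mp /local_graphP[W [U [D [Wp G]]]] tv.
have [g [w [e [e0 g0 wv dg Mg]]]] := tangent_param Mp tv.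
have Wg : W (g 0) by rewrite g0.
have := graph_curve_derive G e0 dg Mg Wg; rewrite g0.
have [Dp _] := graph_top G Mp Wp.
have df : differentiable f (top p).
  by have [_ [_ [df _]] DU _ _] := G; apply: df; apply: DU.
case: wv => ->//.
have -> : top (- v) = - top v by apply: rV2P; rewrite !mxE.
rewrite deriveE// linearN/= -deriveE// mxE => /eqP.
by rewrite eqr_opp => /eqP.
Qed.

Lemma derive_quadratic n (F : 'rV[R]_n -> R) (p v : 'rV[R]_n) (a l k : R) :
  differentiable F p -> (forall s, F (p + s *: v) = a + l * s + k * (s * s)) ->
  'D_v F p = l.
Proof.
move=> dF E.
have d1 : is_derive (0 : R) 1 (fun s => F (p + s *: v)) ('D_v F p).
  have := @is_derive_line _ _ F p v 0; rewrite scale0r addr0; apply.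
  exact: diff_derivable.
pose P : {poly R} := 'X * (l%:P + k%:P * 'X) + a%:P.
have d2 : is_derive (0 : R) 1 (horner P) l.
  have E0 : P^`().[0] = l by rewrite /P !(derivD, derivM, derivC, derivX) !hornerE.
  by rewrite -[X in is_derive _ _ _ X]E0; exact: is_derive_poly.
have EP : (fun s => F (p + s *: v)) = horner P.
  by apply/funext => s; rewrite E /P !(hornerD, hornerM, hornerX, hornerC); ring.
rewrite EP in d1.
by have [_ <-] := d1; have [_ E2] := d2.
Qed.

Definition quadric (A B C D : R) (q : 'rV[R]_3) : R :=
  (A * (q 0 0 * q 0 0 + q 0 1 * q 0 1) + B * q 0 0 + C * q 0 1 + D) * 2^-1.

Lemma Cr_quadric k A B C D : Cr k setT (quadric A B C D).
Proof.
have oT : open [set: 'rV[R]_3] by exact: openT.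
have Cx i : Cr k setT (fun q : 'rV[R]_3 => q 0 i) by exact: Cr_coord.
have Cc a : Cr k setT (fun _ : 'rV[R]_3 => a) by exact: Cr_cst.
apply: (Cr_mul oT) (Cc _); apply: (Cr_add oT) (Cc _).
apply: (Cr_add oT) (Cr_mul oT (Cc _) (Cx _)).
apply: (Cr_add oT) (Cr_mul oT (Cc _) (Cx _)).
apply: (Cr_mul oT (Cc _)); apply: (Cr_add oT); exact: (Cr_mul oT).
Qed.

(** Subtracting the quadratic polynomial is a global chart which flattens the
    sphere. *)
Lemma sphere_tangent (A B C D a b : R) p :
  tangent_plane (parabolic_sphere A B C D) p
    (pt3 a b (a * (A * p 0 0 + B / 2) + b * (A * p 0 1 + C / 2))).
Proof.
pose h := quadric A B C D.
pose phi q := pt3 (q 0 0) (q 0 1) (q 0 2 + (-1) * h q).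
pose psi q := pt3 (q 0 0) (q 0 1) (q 0 2 + h q).
have oT : open [set: 'rV[R]_3] by exact: openT.
have Cx i : Cr 1 setT (fun q : 'rV[R]_3 => q 0 i) by exact: Cr_coord.
have Ch : Cr 1 setT h by exact: Cr_quadric.
have Cphi : Cr 1 setT (fun q => q 0 2 + (-1) * h q).
  apply: (Cr_add oT (Cx 2)); apply: (Cr_mul oT _ Ch); exact: Cr_cst.
have Cpsi : Cr 1 setT (fun q => q 0 2 + h q) by exact: (Cr_add oT (Cx 2)).
have e0 q : phi q 0 0 = q 0 0 by rewrite ptE.
have e1 q : phi q 0 1 = q 0 1 by rewrite ptE.
have e2 q : phi q 0 2 = q 0 2 + (-1) * h q by rewrite ptE.
have f0 q : psi q 0 0 = q 0 0 by rewrite ptE.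
have f1 q : psi q 0 1 = q 0 1 by rewrite ptE.
have f2 q : psi q 0 2 = q 0 2 + h q by rewrite ptE.
exists false, setT, setT, phi, psi; split.
- by [].
- split.
  + by split.
  + by move=> q _; split => //; apply: rV3P; rewrite ?f0 ?f1 ?f2 ?e0 ?e1 ?e2 // /h /quadric !e0 !e1; ring.
  + by move=> q _; split => //; apply: rV3P; rewrite ?e0 ?e1 ?e2 ?f0 ?f1 ?f2 // /h /quadric !f0 !f1; ring.
  + apply: forall_I3; split.
    * exact: (Cr_ext oT (fun q _ => esym (e0 q)) (Cx 0)).
    * exact: (Cr_ext oT (fun q _ => esym (f0 q)) (Cx 0)).
    * exact: (Cr_ext oT (fun q _ => esym (e1 q)) (Cx 1)).
    * exact: (Cr_ext oT (fun q _ => esym (f1 q)) (Cx 1)).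
    * exact: (Cr_ext oT (fun q _ => esym (e2 q)) Cphi).
    * exact: (Cr_ext oT (fun q _ => esym (f2 q)) Cpsi).
  + move=> q _; rewrite /parabolic_sphere /=; split => [E|[E _]].
      split => //; apply: forall_I3 => //= _.
      by rewrite e2 /h /quadric; lra.
    by move: (E 2 isT); rewrite e2 /h /quadric; lra.
- apply: forall_I3 => //= _; rewrite (funext e2).
  have dphi : differentiable (fun q => q 0 2 + (-1) * h q) p by have [+ _] := Cphi; apply.
  apply: (derive_quadratic (a := p 0 2 - h p) (k := - (A * (a * a + b * b) * 2^-1)) dphi) => s.
  by rewrite /h /quadric !mxE /=; field.
Qed.

End Curves.

(** * Real analytic functions of one variable *)

Section AnalyticLine.
Context {R : realType}.
Implicit Types (I J : set R) (f g : R -> R) (a : nat -> R).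

(** Comparison with a geometric series: the terms a n K^n are bounded, and n + 1
    <= 2^n turns the factor 4^n into a ratio of one half. *)
Lemma cvg_pseries_diffs a (K : R) : cvgn (pseries a K) ->
  cvgn (pseries (pseries_diffs a) (K / 4)).
Proof.
move=> cK; have [->|K0] := eqVneq K 0.
  rewrite mul0r; apply/cvg_ex; exists (pseries_diffs a 0).
  rewrite -(cvg_shiftS _); apply: cvg_near_cst; near=> n.
  rewrite /pseries /series/= big_nat_recl//= expr0 mulr1 big1 ?addr0// => i _.
  by rewrite expr0n mulr0.
have [B [Breal Bb]] := cvg_series_bounded cK.
have {Bb}Bb n : `|a n * K ^+ n| <= `|B| + 1.
  by apply: (Bb (`|B| + 1)) => //; rewrite (le_lt_trans (ler_norm B))// ltrDl.
set C := `|B| + 1 in Bb.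
have C0 : 0 <= C by rewrite addr_ge0.
apply: normed_cvg.
apply: (@series_le_cvg R _ (geometric (C / `|K|) 2^-1)) => [n|n|n|].
- exact: normr_ge0.
- by rewrite /geometric/= mulr_ge0// ?divr_ge0// exprn_ge0// invr_ge0.
- rewrite /pseries_diffs /geometric/=.
  have -> : n.+1%:R * a n.+1 * (K / 4) ^+ n = (a n.+1 * K ^+ n.+1) * (n.+1%:R * (4 ^+ n)^-1 / K).
    by rewrite exprMn exprVn exprS; field; rewrite K0 expf_neq0.
  have -> : C / `|K| * 2^-1 ^+ n = C * (2^-1 ^+ n / `|K|) by ring.
  rewrite normrM; apply: ler_pM => //.
  rewrite normrM normfV ler_wpM2r ?invr_ge0//.
  rewrite ger0_norm ?divr_ge0// ?exprn_ge0//.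
  have -> : (4 : R) ^+ n = 2 ^+ n * 2 ^+ n by rewrite -exprMn; congr (_ ^+ n); ring.
  rewrite exprVn invfM mulrA ler_piMl ?invr_ge0 ?exprn_ge0//.
  rewrite ler_pdivrMr ?exprn_gt0// mul1r -natrX ler_nat.
  exact: ltn_expl.
- by apply: is_cvg_geometric_series; rewrite gtr0_norm// invf_lt1// ltr1n.
Unshelve. all: by end_near. Qed.

(** The radius is divided by 4 twice, since termwise differentiation also needs
    convergence of the second formal derivative. *)
Lemma is_derive_pseries a (K x : R) : cvgn (pseries a K) -> `|x| < `|K| / 16 ->
  cvgn (pseries (pseries_diffs a) x) /\
  is_derive x 1 (fun x => limn (pseries a x)) (limn (pseries (pseries_diffs a) x)).
Proof.
move=> cK xK.
have nK4 : `|K / 4 / 4| = `|K| / 16.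
  by rewrite !normrM normfV (ger0_norm (_ : 0 <= (4 : R)))//; field.
have c1 := cvg_pseries_diffs cK; have c2 := cvg_pseries_diffs c1.
have K0 : 0 < `|K|.
  by move: (le_lt_trans (normr_ge0 x) xK); lra.
have lt0 : `|K / 4 / 4| < `|K| by rewrite nK4; lra.
have lt1 : `|K / 4 / 4| < `|K / 4|.
  rewrite nK4 normrM normfV (ger0_norm (_ : 0 <= (4 : R)))//; lra.
have d0 := is_cvg_pseries_inside cK lt0.
have d1 := is_cvg_pseries_inside c1 lt1.
split; first by apply: (is_cvg_pseries_inside d1); rewrite nK4.
by apply: (pseries_snd_diffs d0 d1 c2); rewrite nK4.
Qed.

Lemma pseries_shift a m (x : R) : (forall k, (k < m)%N -> a k = 0) ->
  forall n, pseries a x (n + m)%N = x ^+ m * pseries (fun k => a (k + m)%N) x n.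
Proof.
move=> am; elim=> [|n IH].
  have -> : pseries (fun k => a (k + m)%N) x 0 = 0 by rewrite /pseries /series/= big_geq.
  rewrite add0n /pseries /series/= mulr0 big_nat big1// => i /andP[_ im].
  by rewrite am// mul0r.
rewrite addSn {1}/pseries /series/= big_nat_recr//= -[X in X + _]/(pseries a x (n + m)%N).
rewrite IH /pseries /series/= [in RHS]big_nat_recr//= mulrDr; congr (_ + _).
by rewrite exprD; ring.
Qed.

(** Unless all coefficients vanish, division by the lowest power of s - t which
    occurs leaves a power series which is continuous and nonzero at t. *)
Lemma analytic_dichotomy J f t : analytic_on J f -> J t ->
  (exists2 e, 0 < e & forall s, J s -> `|s - t| < e -> f s = 0) \/
  (exists2 e, 0 < e & forall s, J s -> 0 < `|s - t| < e -> f s != 0).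
Proof.
move=> fJ Jt; have [r [a [r0 fa]]] := fJ t Jt.
have [a0|/existsNP[k ak]] := pselect (forall k, a k = 0).
  left; exists r => // s Js st; apply/esym; have := fa s Js st.
  have -> : series (fun k => a k * (s - t) ^+ k) = cst 0.
    by apply/funext => n; rewrite /series/= big1// => i _; rewrite a0 mul0r.
  by move=> /(cvg_unique _ (cvg_cst _)); apply.
right.
have [[s1 [Js1 s1t]]|N] := pselect (exists s, J s /\ 0 < `|s - t| < r); last first.
  by exists r => // s Js str; exfalso; apply: N; exists s.
have exk : exists k, a k != 0 by exists k; apply/eqP.
pose m := ex_minn exk.
have [am mmin] : a m != 0 /\ forall k, (k < m)%N -> a k = 0.
  rewrite /m; case: ex_minnP => n an nmin; split => // i im; apply/eqP/negPn/negP => /nmin.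
  by rewrite leqNgt im.
pose b k := a (k + m)%N.
pose K := s1 - t.
have [K0 Kr] := andP s1t.
have Kn0 : K != 0 by rewrite -normr_gt0.
have cvgshift x : x != 0 -> cvgn (pseries a x) -> cvgn (pseries b x).
  move=> x0 ca.
  have -> : pseries b x = (fun n => (x ^+ m)^-1 * pseries a x (n + m)%N).
    by apply/funext => n; rewrite (pseries_shift x mmin) mulKf// expf_neq0.
  case/cvg_ex: ca => l cl; apply/cvg_ex; exists ((x ^+ m)^-1 * l).
  by apply: cvgM; [exact: cvg_cst|rewrite (cvg_shiftn m)].
have caK : cvgn (pseries a K) by apply/cvg_ex; exists (f s1); apply: fa.
have cbK := cvgshift K Kn0 caK.
pose g x := limn (pseries b x).
have g0 : g 0 = a m.
  apply/cvg_lim => //; rewrite -(cvg_shiftS _); apply: cvg_near_cst; near=> n.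
  rewrite /pseries /series/= big_nat_recl//= expr0 mulr1 big1 ?addr0// => i _.
  by rewrite expr0n mulr0.
have cg : {for (0 : R), continuous g}.
  apply/differentiable_continuous/derivable1_diffP.
  have [|_ []//] := @is_derive_pseries b K 0 cbK.
  by rewrite normr0 divr_gt0.
have gn0 : g 0 != 0 by rewrite g0.
have /nbhs_ballP[e /= e0 He] := near_neq0 cg gn0.
exists (Num.min e (Num.min r `|K|)); first by rewrite !lt_min e0 r0 K0.
move=> s Js /andP[st0]; rewrite !lt_min => /andP[se /andP[sr sK]].
have ca := fa s Js sr.
have sn0 : s - t != 0 by rewrite -normr_gt0.
have cb := cvgshift _ sn0 (cvgP _ ca).
have -> : f s = (s - t) ^+ m * g (s - t).
  have c1 : pseries a (s - t) (n + m)%N @[n --> \oo] --> f s.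
    by rewrite (cvg_shiftn m).
  have c2 : pseries a (s - t) (n + m)%N @[n --> \oo] --> (s - t) ^+ m * g (s - t).
    rewrite (funext (pseries_shift (s - t) mmin)).
    by apply: cvgM; [exact: cvg_cst|exact: cb].
  exact: (cvg_unique _ c1 c2).
rewrite mulf_neq0 ?expf_neq0//; apply: He.
by rewrite /ball/= sub0r normrN.
Unshelve. all: by end_near. Qed.

(** As f is not zero everywhere and J is connected, f vanishes near none of its
    zeros, which are thus isolated. *)
Lemma analytic_zeros_countable J f : is_interval J -> analytic_on J f ->
  (exists2 t, J t & f t != 0) -> countable [set t | J t /\ f t = 0].
Proof.
move=> iJ fJ [t1 Jt1 ft1].
pose near0 t e := 0 < e /\ forall s, J s -> `|s - t| < e -> f s = 0.
pose E := [set t | J t /\ exists e, near0 t e].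
have [[t0 Et0]|Eempty] := pselect (E !=set0).
  have EJ : E = J.
    have := (connected_intervalP J).2 iJ; apply.
    - by exists t0.
    - exists (\bigcup_(te in [set te : R * R | near0 te.1 te.2]) ball te.1 te.2).
        by apply: bigcup_open => te _; exact: ball_open.
      apply/seteqP; split=> [t [Jt [e [e0 He]]]|t [Jt [[u e] /= [e0 He] uet]]].
        by split => //; exists (t, e) => //; exact: ballxx.
      split => //; exists (e - `|u - t|); split; first by rewrite subr_gt0.
      move=> s Js st; apply: He => //.
      have -> : s - u = (s - t) + (t - u) by ring.
      rewrite (le_lt_trans (ler_normD _ _))// [`|t - u|]distrC.
      by rewrite -ltrBrDr.
    - exists (closure E); first exact: closed_closure.
      apply/seteqP; split=> [t Et|t [Jt cEt]].
        by split; [case: Et => //|exact: subset_closure Et].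
      split => //; case: (analytic_dichotomy fJ Jt) => [[e e0 He]|[e e0 He]].
        by exists e.
      have [s [[Js [d [d0 Hd]]] ste]] := cEt _ (nbhsx_ballx t e e0).
      have fs : f s = 0 by apply: Hd; rewrite ?subrr ?normr0.
      have [tes|tns] := eqVneq s t.
        by exists d; split => //; rewrite -tes.
      have := He s Js; rewrite fs eqxx normr_gt0 subr_eq0 tns/= distrC => /(_ ste).
      by [].
  have [_ [e [e0 He]]] : E t1 by rewrite EJ.
  by move: ft1; rewrite He ?eqxx// subrr normr0.
apply: sub_countable (countable_isolated [set t | J t /\ f t = 0]).
apply: subset_card_le => t [Jt ft]; split; first exact: mem_set.
case: (analytic_dichotomy fJ Jt) => [[e e0 He]|[e e0 He]].
  by exfalso; apply: Eempty; exists t; split => //; exists e.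
exists (ball t e); first exact: nbhsx_ballx.
apply/seteqP; split=> [s [/= ste [Js fs]]|s ->].
  apply/eqP/negPn/negP => st.
  have := He s Js; rewrite fs eqxx normr_gt0 subr_eq0 st/= distrC.
  by move=> /(_ ste).
by split; [exact: ballxx|].
Qed.

Lemma analytic_on_lin J f g (x y z : R) : analytic_on J f -> analytic_on J g ->
  analytic_on J (fun t => x * f t + y * g t + z).
Proof.
move=> fJ gJ t Jt; have [r [a [r0 fa]]] := fJ t Jt; have [r' [b [r'0 gb]]] := gJ t Jt.
exists (Num.min r r'), (fun k => x * a k + y * b k + (if k == 0%N then z else 0)).
split; first by rewrite lt_min r0.
move=> s Js; rewrite lt_min => /andP[/(fa s Js) ca /(gb s Js) cb].
have cz : series (fun k => (if k == 0%N then z else 0) * (s - t) ^+ k) @ \oo --> z.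
  rewrite -(cvg_shiftS _); apply: cvg_near_cst; near=> n.
  rewrite /series/= big_nat_recl//= expr0 mulr1 big1 ?addr0// => i _.
  by rewrite mul0r.
have -> : series (fun k => (x * a k + y * b k + (if k == 0%N then z else 0)) * (s - t) ^+ k) =
   (fun n => x * series (fun k => a k * (s - t) ^+ k) n + y * series (fun k => b k * (s - t) ^+ k) n
      + series (fun k => (if k == 0%N then z else 0) * (s - t) ^+ k) n).
  apply/funext => n; rewrite /series/= !mulr_sumr -!big_split/=.
  by apply: eq_bigr => i _; ring.
by apply: cvgD => //; apply: cvgD; (apply: cvgM; first exact: cvg_cst).
Unshelve. all: by end_near. Qed.

Lemma interior_interval I : is_interval I -> is_interval I°.
Proof.
move=> iI x y Ix Iy z /andP[xz zy].
have [->//|xz'] := eqVneq z x; have [->//|zy'] := eqVneq z y.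
have xz2 : x < z by rewrite lt_neqAle eq_sym xz'.
have zy2 : z < y by rewrite lt_neqAle zy'.
have : nbhs z `]x, y[%classic by apply: open_nbhs_nbhs; split; [exact: interval_open|rewrite /= in_itv/= xz2].
apply: filterS => w; rewrite /= in_itv/= => /andP[xw wy].
by apply: (iI x y); [exact: interior_subset|exact: interior_subset|rewrite !ltW].
Qed.

Lemma analytic_on_derive I f : analytic_on I f -> analytic_on I° (derive1 f).
Proof.
move=> fI t It; have [r [a [r0 fa]]] := fI t (interior_subset It).
have /nbhs_ballP[d /= d0 Hd] := It.
pose K := Num.min r d / 2.
have K0 : 0 < K by rewrite divr_gt0// lt_min r0.
have rd0 : 0 < Num.min r d by rewrite lt_min r0.
have [Kr Kd] : K < r /\ K < d.
  by split; rewrite /K ltr_pdivrMr// gt_min; apply/orP; [left|right]; lra.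
have inI s : `|s - t| < K -> I s.
  by move=> st; apply: Hd; rewrite /ball/= distrC (lt_trans st).
have cK : cvgn (pseries a K).
  have E : t + K - t = K by ring.
  have Kt : `|t + K - t| < r by rewrite E gtr0_norm.
  have := fa (t + K) (Hd _ _) Kt; rewrite E => H.
  apply/cvg_ex; exists (f (t + K)); apply: H.
  by rewrite /ball/= opprD addNKr normrN gtr0_norm.
exists (K / 16), (pseries_diffs a); split; first by rewrite divr_gt0.
move=> s Js st.
have st' : `|s - t| < `|K| / 16 by rewrite (gtr0_norm K0).
have [c dd] := is_derive_pseries cK st'.
have -> : derive1 f s = limn (pseries (pseries_diffs a) (s - t)); last exact: c.
have d1 : is_derive s 1 (fun s => s - t) 1.
  by apply: is_derive_eq; rewrite subr0.
have d2 := @is_derive1_comp _ (fun x => limn (pseries a x)) (fun s => s - t) s _ _ dd d1.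
rewrite mulr1 in d2.
rewrite derive1E -[RHS](@derive_val _ _ _ _ _ _ _ d2).
apply: near_eq_derive.
have : nbhs s (ball t K).
  apply: open_nbhs_nbhs; split; first exact: ball_open.
  rewrite /ball/= distrC; apply: lt_trans st _; lra.
apply: filterS => w; rewrite /ball/= distrC => wt.
apply/esym/cvg_lim => //; apply: fa; [exact: inI|exact: lt_trans wt Kr].
Qed.

End AnalyticLine.

Local Notation D0 f := (derive f ^~ (delta_mx 0 0)).
Local Notation D1 f := (derive f ^~ (delta_mx 0 1)).

(** * Characteristics are meager *)

(** If no F n had interior points in a smaller closed ball, the complements
    would be open and dense there, and by the Baire property some point would
    lie in no F n. *)
Lemma Baire_nat (R : realType) (V : completeNormedModType R) (F : nat -> set V)
    (x : V) (r : R) : 0 < r -> (forall n, closed (F n)) ->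
  ball x r `<=` \bigcup_n F n ->
  exists n y (e : R), 0 < e /\ ball y e `<=` F n `&` ball x r.
Proof.
move=> r0 cF cov; apply: contrapT => N.
pose B : set V := closed_ball x (r / 2).
have r20 : 0 < r / 2 by rewrite divr_gt0.
have Bx : B `<=` ball x r.
  move=> y; rewrite /B closed_ballE// /closed_ball_/= -ball_normE /ball_/= => yx.
  by apply: (le_lt_trans yx); lra.
pose U n := ~` (F n `&` B).
have oU n : open (U n) /\ dense (U n).
  split; first by apply: closed_openC; apply: closedI => //; exact: closed_ball_closed.
  move=> O [w Ow] opO; apply: contrapT => nO.
  apply: N; have /nbhs_ballP[e /= e0 He] := open_nbhs_nbhs (conj opO Ow).
  exists n, w, e; split => // z /He Oz.
  suff [Fz Bz] : (F n `&` B) z by split => //; exact: Bx.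
  by apply: contrapT => nz; apply: nO; exists z.
have [||y [xy Uy]] := @Baire R V U oU (ball x (r / 2)).
- by exists x; exact: ballxx.
- exact: ball_open.
have [n _ Fy] : (\bigcup_n F n) y.
  apply: cov; apply: le_ball xy; lra.
apply: (Uy n I); split => //.
by apply: subset_closed_ball.
Qed.

Lemma Baire_countable (R : realType) (V : completeNormedModType R)
    (T : pointedType) (N : set T) (F : T -> set V) (x : V) (r : R) :
  0 < r -> countable N -> (forall t, N t -> closed (F t)) ->
  ball x r `<=` \bigcup_(t in N) F t ->
  exists t y (e : R), [/\ N t, 0 < e & ball y e `<=` F t `&` ball x r].
Proof.
move=> r0 /countable_injP[g ginj] cF cov.
pose G n := \bigcup_(t in [set t | N t /\ g t = n]) F t.
have GE n : G n = set0 \/ exists t, N t /\ G n = F t.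
  have [[t [Nt gt]]|H] := pselect (exists t, N t /\ g t = n); last first.
    left; apply/seteqP; split=> // y [t [Nt gt] _]; apply: H; by exists t.
  right; exists t; split => //; apply/seteqP; split=> [y [s [Ns gs] Fs]|y Fy].
    by have -> : t = s by apply: ginj; rewrite ?inE// gt gs.
  by exists t.
have cG n : closed (G n).
  by case: (GE n) => [->|[t [Nt ->]]]; [exact: closed0|exact: cF].
have [|n [y [e [e0 He]]]] := @Baire_nat R V G x r r0 cG.
  by move=> y /cov[t Nt Ft]; exists (g t) => //; exists t.
case: (GE n) => [E|[t [Nt E]]].
  by have := He y (ballxx _ e0); rewrite E => -[].
by exists t, y, e; split => //; rewrite -E.
Qed.

(* Matrices over the reals are complete and normed; this joins both structures. *)
HB.instance Definition _ (R : realType) m n := Complete.on 'M[R]_(m, n).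

Section Channel.
Context {R : realType}.
Variables (M : set 'rV[R]_3) (I : set R) (A B C D : R -> R) (c : R -> set 'rV[R]_3).
Hypothesis cc : forall t, I t -> curve_without_endpoints (c t).
Hypothesis ct : forall t, I t -> forall p, c t p ->
  tangent_at M (parabolic_sphere (A t) (B t) (C t) (D t)) p.

Lemma channel_sub t p : I t -> c t p -> M p.
Proof. by move=> It /(ct It)[]. Qed.

(** Equal tangent planes have equal slopes, and the slopes of a sphere are
    explicit. *)
Lemma channel_graph t p f : I t -> c t p -> local_graph M p f ->
  [/\ D0 f (top p) = A t * p 0 0 + B t / 2,
      D1 f (top p) = A t * p 0 1 + C t / 2
    & 2 * p 0 2 = A t * (p 0 0 ^+ 2 + p 0 1 ^+ 2) + B t * p 0 0 + C t * p 0 1 + D t].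
Proof.
move=> It cp lf; have [Mp Sp TE] := ct It cp.
have df : differentiable f (top p).
  case/local_graphP : lf => W [U [E [Wp G]]]; have [Dp _] := graph_top G Mp Wp.
  by have [_ [_ [df _]] DU _ _] := G; apply: df; apply: DU.
have tan a b : a * (A t * p 0 0 + B t / 2) + b * (A t * p 0 1 + C t / 2) =
    a * D0 f (top p) + b * D1 f (top p).
  have := @sphere_tangent R (A t) (B t) (C t) (D t) a b p.
  rewrite -TE => /(graph_tangent Mp lf); rewrite pt3_2 => ->.
  by rewrite derive_coord2// !ptE.
split => //.
- by have := tan 1 0; rewrite !mul1r !mul0r !addr0 => ->.
- by have := tan 0 1; rewrite !mul1r !mul0r !add0r => ->.
Qed.

(** The gradient of the graph minus that of the sphere vanishes along the
    characteristic, so the tangent of the characteristic is an eigenvector of the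
    Hessian. *)
Lemma channel_eigen t W U E f (g : R -> 'rV[R]_3) (w : 'rV[R]_3) (e : R) :
  graph_on M W U E f -> I t -> 0 < e -> is_derive (0 : R) 1 g w ->
  (forall s, 0 <= s < e -> c t (g s)) -> W (g 0) ->
  let u := top (g 0) in
  [/\ w 0 2 = w 0 0 * D0 f u + w 0 1 * D1 f u,
      w 0 0 * D0 (D0 f) u + w 0 1 * D1 (D0 f) u = A t * w 0 0
    & w 0 0 * D0 (D1 f) u + w 0 1 * D1 (D1 f) u = A t * w 0 1].
Proof.
move=> G It e0 dg cg Wg u.
have c0 : c t (g 0) by apply: cg; rewrite lexx.
have Mg s : 0 <= s < e -> M (g s) by move=> /cg; exact: channel_sub.
have M0 : M (g 0) by apply: channel_sub c0.
have [Du _] := graph_top G M0 Wg.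
have [oW [oU [df Df]] DU _ _] := G.
have Uu := DU _ Du.
have contg : {for (0 : R), continuous g}.
  by apply/differentiable_continuous/derivable1_diffP; case: dg.
have : \forall s \near (0 : R), W (g s).
  by apply: contg; exact: open_nbhs_nbhs.
move=> /nbhs_ballP[d /= d0 Hd].
pose m := Num.min d e.
have m0 : 0 < m by rewrite lt_min d0.
have Wc s : 0 <= s < 0 + m -> W (g s) /\ c t (g s).
  rewrite add0r => /andP[s0]; rewrite lt_min => /andP[sd se]; split.
    by apply: Hd; rewrite /ball/= sub0r normrN ger0_norm.
  by apply: cg; rewrite s0.
have dgi := (is_derive_rV g (0 : R) w).2 dg.
have eig (i : 'I_2) (j : 'I_3) b :
    (forall s, 0 <= s < 0 + m -> 'D_(delta_mx 0 i) f (top (g s)) = A t * g s 0 j + b) ->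
    w 0 0 * D0 ('D_(delta_mx 0 i) f) u + w 0 1 * D1 ('D_(delta_mx 0 i) f) u = A t * w 0 j.
  move=> H.
  have dF : differentiable ('D_(delta_mx 0 i) f) (top (g 0)).
    by have [+ _] := Df (delta_mx 0 i); apply.
  have d1 := is_derive_along (is_derive_top dg) dF.
  have d2 := is_deriveD (is_deriveZ (A t) (dgi j)) (is_derive_cst b (0 : R) 1).
  have d3 := is_deriveB d1 d2.
  have := is_derive_right0 m0 d3.
  rewrite addr0 derive_coord2// !ptE => /(_ _)/eqP; rewrite subr_eq0 => /(_ _)/eqP; apply.
  by move=> s sm; rewrite !fctE /= H// subrr.
have gr s : 0 <= s < 0 + m -> D0 f (top (g s)) = A t * g s 0 0 + B t / 2 /\
    D1 f (top (g s)) = A t * g s 0 1 + C t / 2.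
  move=> /Wc[Ws cs]; have Ms := channel_sub It cs.
  by have [] := channel_graph It cs (graph_local G Ms Ws).
split.
- rewrite (graph_curve_derive G e0 dg Mg Wg) derive_coord2; last exact: df.
  by rewrite !ptE.
- by apply: (eig 0 0 (B t / 2)) => s /gr[].
- by apply: (eig 1 1 (C t / 2)) => s /gr[].
Qed.

(** Both coordinate directions of the graph would be tangent to the
    characteristic, hence proportional to a single vector. *)
Lemma curve_no_interior t W U E f y (r : R) : graph_on M W U E f -> I t -> 0 < r ->
  ball y r `<=` E -> ~ (forall u, ball y r u -> c t (lift3 f u)).
Proof.
move=> G It r0 BE H.
have [oW [oU [df Df]] DU _ _] := G.
have Uy : U y by apply: DU; apply: BE; exact: ballxx.
have cp : c t (lift3 f y) by apply: H; exact: ballxx.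
have [_ _ _ sub] := cc It.
have [h [W1 [W' [phi [psi [hb Wp chart]]]]]] := sub _ cp.
have {hb} hF : h = false by case: h hb chart.
subst h.
have [[oW1 oW'] H1 H2 H3 H4] := chart.
have dphi := chart_differentiable chart Wp.
have [W'p psip] := H1 _ Wp.
have dpsi := chart_inv_differentiable chart W'p.
pose z := 'D_(delta_mx 0 0) psi (phi (lift3 f y)).
have key (j : 'I_2) : exists l : R,
    pt3 ((delta_mx 0 j : 'rV[R]_2) 0 0) ((delta_mx 0 j : 'rV[R]_2) 0 1) ('D_(delta_mx 0 j) f y) = l *: z.
  set ej : 'rV[R]_2 := delta_mx 0 j.
  set w := pt3 _ _ _.
  pose g s := lift3 f (y + s *: ej).
  have g0 : g 0 = lift3 f y by rewrite /g scale0r addr0.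
  have dg : is_derive (0 : R) 1 g w.
    apply/is_derive_rV; apply: forall_I3.
    - rewrite ptE; have -> : (fun s => g s 0 0) = (fun s => (y + s *: ej) 0 0).
        by apply/funext => s; rewrite ptE.
      have := @is_derive_line R _ (fun q : 'rV[R]_2 => q 0 0) y ej 0.
      by rewrite derive_coordinate; apply; exact/diff_derivable/differentiable_coord.
    - rewrite ptE; have -> : (fun s => g s 0 1) = (fun s => (y + s *: ej) 0 1).
        by apply/funext => s; rewrite ptE.
      have := @is_derive_line R _ (fun q : 'rV[R]_2 => q 0 1) y ej 0.
      by rewrite derive_coordinate; apply; exact/diff_derivable/differentiable_coord.
    - rewrite ptE; have -> : (fun s => g s 0 2) = (fun s => f (y + s *: ej)).
        by apply/funext => s; rewrite ptE.
      have := @is_derive_line R _ f y ej 0.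
      by rewrite scale0r addr0; apply; exact/diff_derivable/df.
  have cg : {for (0 : R), continuous g}.
    by apply/differentiable_continuous/derivable1_diffP; case: dg.
  have : \forall s \near (0 : R), W1 (g s).
    by apply: cg; rewrite g0; exact: open_nbhs_nbhs.
  move=> /nbhs_ballP[d /= d0 Hd].
  have [e e0 He] : exists2 e : R, 0 < e & forall s, `|s| < e -> ball y r (y + s *: ej).
    by apply: line_near; [exact: ball_open|exact: ballxx].
  have m0 : 0 < Num.min d e by rewrite lt_min d0.
  have Di (i : 'I_3) : (0 < i)%N -> 'D_w phi (lift3 f y) 0 i = 0.
    move=> i0; rewrite (chart_coord chart)// -g0.
    have dF : differentiable (fun q => phi q 0 i) (g 0).
      by rewrite g0; have [[+ _] _] := H3 i; apply.
    apply: (is_derive_right0 m0 (is_derive_along dg dF)) => s.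
    rewrite add0r => /andP[s0]; rewrite lt_min => /andP[sd se].
    have W1s : W1 (g s) by apply: Hd; rewrite /ball/= sub0r normrN ger0_norm.
    have cs : c t (g s) by apply: H; apply: He; rewrite ger0_norm.
    by have [/(_ i i0)] := (H4 _ W1s).1 cs.
  have := chart_derive chart w Wp.
  set d' := 'D_w phi _ in Di *.
  have -> : d' = d' 0 0 *: delta_mx 0 0.
    apply: rV3P; rewrite !mxE/= ?mulr1 ?mulr0 //; exact: Di.
  move=> <-; exists (d' 0 0).
  by rewrite /z deriveE// linearZ/= -deriveE.
have [l0 E0] := key 0; have [l1 E1] := key 1.
have := congr1 (fun q : 'rV[R]_3 => q 0 0) E0; have := congr1 (fun q : 'rV[R]_3 => q 0 1) E0.
have := congr1 (fun q : 'rV[R]_3 => q 0 1) E1.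
rewrite !ptE => e1 e2 e3; rewrite !mxE /= in e1 e2 e3.
have : (l0 * z 0 0) * (l1 * z 0 1) = 1 by rewrite -e1 -e3 mulr1.
have -> : (l0 * z 0 0) * (l1 * z 0 1) = (l0 * z 0 1) * (l1 * z 0 0) by ring.
by rewrite -e2 mul0r => /esym/eqP; rewrite oner_eq0.
Qed.

Lemma closed_trace t W U E f y (r r' : R) : graph_on M W U E f -> I t ->
  0 < r' < r -> ball y r `<=` E ->
  closed [set u | closed_ball y r' u /\ c t (lift3 f u)].
Proof.
move=> G It /andP[r'0 r'r] BE u clu.
have [oW [oU Cf] DU _ _] := G.
have BB : closed_ball y r' `<=` ball y r.
  move=> z; rewrite closed_ballE// /closed_ball_/= -ball_normE /ball_/= => yx.
  exact: (le_lt_trans yx).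
have Bu : closed_ball y r' u.
  apply: closed_ball_closed => V /clu[z [[Bz _] Vz]]; by exists z.
have Uu : U u by apply: DU; apply: BE; exact: BB.
split => //.
have [_ _ cct _] := cc It; apply: cct => V nV.
have cl : {for u, continuous (lift3 f)} by apply: continuous_lift3; exact: Cr_cont Cf Uu.
by have [z [[_ cz] Vz]] := clu _ (cl _ nV); exists (lift3 f z).
Qed.

(** A characteristic is closed and has no interior in the surface, so the Baire
    property applies. *)
Lemma characteristics_meager (N : set R) W U E f y (r : R) :
  graph_on M W U E f -> 0 < r -> ball y r `<=` E -> countable N -> N `<=` I ->
  ~ (forall u, ball y r u -> exists2 t, N t & c t (lift3 f u)).
Proof.
move=> G r0 BE cN NI H.
pose r' := r / 2.
have r'0 : 0 < r' by rewrite divr_gt0.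
have r'r : 0 < r' < r by rewrite r'0 /r'; lra.
pose F t := [set u | closed_ball y r' u /\ c t (lift3 f u)].
have cF t : N t -> closed (F t) by move=> /NI It; exact: (closed_trace G It r'r BE).
have sub z : ball y r' z -> ball y r z by apply: le_ball; rewrite /r'; lra.
have [|t [z [e [Nt e0 He]]]] := @Baire_countable R 'rV[R]_2 R N F y r' r'0 cN cF.
  move=> u yu; have [|t Nt ctu] := H u; first exact: sub.
  by exists t => //; split => //; exact: subset_closed_ball.
apply: (@curve_no_interior t W U E f z e G (NI _ Nt) e0).
  by move=> u /He[_ Bu]; apply: BE; exact: sub.
by move=> u /He[[]].
Qed.

End Channel.

(** * Envelopes governed by a curvature relation *)

Section ContinuityAt.
Context {R : realType} {T : topologicalType}.
Implicit Types (x : T) (f g : T -> R).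

Lemma contAdd x f g : {for x, continuous f} -> {for x, continuous g} ->
  {for x, continuous (fun y => f y + g y)}.
Proof. exact: continuousD. Qed.

Lemma contSub x f g : {for x, continuous f} -> {for x, continuous g} ->
  {for x, continuous (fun y => f y - g y)}.
Proof. exact: continuousB. Qed.

Lemma contMul x f g : {for x, continuous f} -> {for x, continuous g} ->
  {for x, continuous (fun y => f y * g y)}.
Proof. exact: continuousM. Qed.

Lemma contCst x (a : R) : {for x, continuous (fun _ : T => a)}.
Proof. exact: cst_continuous. Qed.

Lemma contDiv x f g : {for x, continuous f} -> {for x, continuous g} -> g x != 0 ->
  {for x, continuous (fun y => f y / g y)}.
Proof. by move=> cf cg g0; apply: contMul => //; exact: continuousV. Qed.

Lemma contComp x (h : R -> R) g : {for g x, continuous h} -> {for x, continuous g} ->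
  {for x, continuous (fun y => h (g y))}.
Proof. by move=> ch cg; exact: (continuous_comp cg ch). Qed.

End ContinuityAt.

Lemma derivable_cont (R : realType) (f : R -> R) (x : R) l : is_derive x 1 f l ->
  {for x, continuous f}.
Proof. by case=> df _; apply/differentiable_continuous/derivable1_diffP. Qed.

Section DerivativeRules.
Context {R : realType}.
Implicit Types (f g : R -> R) (x l m : R).

Lemma derAdd f g x l m : is_derive x 1 f l -> is_derive x 1 g m ->
  is_derive x 1 (fun t => f t + g t) (l + m).
Proof. exact: is_deriveD. Qed.

Lemma derSub f g x l m : is_derive x 1 f l -> is_derive x 1 g m ->
  is_derive x 1 (fun t => f t - g t) (l - m).
Proof. exact: is_deriveB. Qed.

Lemma derMul f g x l m : is_derive x 1 f l -> is_derive x 1 g m ->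
  is_derive x 1 (fun t => f t * g t) (l * g x + f x * m).
Proof.
move=> df dg; apply: (is_derive_eq (is_deriveM df dg)).
by rewrite addrC; congr (_ + _); exact: mulrC.
Qed.

Lemma derCst x (a : R) : is_derive x 1 (fun _ : R => a) 0.
Proof. exact: is_derive_cst. Qed.

Lemma derScale (a : R) f x l : is_derive x 1 f l -> is_derive x 1 (fun t => a * f t) (a * l).
Proof. by move=> df; apply: (is_derive_eq (derMul (derCst x a) df)); rewrite mul0r add0r. Qed.

Lemma derComp f g x l m : is_derive (g x) 1 f l -> is_derive x 1 g m ->
  is_derive x 1 (fun t => f (g t)) (l * m).
Proof. by move=> df dg; exact: (@is_derive1_comp _ f g). Qed.

Lemma derDiv f g x l m : is_derive x 1 f l -> is_derive x 1 g m -> g x != 0 ->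
  is_derive x 1 (fun t => f t / g t) ((l * g x - f x * m) / g x ^+ 2).
Proof.
move=> df dg g0; have dV := is_deriveV g0 dg.
apply: (is_derive_eq (derMul df dV)).
have -> : - g x ^- 2 *: m = - (g x ^- 2 * m) by exact: mulNr.
by field.
Qed.

End DerivativeRules.

Section CircleFamily.
Context {R : realType}.
Variables (V : set 'rV[R]_2) (k : 'rV[R]_2 -> R) (a b : R).
Variables (b1 b2 d b1' b2' d' : R -> R).
Hypothesis oV : open V.
Hypothesis dk : forall u, V u -> differentiable k u.
Hypothesis kab : forall u, V u -> a < k u < b.
Hypothesis db1 : forall s, a < s < b -> is_derive s 1 b1 (b1' s).
Hypothesis db2 : forall s, a < s < b -> is_derive s 1 b2 (b2' s).
Hypothesis dd : forall s, a < s < b -> is_derive s 1 d (d' s).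
Hypothesis cb1 : forall s, a < s < b -> {for s, continuous b1'}.
Hypothesis cb2 : forall s, a < s < b -> {for s, continuous b2'}.
Hypothesis cd : forall s, a < s < b -> {for s, continuous d'}.

(** The family 2 z = s (x^2 + y^2) + B x + C y + D, parametrised by its
    curvature s, touches its envelope where the derivative by s vanishes. Here 2
    b1, 2 b2 and d stand for the derivatives of B, C and D, so this is the
    equation of the top view of a characteristic, with centre - (b1 s, b2 s). *)
Definition circle (s : R) (u : 'rV[R]_2) : R :=
  u 0 0 ^+ 2 + u 0 1 ^+ 2 + 2 * b1 s * u 0 0 + 2 * b2 s * u 0 1 + d s.

Definition circle' (s : R) (u : 'rV[R]_2) : R :=
  2 * b1' s * u 0 0 + 2 * b2' s * u 0 1 + d' s.

Hypothesis Q0 : forall u, V u -> circle (k u) u = 0.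

Local Notation kx := ('D_(delta_mx 0 0) k).
Local Notation ky := ('D_(delta_mx 0 1) k).

Lemma is_derive_coord_line (u v : 'rV[R]_2) i :
  is_derive (0 : R) 1 (fun s => (u + s *: v) 0 i) (v 0 i).
Proof.
have := @is_derive_line R _ (fun q : 'rV[R]_2 => q 0 i) u v 0.
by rewrite derive_coordinate; apply; exact/diff_derivable/differentiable_coord.
Qed.

Lemma is_derive_k_line u v (h : R -> R) l : V u -> is_derive (k u) 1 h l ->
  is_derive (0 : R) 1 (fun s => h (k (u + s *: v))) (l * 'D_v k u).
Proof.
move=> Vu dh.
have dkl : is_derive (0 : R) 1 (fun s => k (u + s *: v)) ('D_v k u).
  have := @is_derive_line R _ k u v 0.
  by rewrite scale0r addr0; apply; exact/diff_derivable/dk.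
have dh' : is_derive (k (u + 0 *: v)) 1 h l by rewrite scale0r addr0.
exact: (@is_derive1_comp _ h (fun s => k (u + s *: v)) 0 l _ dh' dkl).
Qed.

(** Implicit differentiation of circle (k u) u = 0. *)
Lemma circle_gradient u : V u ->
  2 * (u 0 0 + b1 (k u)) + circle' (k u) u * kx u = 0 /\
  2 * (u 0 1 + b2 (k u)) + circle' (k u) u * ky u = 0.
Proof.
move=> Vu; have ku := kab Vu.
suff H (v : 'rV[R]_2) : 2 * (u 0 0 + b1 (k u)) * v 0 0 + 2 * (u 0 1 + b2 (k u)) * v 0 1
    + circle' (k u) u * 'D_v k u = 0.
  split; first by have := H (delta_mx 0 0); rewrite !mxE/= mulr1 mulr0 addr0.
  by have := H (delta_mx 0 1); rewrite !mxE/= mulr1 mulr0 add0r.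
have dx := is_derive_coord_line u v 0; have dy := is_derive_coord_line u v 1.
have e1 := is_derive_k_line v Vu (db1 ku).
have e2 := is_derive_k_line v Vu (db2 ku).
have e3 := is_derive_k_line v Vu (dd ku).
have D := derAdd (derAdd (derAdd (derAdd (derMul dx dx) (derMul dy dy))
   (derMul (derScale 2 e1) dx)) (derMul (derScale 2 e2) dy)) e3.
have [e e0 He] := line_near v oV Vu.
have := is_derive_right0 e0 D.
rewrite /= scale0r addr0 => <-.
  by rewrite /circle'; ring.
move=> s /andP[s0 se]; rewrite add0r in se.
have Vs : V (u + s *: v) by apply: He; rewrite ger0_norm.
by rewrite -(Q0 Vs) /circle; ring.
Qed.

Lemma cont_circle' s0 u0 : a < s0 < b ->
  {for (s0, u0), continuous (fun z : R * 'rV[R]_2 => circle' z.1 z.2)}.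
Proof.
move=> sab; rewrite /circle'.
have c1 : {for (s0, u0), continuous (fun z : R * 'rV[R]_2 => z.1)} by exact: cvg_fst.
have c2 : {for (s0, u0), continuous (fun z : R * 'rV[R]_2 => z.2)} by exact: cvg_snd.
have cx i : {for (s0, u0), continuous (fun z : R * 'rV[R]_2 => z.2 0 i)}.
  by apply: (@continuous_comp _ _ _ _ (fun q : 'rV[R]_2 => q 0 i) _ c2); exact: coord_continuous.
have cc (h : R -> R) : {for s0, continuous h} ->
    {for (s0, u0), continuous (fun z : R * 'rV[R]_2 => h z.1)}.
  by move=> ch; apply: (@continuous_comp _ _ _ _ h _ c1).
apply: contAdd; last by apply: cc; exact: cd.
by apply: contAdd; (apply: contMul; last exact: cx);
  (apply: contMul; first exact: contCst); apply: cc; [exact: cb1|exact: cb2].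
Qed.

Lemma is_derive_circle s u : a < s < b ->
  is_derive s 1 (fun s => circle s u) (circle' s u).
Proof.
move=> sab.
have D := derAdd (derAdd (derAdd (derCst s (u 0 0 ^+ 2 + u 0 1 ^+ 2))
   (derScale (2 * u 0 0) (db1 sab))) (derScale (2 * u 0 1) (db2 sab))) (dd sab).
have -> : (fun s => circle s u) = (fun t => u 0 0 ^+ 2 + u 0 1 ^+ 2 +
    2 * u 0 0 * b1 t + 2 * u 0 1 * b2 t + d t).
  by apply/funext => t; rewrite /circle; ring.
by apply: (is_derive_eq D); rewrite /circle'; ring.
Qed.

(** Where circle' does not vanish, circle is injective in s by the mean value
    theorem, so that k is determined by its equation. *)
Lemma circle_inverse u0 : V u0 -> circle' (k u0) u0 != 0 ->
  exists2 e : R, 0 < e & forall (s : R) (u : 'rV[R]_2), `|s - k u0| < e -> ball u0 e u -> circle s u = 0 ->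
    V u /\ k u = s.
Proof.
move=> Vu0 q0; have kab0 := kab Vu0.
have /nbhs_ballP[r /= r0 Hr] := near_neq0 (cont_circle' (u0 := u0) kab0) q0.
have inab : nbhs (k u0) `]a, b[%classic.
  by apply: open_nbhs_nbhs; split; [exact: interval_open|rewrite /= in_itv].
have /nbhs_ballP[r1 /= r10 Hr1] := inab.
have /nbhs_ballP[r2 /= r20 Hr2] := open_nbhs_nbhs (conj oV Vu0).
have ck := differentiable_continuous (dk Vu0).
pose m := Num.min r r1.
have m0 : 0 < m by rewrite lt_min r0.
have /nbhs_ballP[r3 /= r30 Hr3] := near_continuous ck m0.
exists (Num.min m (Num.min r2 r3)); first by rewrite !lt_min r0 r10 r20 r30.
move=> s u; rewrite lt_min => /andP[sm _] Bu Qs.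
have Vu : V u by apply: Hr2; apply: le_ball Bu; rewrite !ge_min lexx !orbT.
have kum : `|k u - k u0| < m.
  by rewrite distrC; apply: Hr3; apply: le_ball Bu; rewrite !ge_min lexx !orbT.
split => //; apply/eqP/negPn/negP => ks.
have nz t : `|t - k u0| < m -> circle' t u != 0.
  rewrite lt_min => /andP[tr _]; apply: (Hr (t, u)); split => /=.
    by rewrite /ball/= distrC.
  by apply: le_ball Bu; rewrite !ge_min lexx.
have ab t : `|t - k u0| < m -> a < t < b.
  rewrite lt_min => /andP[_ tr].
  by have /= := Hr1 t; rewrite in_itv/=; apply; rewrite /ball/= distrC.
have between (x y t : R) : `|x - k u0| < m -> `|y - k u0| < m -> x <= t <= y -> `|t - k u0| < m.
  by rewrite !ltr_norml; lra.
have Rolle2 (x y : R) : `|x - k u0| < m -> `|y - k u0| < m -> x < y ->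
    circle x u = 0 -> circle y u = 0 -> False.
  move=> xm ym xy Qx Qy.
  have [|t txy] := @mean_value _ (fun t => circle t u) (fun t => circle' t u) x y xy.
    by move=> t txy; apply: is_derive_circle; apply: ab; exact: between txy.
  rewrite Qx Qy subrr => /esym/eqP; rewrite mulf_eq0 subr_eq0 (gt_eqF xy) orbF.
  apply/negP; apply: nz; apply: (between x y) => //.
  by case/andP: txy => /ltW -> /ltW ->.
have [lt|gt|eq] := ltgtP (k u) s.
- exact: (Rolle2 _ _ kum sm lt (Q0 Vu) Qs).
- exact: (Rolle2 _ _ sm kum gt Qs (Q0 Vu)).
- by rewrite eq eqxx in ks.
Qed.

(** With gradient k (x, y) + (B, C) / 2, the Hessian has trace 2 k + bend and
    determinant k^2 + k bend. *)
Definition bend u : R := kx u * (u 0 0 + b1 (k u)) + ky u * (u 0 1 + b2 (k u)).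

Definition radius2 (s : R) : R := b1 s ^+ 2 + b2 s ^+ 2 - d s.

Lemma circle_radius u : V u ->
  (u 0 0 + b1 (k u)) ^+ 2 + (u 0 1 + b2 (k u)) ^+ 2 = radius2 (k u).
Proof. by move=> /Q0; rewrite /circle /radius2; lra. Qed.

(** The scalar product of circle_gradient with the radius. *)
Lemma bendE u : V u -> circle' (k u) u * bend u = - 2 * radius2 (k u).
Proof.
move=> Vu; have [gx gy] := circle_gradient Vu.
rewrite -circle_radius// /bend.
set x := u 0 0 + _ in gx *; set y := u 0 1 + _ in gy *.
set p := kx u in gx *; set q := ky u in gy *; set w := circle' _ _ in gx gy *.
have -> : w * (p * x + q * y) = (2 * x + w * p) * x + (2 * y + w * q) * y - 2 * (x ^+ 2 + y ^+ 2).
  by ring.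
by rewrite gx gy; ring.
Qed.

Variable Z : set 'rV[R]_2.
Hypothesis Z0 : forall v : 'rV[R]_2, ~ (\near v, Z v).
Hypothesis HZ : forall u, V u -> Z (pt2 (k u + bend u / 2) (k u ^+ 2 + k u * bend u)).

(** If the centres moved, the two curvatures would be independent and the pair of
    their mean and product would fill an open set. The point with prescribed
    curvatures is the intersection of a circle of the family with the line
    circle' s u = q, which is solved explicitly. *)
Lemma centre_moves u1 : V u1 ->
  (u1 0 1 + b2 (k u1)) * b1' (k u1) - (u1 0 0 + b1 (k u1)) * b2' (k u1) = 0.
Proof.
move=> Vu1; apply/eqP/negPn/negP => r10.
set k1 := k u1 in r10; set r1 := (_ - _) in r10.
have kab1 := kab Vu1; rewrite -/k1 in kab1.
set x := u1 0 0 + b1 k1 in r1 r10; set y := u1 0 1 + b2 k1 in r1 r10.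
have rad1 : x ^+ 2 + y ^+ 2 = radius2 k1 by exact: circle_radius.
have xy0 : 0 < x ^+ 2 + y ^+ 2.
  rewrite lt_neqAle eq_sym paddr_eq0 ?sqr_ge0// addr_ge0 ?sqr_ge0// andbT.
  apply/negP => /andP[]; rewrite !sqrf_eq0 => /eqP x0 /eqP y0.
  by move: r10; rewrite /r1 x0 y0 !mul0r subrr eqxx.
have rad0 : radius2 k1 != 0 by rewrite -rad1 gt_eqF.
have gg0 : 0 < b1' k1 ^+ 2 + b2' k1 ^+ 2.
  rewrite lt_neqAle eq_sym paddr_eq0 ?sqr_ge0// addr_ge0 ?sqr_ge0// andbT.
  apply/negP => /andP[]; rewrite !sqrf_eq0 => /eqP x0 /eqP y0.
  by move: r10; rewrite /r1 x0 y0 !mulr0 subrr eqxx.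
have BE := bendE Vu1; rewrite -/k1 in BE.
set m1 := bend u1 in BE; set w1 := circle' k1 u1 in BE.
have w10 : w1 != 0.
  apply/eqP => w0; move: BE; rewrite w0 mul0r => /esym/eqP.
  by rewrite mulf_eq0 (negbTE rad0) orbF oppr_eq0 pnatr_eq0.
have m10 : m1 != 0.
  apply/eqP => w0; move: BE; rewrite w0 mulr0 => /esym/eqP.
  by rewrite mulf_eq0 (negbTE rad0) orbF oppr_eq0 pnatr_eq0.
have [e e0 inv] := circle_inverse Vu1 w10.
pose v1 : 'rV[R]_2 := pt2 (k1 + m1 / 2) (k1 ^+ 2 + k1 * m1).
pose disc (v : 'rV[R]_2) : R := v 0 0 * v 0 0 - v 0 1.
pose s (v : 'rV[R]_2) : R := v 0 0 - Num.sg m1 * Num.sqrt (disc v).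
pose m (v : 'rV[R]_2) : R := 2 * (v 0 0 - s v).
pose q (v : 'rV[R]_2) : R := - 2 * radius2 (s v) / m v.
pose p (v : 'rV[R]_2) : R := (q v - d' (s v) + 2 * (b1' (s v) * b1 (s v) + b2' (s v) * b2 (s v))) / 2.
pose G (v : 'rV[R]_2) : R := b1' (s v) * b1' (s v) + b2' (s v) * b2' (s v).
pose rad (v : 'rV[R]_2) : R := radius2 (s v) * G v - p v * p v.
pose r (v : 'rV[R]_2) : R := Num.sg r1 * Num.sqrt (rad v).
pose X (v : 'rV[R]_2) : R := (p v * b1' (s v) - r v * b2' (s v)) / G v.
pose Y (v : 'rV[R]_2) : R := (p v * b2' (s v) + r v * b1' (s v)) / G v.
pose U (v : 'rV[R]_2) : 'rV[R]_2 := pt2 (X v - b1 (s v)) (Y v - b2 (s v)).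
have disc1 : disc v1 = (m1 / 2) ^+ 2 by rewrite /disc /v1 !ptE; field.
have s1 : s v1 = k1.
  rewrite /s disc1 sqrtr_sqr /v1 ptE normrM (ger0_norm (_ : 0 <= 2^-1)) ?invr_ge0//.
  by rewrite mulrA -numEsg addrK.
have mv1 : m v1 = m1 by rewrite /m s1 /v1 ptE; field.
have q1 : q v1 = w1 by rewrite /q s1 mv1 -BE mulfK.
have p1 : p v1 = b1' k1 * x + b2' k1 * y.
  by rewrite /p q1 s1 /w1 /circle' /x /y; field.
have G1 : G v1 = b1' k1 ^+ 2 + b2' k1 ^+ 2 by rewrite /G s1; ring.
have radv1 : rad v1 = r1 ^+ 2 by rewrite /rad p1 s1 G1 -rad1 /r1; ring.
have rv1 : r v1 = r1 by rewrite /r radv1 sqrtr_sqr -numEsg.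
have G10 : b1' k1 ^+ 2 + b2' k1 ^+ 2 != 0 by rewrite gt_eqF.
have U1 : U v1 = u1.
  apply: rV2P; rewrite /U ptE s1.
    by rewrite /X p1 rv1 G1 s1 /r1 /x /y; field.
  by rewrite /Y p1 rv1 G1 s1 /r1 /x /y; field.
have c0 : {for v1, continuous (fun v : 'rV[R]_2 => v 0 0)} by exact: coord_continuous.
have c1 : {for v1, continuous (fun v : 'rV[R]_2 => v 0 1)} by exact: coord_continuous.
have cdisc : {for v1, continuous disc} by apply: contSub c1; exact: contMul.
have csqrt (f : 'rV[R]_2 -> R) : {for v1, continuous f} -> {for v1, continuous (fun v => Num.sqrt (f v))}.
  by move=> cf; apply: contComp cf; exact: sqrt_continuous.
have cs : {for v1, continuous s}.
  by apply: (contSub c0); apply: contMul (csqrt _ cdisc); exact: contCst.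
have cS (h : R -> R) : {for k1, continuous h} -> {for v1, continuous (fun v => h (s v))}.
  by move=> ch; apply: contComp cs; rewrite s1.
have cB1 := cS _ (derivable_cont (db1 kab1)).
have cB2 := cS _ (derivable_cont (db2 kab1)).
have cB1' := cS _ (cb1 kab1).
have cB2' := cS _ (cb2 kab1).
have cD' := cS _ (cd kab1).
have cR : {for v1, continuous (fun v => radius2 (s v))}.
  by apply: contSub (cS _ (derivable_cont (dd kab1))); apply: contAdd; apply: contMul.
have cm : {for v1, continuous m}.
  by apply: contMul; [exact: contCst|exact: contSub].
have cq : {for v1, continuous q}.
  apply: contDiv cm _; last by rewrite mv1.
  by apply: contMul => //; exact: contCst.
have cp : {for v1, continuous p}.
  apply: contMul; last exact: contCst.
  apply: contAdd; first exact: contSub.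
  by apply: contMul; [exact: contCst|apply: contAdd; exact: contMul].
have cG : {for v1, continuous G} by apply: contAdd; exact: contMul.
have crad : {for v1, continuous rad} by apply: contSub; exact: contMul.
have cr : {for v1, continuous r}.
  by apply: contMul (csqrt _ crad); exact: contCst.
have cX : {for v1, continuous X}.
  apply: contDiv cG _; last by rewrite G1.
  by apply: contSub; exact: contMul.
have cY : {for v1, continuous Y}.
  apply: contDiv cG _; last by rewrite G1.
  by apply: contAdd; exact: contMul.
have cU : {for v1, continuous U}.
  apply: continuous_rV; apply: forall_I2.
    apply: (@continuous_at_ext _ _ (fun v => X v - b1 (s v))); last exact: contSub.
    by move=> v; rewrite ptE.
  apply: (@continuous_at_ext _ _ (fun v => Y v - b2 (s v))); last exact: contSub.
  by move=> v; rewrite ptE.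
have n1 : \forall v \near v1, `|s v1 - s v| < e by exact: near_continuous.
have n2 : \forall v \near v1, ball u1 e (U v).
  by apply: cU; rewrite U1; exact: nbhsx_ballx.
have gt0near (f : 'rV[R]_2 -> R) : {for v1, continuous f} -> 0 < f v1 ->
    \forall v \near v1, 0 < f v.
  move=> cf f0; apply: filterS (near_continuous cf f0) => v.
  by rewrite ltr_norml; lra.
have n3 : \forall v \near v1, 0 < disc v.
  by apply: gt0near => //; rewrite disc1 exprn_even_gt0//= mulf_neq0// invr_eq0.
have n4 : \forall v \near v1, 0 < rad v.
  by apply: gt0near => //; rewrite radv1 exprn_even_gt0.
have n5 : \forall v \near v1, m v != 0 by apply: near_neq0 => //; rewrite mv1.
have n6 : \forall v \near v1, G v != 0 by apply: near_neq0 => //; rewrite G1.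
have n7 : \forall v \near v1, radius2 (s v) != 0.
  by apply: (@near_neq0 _ _ (fun v => radius2 (s v))) => //; rewrite s1.
apply: (@Z0 v1).
near=> v.
have sv : `|s v1 - s v| < e by near: v; exact: n1.
have Uv : ball u1 e (U v) by near: v; exact: n2.
have dv : 0 < disc v by near: v; exact: n3.
have radv : 0 < rad v by near: v; exact: n4.
have mv : m v != 0 by near: v; exact: n5.
have Gv : G v != 0 by near: v; exact: n6.
have Rv : radius2 (s v) != 0 by near: v; exact: n7.
have r2 : r v * r v = rad v.
  rewrite /r mulrACA -!expr2 sqr_sqrtr ?ltW//.
  by rewrite sqr_sg r10 mul1r.
have XY : X v ^+ 2 + Y v ^+ 2 = radius2 (s v).
  have -> : X v ^+ 2 + Y v ^+ 2 = (p v * p v + r v * r v) / G v.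
    by rewrite /X /Y /G in Gv *; field.
  by rewrite r2 /rad; field.
have Q : circle (s v) (U v) = 0.
  have -> : circle (s v) (U v) = X v ^+ 2 + Y v ^+ 2 - radius2 (s v).
    by rewrite /circle /radius2 /U !ptE; ring.
  by rewrite XY subrr.
have [VU kU] : V (U v) /\ k (U v) = s v.
  by apply: inv => //; rewrite -/k1 -s1 distrC.
have w : circle' (s v) (U v) = q v.
  have -> : circle' (s v) (U v) = 2 * (b1' (s v) * X v + b2' (s v) * Y v)
     - 2 * (b1' (s v) * b1 (s v) + b2' (s v) * b2 (s v)) + d' (s v).
    by rewrite /circle' /U !ptE; ring.
  have -> : b1' (s v) * X v + b2' (s v) * Y v = p v.
    by rewrite /X /Y /G in Gv *; field.
  by rewrite /p; field.
have bv : bend (U v) = m v.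
  have := bendE VU; rewrite kU w => E.
  have q0 : q v != 0 by rewrite /q mulf_neq0 ?invr_eq0// mulf_neq0// oppr_eq0 pnatr_eq0.
  by apply: (mulfI q0); rewrite E /q divfK.
have := HZ VU; rewrite kU bv.
suff -> : pt2 (s v + m v / 2) (s v ^+ 2 + s v * m v) = v by [].
apply: rV2P; rewrite ptE /m; first by field.
have -> : s v ^+ 2 + s v * (2 * (v 0 0 - s v)) = v 0 0 * v 0 0 - (v 0 0 - s v) ^+ 2 by ring.
have -> : (v 0 0 - s v) ^+ 2 = disc v.
  have -> : v 0 0 - s v = Num.sg m1 * Num.sqrt (disc v) by rewrite /s; ring.
  by rewrite exprMn sqr_sqrtr ?ltW// sqr_sg m10 mul1r.
by rewrite /disc; ring.
Unshelve. all: by end_near. Qed.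

Lemma radius2_eq0 u : V u -> radius2 (k u) = 0 ->
  u 0 0 + b1 (k u) = 0 /\ u 0 1 + b2 (k u) = 0.
Proof.
move=> Vu; rewrite -circle_radius// => /eqP.
by rewrite paddr_eq0 ?sqr_ge0// !sqrf_eq0 => /andP[/eqP -> /eqP ->].
Qed.

(** The circles do not all degenerate, for the centres alone only sweep out a
    curve. *)
Lemma circle_nondegenerate : V !=set0 -> exists2 u, V u & radius2 (k u) != 0.
Proof.
move=> [u Vu]; apply: contrapT => N.
have H w : V w -> w 0 0 + b1 (k w) = 0 /\ w 0 1 + b2 (k w) = 0.
  move=> Vw; apply: radius2_eq0 => //; apply/eqP/negPn/negP => r0.
  by apply: N; exists w.
have E (v : 'rV[R]_2) i (h : R -> R) l : is_derive (k u) 1 h l ->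
    (forall w, V w -> w 0 i + h (k w) = 0) -> v 0 i + l * 'D_v k u = 0.
  move=> dh Hh; have D := derAdd (is_derive_coord_line u v i) (is_derive_k_line v Vu dh).
  have [e e0 He] := line_near v oV Vu.
  apply: (is_derive_right0 e0 D) => t /andP[t0 te]; rewrite add0r in te.
  by apply: Hh; apply: He; rewrite ger0_norm.
have ku := kab Vu.
have h1 w : V w -> w 0 0 + b1 (k w) = 0 by move=> /H[].
have h2 w : V w -> w 0 1 + b2 (k w) = 0 by move=> /H[].
have := E (delta_mx 0 0) 0 _ _ (db1 ku) h1; have := E (delta_mx 0 1) 0 _ _ (db1 ku) h1.
have := E (delta_mx 0 0) 1 _ _ (db2 ku) h2; have := E (delta_mx 0 1) 1 _ _ (db2 ku) h2.
rewrite !mxE /=; move: (kx u) (ky u) (b1' _) (b2' _) => p q g1 g2 e4 e3 e2 e1.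
have : (g1 * p) * (g2 * q) = (g1 * q) * (g2 * p) by ring.
have -> : g1 * p = -1 by lra.
have -> : g2 * q = -1 by lra.
have -> : g1 * q = 0 by lra.
by rewrite mul0r; lra.
Qed.

(** By centre_moves, the velocity of the centre is parallel to the radius
    through every point of the circle; two independent radii suffice. *)
Lemma centre_stationary u : V u -> radius2 (k u) != 0 ->
  b1' (k u) = 0 /\ b2' (k u) = 0.
Proof.
move=> Vu r0.
have E := bendE Vu.
have w0 : circle' (k u) u != 0.
  apply/eqP => w0; move: E; rewrite w0 mul0r => /esym/eqP.
  by rewrite mulf_eq0 (negbTE r0) orbF oppr_eq0 pnatr_eq0.
have [e e0 inv] := circle_inverse Vu w0.
pose x := u 0 0 + b1 (k u); pose y := u 0 1 + b2 (k u).
pose c (t : R) : R := Num.sqrt (1 - t * t).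
(* the point u turned around the centre of its circle by the angle of sine t *)
pose U (t : R) : 'rV[R]_2 :=
  pt2 (c t * x - t * y - b1 (k u)) (t * x + c t * y - b2 (k u)).
have c0 : c 0 = 1 by rewrite /c mulr0 subr0 sqrtr1.
have U0 : U 0 = u by apply: rV2P; rewrite /U ptE c0 /x /y; ring.
have ct : {for (0 : R), continuous (fun t : R => t)} by exact: cvg_id.
have ck (z : R) : {for (0 : R), continuous (fun _ : R => z)} by exact: cst_continuous.
have cc : {for (0 : R), continuous c}.
  apply: (@contComp R R (0 : R) Num.sqrt (fun t : R => 1 - t * t)).
    exact: sqrt_continuous.
  exact: (contSub (ck 1) (contMul ct ct)).
have cU : {for (0 : R), continuous U}.
  apply: continuous_rV; apply: forall_I2.
    apply: (@continuous_at_ext R R (fun t : R => c t * x - t * y - b1 (k u))) => [t|].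
      by rewrite ptE.
    by apply: contSub => //; apply: contSub; exact: contMul.
  apply: (@continuous_at_ext R R (fun t : R => t * x + c t * y - b2 (k u))) => [t|].
    by rewrite ptE.
  by apply: contSub => //; apply: contAdd; exact: contMul.
have : \forall t \near (0 : R), ball u e (U t).
  by apply: cU; rewrite U0; exact: nbhsx_ballx.
move=> /nbhs_ballP[r /= rpos Hr].
pose t := Num.min (r / 2) (1 / 2).
have t0 : 0 < t by rewrite lt_min !divr_gt0.
have t1 : t <= 1 / 2 by rewrite /t ge_min lexx orbT.
have tr : t < r by apply: (@le_lt_trans _ _ (r / 2)); [rewrite /t ge_min lexx|lra].
have c2 : c t ^+ 2 = 1 - t * t by rewrite sqr_sqrtr//; nra.
have Q : circle (k u) (U t) = 0.
  have -> : circle (k u) (U t) = (c t * x - t * y) ^+ 2 + (t * x + c t * y) ^+ 2 - radius2 (k u).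
    by rewrite /circle /radius2 /U !ptE; ring.
  have -> : (c t * x - t * y) ^+ 2 + (t * x + c t * y) ^+ 2 = (c t ^+ 2 + t * t) * (x ^+ 2 + y ^+ 2).
    by ring.
  by rewrite c2 subrK mul1r circle_radius// subrr.
have [VU kU] : V (U t) /\ k (U t) = k u.
  apply: inv Q; first by rewrite subrr normr0.
  by apply: Hr; rewrite /ball/= sub0r normrN gtr0_norm.
have := centre_moves VU; have := centre_moves Vu.
rewrite kU {1 2}/U !ptE -/x -/y !subrK.
set g1 := b1' _; set g2 := b2' _ => cr1 cr2.
have cr3 : x * g1 + y * g2 = 0.
  have : t * (x * g1 + y * g2) = 0.
    have -> : t * (x * g1 + y * g2) = (t * x + c t * y) * g1 - (c t * x - t * y) * g2
      - c t * (y * g1 - x * g2) by ring.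
    by rewrite cr1 cr2 mulr0 subrr.
  by move/eqP; rewrite mulf_eq0 (gt_eqF t0) => /eqP.
have xy : x ^+ 2 + y ^+ 2 != 0 by rewrite circle_radius.
split; apply: (mulfI xy); rewrite mulr0.
  have -> : (x ^+ 2 + y ^+ 2) * g1 = x * (x * g1 + y * g2) + y * (y * g1 - x * g2) by ring.
  by rewrite cr1 cr3 !mulr0 addr0.
have -> : (x ^+ 2 + y ^+ 2) * g2 = y * (x * g1 + y * g2) - x * (y * g1 - x * g2) by ring.
by rewrite cr1 cr3 !mulr0 subrr.
Qed.

(** Along a line on which k is not constant, k takes all values of an interval. *)
Lemma centres_constant : V !=set0 -> exists l r : R, l < r /\
  forall s, l <= s <= r -> [/\ a < s < b, b1' s = 0 & b2' s = 0].
Proof.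
move=> /circle_nondegenerate[u Vu r0].
have ku := kab Vu.
have [v dv] : exists v, 'D_v k u != 0.
  apply: contrapT => N.
  have Dv v : 'D_v k u = 0 by apply/eqP/negPn/negP => H; apply: N; exists v.
  have [gx gy] := circle_gradient Vu.
  rewrite !Dv !mulr0 !addr0 in gx gy.
  move: r0; rewrite -circle_radius//.
  have -> : u 0 0 + b1 (k u) = 0 by lra.
  have -> : u 0 1 + b2 (k u) = 0 by lra.
  by rewrite expr0n addr0 eqxx.
have ck := differentiable_continuous (dk Vu).
have cR : {for u, continuous (fun w => radius2 (k w))}.
  apply: (contComp (h := radius2)) => //.
  have dB1 := derivable_cont (db1 ku); have dB2 := derivable_cont (db2 ku).
  apply: contSub (derivable_cont (dd ku)); apply: contAdd; exact: contMul.
have /nbhs_ballP[r1 /= r10 Hr1] := @near_neq0 _ _ (fun w => radius2 (k w)) _ cR r0.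
have /nbhs_ballP[r2 /= r20 Hr2] := open_nbhs_nbhs (conj oV Vu).
have m0 : 0 < Num.min r1 r2 by rewrite lt_min r10.
have [e e0 He] : exists2 e : R, 0 < e &
    forall s, `|s| < e -> ball u (Num.min r1 r2) (u + s *: v).
  by apply: line_near; [exact: ball_open|exact: ballxx].
pose phi (s : R) : R := k (u + s *: v).
have good (s : R) : `|s| < e -> V (u + s *: v) /\ radius2 (phi s) != 0.
  move=> /He B; split; first by apply: Hr2; apply: le_ball B; rewrite ge_min lexx orbT.
  by apply: Hr1; apply: le_ball B; rewrite ge_min lexx.
have cphi (s : R) : `|s| < e -> {for s, continuous phi}.
  move=> /good[Vs _].
  have : derivable k (u + s *: v) v by exact/diff_derivable/dk.
  by move/is_derive_line; exact: derivable_cont.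
have phi0 : phi 0 = k u by rewrite /phi scale0r addr0.
have [t [t0 te pt]] : exists t : R, [/\ 0 < t, t < e & phi t != phi 0].
  apply: contrapT => N.
  have dphi : is_derive (0 : R) 1 (fun s => phi s - phi 0) ('D_v k u - 0).
    have D1 : is_derive (0 : R) 1 phi ('D_v k u).
      have := @is_derive_line R _ k u v 0.
      by rewrite scale0r addr0; apply; exact/diff_derivable/dk.
    exact: (derSub D1 (derCst 0 (phi 0))).
  have Z' : 'D_v k u - 0 = 0.
    apply: (is_derive_right0 e0 dphi) => t /andP[t0 te]; rewrite add0r in te.
    have [->|tn0] := eqVneq t 0; first by rewrite subrr.
    apply/eqP; rewrite subr_eq0; apply/negPn/negP => H.
    by apply: N; exists t; split => //; rewrite lt_neqAle eq_sym tn0.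
  by move: dv; rewrite -[X in X != _]subr0 Z' eqxx.
exists (Num.min (phi 0) (phi t)), (Num.max (phi 0) (phi t)); split.
  by case: (ltgtP (phi 0) (phi t)) pt => // ->; rewrite eqxx.
move=> s sp.
have [w + ws] : exists2 w, w \in `[0, t] & phi w = s.
  apply: IVT; [exact: ltW| |exact: sp].
  apply: continuous_in_subspaceT => w; rewrite inE/= in_itv/= => /andP[w0 wt].
  by apply: cphi; rewrite ger0_norm// (le_lt_trans wt).
rewrite in_itv/= => /andP[w0 wt].
have we : `|w| < e by rewrite ger0_norm// (le_lt_trans wt).
have [Vw rw] := good w we.
by rewrite -ws; have [e1 e2] := centre_stationary Vw rw; split => //; exact: kab.
Qed.

End CircleFamily.

(** * Intervals and inverse functions *)

Section RealLine.
Context {R : realType}.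

Lemma within_cont (f : R -> R) (a b : R) :
  (forall t, a <= t <= b -> {for t, continuous f}) -> {within `[a, b], continuous f}.
Proof.
move=> H; apply: continuous_in_subspaceT => w; rewrite inE/= in_itv/=; exact: H.
Qed.

(** A function whose derivative does not vanish is injective, hence strictly
    monotone on the interval. *)
Lemma monotone_inverse (f df : R -> R) (a b : R) : a < b ->
  (forall t, a <= t <= b -> is_derive t 1 f (df t) /\ df t != 0) ->
  exists (g : R -> R) (l r : R),
  [/\ forall t, a < t < b -> l < f t < r /\ g (f t) = t,
      forall s, l < s < r -> [/\ a < g s < b, f (g s) = s & is_derive s 1 g (df (g s))^-1]
    & forall x t y, a <= x -> x <= t <= y -> y <= b ->
        Num.min (f x) (f y) <= f t <= Num.max (f x) (f y)].
Proof.
move=> ab H.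
have fc t : a <= t <= b -> {for t, continuous f} by move=> /H[/derivable_cont].
have cW : {within `[a, b], continuous f} by exact: within_cont.
have inj_lt x y : a <= x -> x < y -> y <= b -> f x <> f y.
  move=> ax xy yb E.
  have [|t txy] := @mean_value R f df x y xy.
    by move=> t txy; have [|] := H t => //; lra.
  rewrite E subrr => /esym/eqP; rewrite mulf_eq0 subr_eq0 (gt_eqF xy) orbF.
  by apply/negP; have [|] := H t => //; lra.
have finj : {in `[a, b] &, injective f}.
  move=> x y; rewrite !in_itv/= => /andP[ax xb] /andP[ay yb] E.
  have [lt|gt|//] := ltgtP x y.
    by have := inj_lt x y ax lt yb E.
  by have := inj_lt y x ay gt xb (esym E).
have mono : (forall x y, a <= x -> x < y -> y <= b -> f x < f y) \/
            (forall x y, a <= x -> x < y -> y <= b -> f y < f x).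
  have [M|M] := itv_continuous_inj_mono cW finj; [left|right] => x y ax xy yb.
    by rewrite M ?in_itv//=; lra.
  by rewrite M ?in_itv//=; lra.
pose g s := xget a [set t | a <= t <= b /\ f t = s].
have gf t : a <= t <= b -> g (f t) = t.
  move=> tab; rewrite /g; case: xgetP => [x -> [xab E]|/(_ t)[]//].
  by apply: finj => //; rewrite in_itv.
exists g, (Num.min (f a) (f b)), (Num.max (f a) (f b)); split.
- move=> t /andP[at' tb]; split; last by apply: gf; rewrite !ltW.
  rewrite gt_min lt_max; case: mono => M.
    by rewrite (M a t)// ?(M t b)// ?orbT// ltW.
  by rewrite (M t b) ?(M a t)// ?orbT// ltW.
- move=> s /andP[ls sr].
  have [t + ft] : exists2 t, t \in `[a, b] & f t = s.
    by apply: IVT; [exact: ltW|exact: cW|rewrite !ltW].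
  rewrite in_itv/= => tab.
  have ta : t != a by apply/eqP => E; move: ls sr; rewrite -ft E gt_min lt_max !ltxx/=; lra.
  have tb : t != b by apply/eqP => E; move: ls sr; rewrite -ft E gt_min lt_max !ltxx !orbF; lra.
  have gs : g s = t by rewrite -ft gf.
  have tab' : a < t < b by rewrite !lt_neqAle eq_sym ta tb.
  rewrite gs; split => //; rewrite -ft.
  have nab : \forall z \near t, z \in `]a, b[.
    by apply: near_in_itvoo; rewrite in_itv.
  apply: is_derive_inverse.
  + by apply: filterS nab => z; rewrite in_itv/= => /andP[az zb]; rewrite /= gf// !ltW.
  + by apply: filterS nab => z; rewrite in_itv/= => /andP[az zb]; apply: fc; rewrite !ltW.
  + by case: (H t tab).
  + by case: (H t tab).
- move=> x t y ax /andP[xt ty] yb.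
  have [->|xt'] := eqVneq t x; first by rewrite ge_min le_max lexx.
  have [->|ty'] := eqVneq t y; first by rewrite ge_min le_max lexx !orbT.
  have xlt : x < t by rewrite lt_neqAle eq_sym xt'.
  have tly : t < y by rewrite lt_neqAle ty'.
  rewrite ge_min le_max; case: mono => M.
    by rewrite (ltW (M x t _ _ _))// ?(ltW (M t y _ _ _))// ?orbT//; lra.
  by rewrite (ltW (M t y _ _ _)) ?(ltW (M x t _ _ _))// ?orbT//; lra.
Qed.

Lemma countable_setU (T : Type) (A B : set T) : countable A -> countable B ->
  countable (A `|` B).
Proof.
move=> cA cB.
have -> : A `|` B = \bigcup_(b in [set: bool]) (if b then A else B).
  apply/seteqP; split=> [x [Lx|Hx]|x [[] _]]; [by exists true|by exists false|by left|by right].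
by apply: bigcup_countable => [|[] _].
Qed.

Lemma interval_boundary_countable (I : set R) : is_interval I ->
  countable (I `\` I°).
Proof.
move=> iI.
pose L := [set x | I x /\ forall y, I y -> x <= y].
pose H := [set x | I x /\ forall y, I y -> y <= x].
have one (K : set R) : (forall x y, K x -> K y -> x = y) -> countable K.
  move=> K1; have [[x Kx]|N] := pselect (K !=set0); last first.
    by have -> : K = set0 by apply/seteqP; split=> // x Kx; apply: N; exists x.
  have -> : K = [set x]; last exact: countable1.
  by apply/seteqP; split=> [y Ky|y ->//]; exact: K1.
have L1 : countable L.
  by apply: one => x y [Ix xI] [Iy yI]; apply/eqP; rewrite eq_le xI// yI.
have H1 : countable H.
  by apply: one => x y [Ix xI] [Iy yI]; apply/eqP; rewrite eq_le xI// yI.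
apply: (@sub_countable _ _ _ (L `|` H)); last exact: countable_setU.
apply: subset_card_le => x [Ix nIx]; apply: contrapT => N; apply: nIx.
have [y Iy yx] : exists2 y, I y & y < x.
  apply: contrapT => N2; apply: N; left; split => // y Iy.
  by rewrite leNgt; apply/negP => yx; apply: N2; exists y.
have [z Iz xz] : exists2 y, I y & x < y.
  apply: contrapT => N2; apply: N; right; split => // z Iz.
  by rewrite leNgt; apply/negP => xz; apply: N2; exists z.
have : nbhs x `]y, z[%classic.
  by apply: open_nbhs_nbhs; split; [exact: interval_open|rewrite /= in_itv/= yx].
apply: filterS => w; rewrite /= in_itv/= => /andP[yw wz].
by apply: (iI y z) => //; rewrite !ltW.
Qed.

(** Points are closed and have no interior, so the Baire property applies. *)
Lemma segment_uncountable (l r : R) (N : set R) : l < r ->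
  (forall s, l <= s <= r -> N s) -> ~ countable N.
Proof.
move=> lr lrN cN.
have e0 : 0 < (r - l) / 2 by rewrite divr_gt0// subr_gt0.
have [||t [y [e [_ epos He]]]] := @Baire_countable R R R N (fun t => [set t]) ((l + r) / 2) _ e0 cN.
- by move=> t _; rewrite -set_itv1; exact: interval_closed.
- move=> s; rewrite /ball/= ltr_norml => H; exists s => //; apply: lrN; lra.
have y1 : y = t by case: (He y (ballxx y epos)).
have [E _] : ([set t] `&` ball ((l + r) / 2) ((r - l) / 2)) (y + e / 2).
  by apply: He; rewrite /ball/= opprD addNKr normrN gtr0_norm ?divr_gt0//; lra.
by move: E => /=; rewrite y1; lra.
Qed.

Lemma le_on_closure (T : topologicalType) (D : set T) (f : T -> R) (m : R) x :
  closure D x -> {for x, continuous f} -> (forall y, D y -> m <= f y) -> m <= f x.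
Proof.
move=> cD cf H; rewrite leNgt; apply/negP => fm.
have e0 : 0 < m - f x by rewrite subr_gt0.
have [y [/H my]] := cD _ (near_continuous cf e0).
by rewrite ltr_norml; lra.
Qed.

End RealLine.

Lemma Baire_two (R : realType) (V : completeNormedModType R)
    (S T : Type) (N : set S) (F : S -> set V) (P : set T) (G : T -> set V)
    (x : V) (r : R) :
  0 < r -> countable N -> countable P -> (forall t, N t -> closed (F t)) ->
  (forall t, P t -> closed (G t)) ->
  ball x r `<=` (\bigcup_(t in N) F t) `|` (\bigcup_(t in P) G t) ->
  (exists t y (e : R), [/\ N t, 0 < e & ball y e `<=` F t `&` ball x r]) \/
  (exists t y (e : R), [/\ P t, 0 < e & ball y e `<=` G t `&` ball x r]).
Proof.
move=> r0 /countable_injP[g ginj] /countable_injP[h hinj] cF cG cov.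
pose E n := \bigcup_(t in [set t | N t /\ (g t).*2 = n]) F t `|`
            \bigcup_(t in [set t | P t /\ (h t).*2.+1 = n]) G t.
have EE n : [\/ E n = set0, exists t, N t /\ E n = F t | exists t, P t /\ E n = G t].
  have [[t [Nt gt]]|H1] := pselect (exists t, N t /\ (g t).*2 = n).
    constructor 2; exists t; split => //; apply/seteqP; split=> [y|y Fy]; last by left; exists t.
    case=> [[s [Ns gs] Fs]|[s [Ps hs] Gs]].
      by have -> : t = s by apply: ginj; rewrite ?inE//; apply: double_inj; rewrite gt gs.
    by have := congr1 odd (etrans gt (esym hs)); rewrite /= !odd_double.
  have [[t [Pt ht]]|H2] := pselect (exists t, P t /\ (h t).*2.+1 = n).
    constructor 3; exists t; split => //; apply/seteqP; split=> [y|y Fy]; last by right; exists t.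
    case=> [[s [Ns gs] Fs]|[s [Ps hs] Gs]]; first by exfalso; apply: H1; exists s.
    have -> : t = s by apply: hinj; rewrite ?inE//; apply: double_inj; apply: succn_inj; rewrite ht hs.
    by [].
  constructor 1; apply/seteqP; split=> // y [[t [Nt gt] _]|[t [Nt gt] _]].
    by apply: H1; exists t.
  by apply: H2; exists t.
have cE n : closed (E n).
  by case: (EE n) => [->|[t [Nt ->]]|[t [Pt ->]]]; [exact: closed0|exact: cF|exact: cG].
have [|n [y [e [e0 He]]]] := @Baire_nat R V E x r r0 cE.
  move=> y /cov[[t Nt Ft]|[t Pt Gt]].
    by exists (g t).*2 => //; left; exists t.
  by exists (h t).*2.+1 => //; right; exists t.
case: (EE n) => [E0|[t [Nt Et]]|[t [Pt Et]]].
- by have := He y (ballxx _ e0); rewrite E0 => -[].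
- by left; exists t, y, e; split => //; rewrite -Et.
- by right; exists t, y, e; split => //; rewrite -Et.
Qed.

(** * The Hessian and its invariants *)

Definition htrace {R : realType} (f : 'rV[R]_2 -> R) u : R := D0 (D0 f) u + D1 (D1 f) u.

Definition hdet {R : realType} (f : 'rV[R]_2 -> R) u : R :=
  D0 (D0 f) u * D1 (D1 f) u - D0 (D1 f) u * D1 (D0 f) u.

Lemma det_mx2 (R : comPzRingType) (H : 'M[R]_2) :
  \det H = H 0 0 * H 1 1 - H 0 1 * H 1 0.
Proof.
rewrite (expand_det_row _ 0) !big_ord_recl big_ord0 addr0 /cofactor !det_mx11.
rewrite !mxE /= expr0 expr1 mul1r.
have -> : lift 0 0 = 1 :> 'I_2 by apply/val_inj.
have -> : lift 1 0 = 0 :> 'I_2 by apply/val_inj.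
by rewrite mulN1r mulrN.
Qed.

Lemma principal_curvatures_hess (R : realType) (M : set 'rV[R]_3) p f k1 k2 :
  M p -> local_graph M p f -> principal_curvatures M p k1 k2 ->
  k1 + k2 = htrace f (top p) /\ k1 * k2 = hdet f (top p).
Proof.
move=> Mp lf [f' [lf' E]].
have HE i j : hessian f' (top p) i j = 'D_(delta_mx 0 i) ('D_(delta_mx 0 j) f) (top p).
  by rewrite mxE; exact: local_graph_hess lf' lf.
rewrite -/(top p) in E; set H := hessian f' (top p) in E HE.
have EX : ('X - k1%:P) * ('X - k2%:P) = 'X^2 - (k1 + k2) *: 'X + (k1 * k2)%:P.
  by rewrite -mul_polyC polyCD polyCM; ring.
have E1 : (('X - k1%:P) * ('X - k2%:P))`_1 = - (k1 + k2).
  by rewrite EX !(coefD, coefN, coefZ, coefXn, coefX, coefC)/= mulr1 add0r addr0.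
have E0 : (('X - k1%:P) * ('X - k2%:P))`_0 = k1 * k2.
  by rewrite EX !(coefD, coefN, coefZ, coefXn, coefX, coefC)/= mulr0 oppr0 !add0r.
have := @char_poly_trace _ 2 H isT; have := char_poly_det H.
rewrite E /= E0 E1 det_mx2 /mxtrace !big_ord_recl big_ord0 addr0 sqrrN expr1n mul1r.
have -> : lift ord0 ord0 = 1 :> 'I_2 by apply/val_inj.
rewrite !HE => -> /oppr_inj ->; split => //.
Qed.

Lemma smooth_interior (R : realType) (I : set R) (f : R -> R) : smooth_on I f ->
  forall t, I° t -> forall n, derivable (derive1n n f) t 1.
Proof.
move=> sf t It n; have [r [g [r0 dg fg]]] := sf t (interior_subset It).
have nfg : \near t, f t = g t.
  near=> s; apply: fg; first by near: s; exact: It.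
  by rewrite distrC; near: s; exact: nbhsx_ballx.
have E : forall m, \near t, derive1n m f t = derive1n m g t.
  elim=> [//|m IH]; have := near_join IH; apply: filterS => s sE.
  by rewrite !derive1nS !derive1E; exact: near_eq_derive.
apply: near_eq_derivable (dg n t _); last by rewrite subrr normr0.
by apply: filterS (E n) => s ->.
Unshelve. all: by end_near. Qed.

(** * Families of nonconstant radius *)

(** Cramer's rule without division: the value at a of the characteristic
    polynomial annihilates both coordinates of the eigenvector. *)
Lemma eigenvalue_root (F : idomainType) (P Q Q' S a x y : F) :
  x * P + y * Q = a * x -> x * Q' + y * S = a * y -> x != 0 \/ y != 0 ->
  a ^+ 2 - (P + S) * a + (P * S - Q' * Q) = 0.
Proof.
move=> e1 e2; set X := _ - _ + _.
have x0 : X * x = 0.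
  rewrite /X; have -> : (a ^+ 2 - (P + S) * a + (P * S - Q' * Q)) * x =
     (S - a) * (x * P + y * Q - a * x) - Q * (x * Q' + y * S - a * y) by ring.
  by rewrite e1 e2 !subrr !mulr0 subrr.
have x1 : X * y = 0.
  rewrite /X; have -> : (a ^+ 2 - (P + S) * a + (P * S - Q' * Q)) * y =
     (P - a) * (x * Q' + y * S - a * y) - Q' * (x * P + y * Q - a * x) by ring.
  by rewrite e1 e2 !subrr !mulr0 subrr.
by case=> n0; apply/eqP; move/eqP: (x0); move/eqP: (x1);
  rewrite !mulf_eq0 (negbTE n0) !orbF.
Qed.

Section NonconstantRadius.
Context {R : realType}.
Variables (M : set 'rV[R]_3) (I : set R) (A B C D : R -> R) (c : R -> set 'rV[R]_3).
Hypothesis cc : forall t, I t -> curve_without_endpoints (c t).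
Hypothesis ct : forall t, I t -> forall p, c t p ->
  tangent_at M (parabolic_sphere (A t) (B t) (C t) (D t)) p.
Hypothesis cM : M = \bigcup_(t in I) c t.
Hypothesis iI : is_interval I.
Hypothesis sA : smooth_on I A.
Hypothesis aA : analytic_on I A.
Hypothesis Anc : exists s t, [/\ I s, I t & A s != A t].

Lemma covered p : M p -> exists2 t, I t & c t p.
Proof. by rewrite cM => -[t It cp]; exists t. Qed.

Lemma level_countable a : countable [set t | I t /\ A t = a].
Proof.
have an := analytic_on_lin 1 0 (- a) aA aA.
have -> : [set t | I t /\ A t = a] = [set t | I t /\ 1 * A t + 0 * A t + - a = 0].
  apply/seteqP; split=> t [It E]; split=> //; first by rewrite E; ring.
  by move: E; lra.
apply: analytic_zeros_countable an _ => //.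
have [s [t [Is It ne]]] := Anc.
have [Es|Es] := eqVneq (A s) a.
  by exists t => //; rewrite mul1r mul0r addr0 subr_eq0 -Es eq_sym.
by exists s => //; rewrite mul1r mul0r addr0 subr_eq0.
Qed.

Lemma derA t : I° t -> is_derive t 1 A (derive1 A t).
Proof. by move=> It; rewrite derive1E; apply: derivableP; exact: (@smooth_interior R I A sA t It 0%N). Qed.

Lemma interval_inner : exists l r : R, l < r /\ forall s, l <= s <= r -> I° s.
Proof.
have [s0 [t0 [Is0 It0 ne]]] := Anc.
wlog lt : s0 t0 Is0 It0 ne / s0 < t0 => [H|].
  have [lt|gt|eq] := ltgtP s0 t0; first exact: (H s0 t0).
    by apply: (H t0 s0) => //; rewrite eq_sym.
  by rewrite eq eqxx in ne.
exists (s0 + (t0 - s0) / 3), (t0 - (t0 - s0) / 3); split; first lra.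
move=> s st; have : nbhs s `]s0, t0[%classic.
  apply: open_nbhs_nbhs; split; [exact: interval_open|rewrite /= in_itv/=; lra].
apply: filterS => w; rewrite /= in_itv/= => /andP[sw wt].
by apply: (iI Is0 It0); rewrite !ltW.
Qed.

(** If A' vanished on the interior of I, then A would be constant on a segment,
    against level_countable; so A', being analytic, has countably many zeros.
    The boundary of I adds at most two parameters. *)
Lemma critical_countable : countable [set t | I t /\ (I° t -> derive1 A t = 0)].
Proof.
apply: (@sub_countable _ _ _ ((I `\` I°) `|` [set t | I° t /\ derive1 A t = 0])).
  apply: subset_card_le => t [It H].
  by have [It'|nIt] := pselect (I° t); [right; split=> //; exact: H|left].
apply: countable_setU; first exact: interval_boundary_countable.
apply: (@analytic_zeros_countable R I°); first exact: interior_interval.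
  exact: analytic_on_derive.
apply: contrapT => N.
have dA t : I° t -> derive1 A t = 0.
  by move=> It; apply/eqP/negPn/negP => H; apply: N; exists t.
have [l [r [lr lrI]]] := interval_inner.
apply: (@segment_uncountable R l r [set t | I t /\ A t = A l] lr); last first.
  exact: level_countable.
move=> s /andP[ls sr]; split; first by apply: interior_subset; apply: lrI; rewrite ls.
have [->//|ns] := eqVneq s l.
have ls' : l < s by rewrite lt_neqAle eq_sym ns.
have [|w /andP[lw ws]] := @mean_value R A (derive1 A) l s ls'.
  by move=> x /andP[lx xs]; apply: derA; apply: lrI; rewrite lx (le_trans xs).
rewrite dA; last by apply: lrI; rewrite (ltW lw) (le_trans (ltW ws)).
by rewrite mul0r => /eqP; rewrite subr_eq0 => /eqP.
Qed.

(** The tangent of the characteristic is an eigenvector of the Hessian with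
    eigenvalue A t. *)
Lemma curvature_root t W U E f u : graph_on M W U E f -> I t -> E u ->
  c t (lift3 f u) -> A t ^+ 2 - htrace f u * A t + hdet f u = 0.
Proof.
move=> G It Eu cu.
have [g [v [e [e0 g0 v0 _ gv]]]] := curve_param (cc It) cu.
have [_ Wu] := graph_lift G Eu.
have dg : is_derive (0 : R) 1 g (v 0) by have [] := gv 0; rewrite ?normr0.
have cg s : 0 <= s < e -> c t (g s).
  by move=> /andP[s0 se]; have [] := gv s; rewrite ?ger0_norm.
have Wg : W (g 0) by rewrite g0.
have [] := channel_eigen ct G It e0 dg cg Wg.
rewrite g0 top_lift3.
move=> w2 e1 e2.
have w0 : v 0 0 0 != 0 \/ v 0 0 1 != 0.
  have [w0|] := eqVneq (v 0 0 0) 0; last by left.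
  have [w1|] := eqVneq (v 0 0 1) 0; last by right.
  exfalso; move/eqP: v0; apply; apply: rV3P; rewrite mxE//.
  by rewrite w2 w0 w1 !mul0r addr0.
exact: (eigenvalue_root e1 e2 w0).
Qed.

Lemma derive_affine (F : 'rV[R]_2 -> R) (u v : 'rV[R]_2) (V : set 'rV[R]_2) k0 b0 i :
  open V -> V u -> differentiable F u -> (forall w, V w -> F w = k0 * w 0 i + b0) ->
  'D_v F u = k0 * v 0 i.
Proof.
move=> oV Vu dF H.
have [e e0 He] := line_near v oV Vu.
have d1 : is_derive (0 : R) 1 (fun s => F (u + s *: v)) ('D_v F u).
  have := @is_derive_line R _ F u v 0; rewrite scale0r addr0; apply.
  exact: diff_derivable.
have d2 := derScale k0 (is_derive_coord_line u v i).
have d3 := derSub d1 (derAdd d2 (derCst 0 b0)).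
apply/eqP; rewrite -subr_eq0 -[X in _ - X]addr0; apply/eqP.
apply: (is_derive_right0 e0 d3) => s /andP[s0 se]; rewrite add0r in se.
by rewrite H ?subrr//; apply: He; rewrite ger0_norm.
Qed.

(** On such a ball the curvature is k0, so only characteristics with A t = k0
    pass through it, and there are countably many of these. *)
Lemma no_umbilic_ball W U E f y (e k0 b0 c0 : R) : graph_on M W U E f -> 0 < e ->
  ball y e `<=` E ->
  ~ (forall u, ball y e u -> D0 f u = k0 * u 0 0 + b0 /\ D1 f u = k0 * u 0 1 + c0).
Proof.
move=> G e0 BE H.
have [_ [oU [df Df]] DU _ _] := G.
have NI : [set t | I t /\ A t = k0] `<=` I by move=> t [].
apply: (characteristics_meager cc G e0 BE (level_countable k0) NI) => u Bu.
have Eu := BE _ Bu; have Uu := DU _ Eu.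
have [Mu _] := graph_lift G Eu.
have [t It cu] := covered Mu.
exists t => //; split => //.
have oB : open (ball y e) by exact: ball_open.
have d0 : differentiable (D0 f) u by have [+ _] := Df (delta_mx 0 0); apply.
have d1 : differentiable (D1 f) u by have [+ _] := Df (delta_mx 0 1); apply.
have h0 v := derive_affine v oB Bu d0 (fun w Bw => (H w Bw).1).
have h1 v := derive_affine v oB Bu d1 (fun w Bw => (H w Bw).2).
have e00 : D0 (D0 f) u = k0 by have := h0 (delta_mx 0 0); rewrite mxE mulr1.
have e01 : D1 (D0 f) u = 0 by have := h0 (delta_mx 0 1); rewrite mxE mulr0.
have e11 : D1 (D1 f) u = k0 by have := h1 (delta_mx 0 1); rewrite mxE mulr1.
have eT : htrace f u = k0 + k0 by rewrite /htrace e00 e11.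
have eD : hdet f u = k0 * k0 by rewrite /hdet e00 e11 e01 mulr0 subr0.
have := curvature_root G It Eu cu; rewrite eT eD => E0.
have : (A t - k0) ^+ 2 = 0 by rewrite -E0; ring.
by move/eqP; rewrite sqrf_eq0 subr_eq0 => /eqP.
Qed.

(** The quadratic formula for the principal curvatures. On a small ball the
    square root does no harm: either the discriminant vanishes identically, or
    it is positive at some point and near it. *)
Lemma curvature_branches W U E f y (r : R) : graph_on M W U E f -> 0 < r ->
  ball y r `<=` E ->
  exists (z : 'rV[R]_2) (e : R) (k : bool -> 'rV[R]_2 -> R),
  [/\ 0 < e, ball z e `<=` ball y r,
      forall b u, ball z e u -> differentiable (k b) u
    & forall u t, ball z e u -> I t -> c t (lift3 f u) -> exists b, A t = k b u].
Proof.
have pos_near (a b : R) : `|a - b| < a -> 0 < b by rewrite ltr_norml; lra.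
have branch (a T s : R) : (2 * a - T) ^+ 2 = s ^+ 2 ->
    exists b : bool, a = (T + (if b then 1 else -1) * s) * 2^-1.
  by move/eqP; rewrite eqf_sqr => /orP[/eqP E1|/eqP E1]; [exists true|exists false]; lra.
move=> G r0 BE.
have [_ [oU Cf] DU _ _] := G.
have [df Df] := Cf.
have dd i j u : U u -> differentiable ('D_(delta_mx 0 i) ('D_(delta_mx 0 j) f)) u.
  by move=> Uu; have [_ /(_ (delta_mx 0 i))[+ _]] := Df (delta_mx 0 j); apply.
have dT u : U u -> differentiable (htrace f) u by move=> Uu; apply: differentiableD; exact: dd.
have dD u : U u -> differentiable (hdet f) u.
  move=> Uu; have -> : hdet f = (D0 (D0 f)) * (D1 (D1 f)) - (D0 (D1 f)) * (D1 (D0 f)) by [].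
  by apply: differentiableB; apply: differentiableM; exact: dd.
pose disc u := htrace f u * htrace f u - 4 * hdet f u.
have ddisc u : U u -> differentiable disc u.
  move=> Uu; apply: differentiableB.
    by apply: differentiableM; exact: dT.
  by apply: differentiableM; [exact: differentiable_cst|exact: dD].
have BU : ball y r `<=` U by move=> u /BE /DU.
have root u t : ball y r u -> I t -> c t (lift3 f u) ->
    (2 * A t - htrace f u) ^+ 2 = disc u.
  move=> Bu It cu; have := curvature_root G It (BE _ Bu) cu => E0.
  have -> : disc u = htrace f u * htrace f u - 4 * (htrace f u * A t - A t ^+ 2).
    by rewrite /disc; lra.
  by ring.
have [[u1 [Bu1 d1]]|N] := pselect (exists u, ball y r u /\ disc u != 0); last first.
  exists y, r, (fun _ u => htrace f u * 2^-1); split => //.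
    move=> _ u Bu; apply: differentiableM; [exact: dT (BU _ Bu)|exact: differentiable_cst].
  move=> u t Bu It cu; exists true; have := root u t Bu It cu.
  have -> : disc u = 0 by apply/eqP/negPn/negP => H; apply: N; exists u.
  by move/eqP; rewrite sqrf_eq0 subr_eq0 => /eqP <-; field.
have disc0 : 0 < disc u1.
  have [Mu _] := graph_lift G (BE _ Bu1); have [t It cu] := covered Mu.
  by rewrite lt_neqAle eq_sym d1/= -(root u1 t Bu1 It cu) sqr_ge0.
have cdisc := differentiable_continuous (ddisc _ (BU _ Bu1)).
have /nbhs_ballP[e1 /= e10 H1] := near_continuous cdisc disc0.
have oB : open (ball y r) by exact: ball_open.
have /nbhs_ballP[e2 /= e20 H2] := open_nbhs_nbhs (conj oB Bu1).
pose e := Num.min e1 e2.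
have e0 : 0 < e by rewrite lt_min e10.
have sub1 : ball u1 e `<=` ball u1 e1 by apply: le_ball; rewrite ge_min lexx.
have sub2 : ball u1 e `<=` ball y r.
  by move=> u Bu; apply: H2; apply: le_ball Bu; rewrite ge_min lexx orbT.
have pos u : ball u1 e u -> 0 < disc u.
  by move=> Bu; exact: (pos_near _ _ (H1 _ (sub1 _ Bu))).
exists u1, e, (fun b u => (htrace f u + (if b then 1 else -1) * Num.sqrt (disc u)) * 2^-1).
split => //.
  move=> b u Bu; have Uu := BU _ (sub2 _ Bu).
  apply: differentiableM; last exact: differentiable_cst.
  apply: differentiableD; first exact: dT.
  apply: differentiableM; first exact: differentiable_cst.
  apply: (@differentiable_comp R _ _ _ disc Num.sqrt); first exact: ddisc.
  by apply/derivable1_diffP; have [] := is_derive1_sqrt (pos _ Bu).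
move=> u t Bu It cu; have E0 := root u t (sub2 _ Bu) It cu.
have E1 : Num.sqrt (disc u) ^+ 2 = disc u by apply: sqr_sqrtr; apply: ltW; exact: pos.
exact: branch (etrans E0 (esym E1)).
Qed.

End NonconstantRadius.

(** * Smooth choice of the tangent sphere *)

Section LocalFamily.
Context {R : realType}.
Variables (M : set 'rV[R]_3) (I : set R) (A B C D : R -> R) (c : R -> set 'rV[R]_3).
Hypothesis cc : forall t, I t -> curve_without_endpoints (c t).
Hypothesis ct : forall t, I t -> forall p, c t p ->
  tangent_at M (parabolic_sphere (A t) (B t) (C t) (D t)) p.
Hypothesis cM : M = \bigcup_(t in I) c t.
Hypothesis iI : is_interval I.
Hypothesis sA : smooth_on I A.
Hypothesis sB : smooth_on I B.
Hypothesis sC : smooth_on I C.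
Hypothesis sD : smooth_on I D.
Hypothesis aA : analytic_on I A.
Hypothesis Anc : exists s t, [/\ I s, I t & A s != A t].

(** First order contact of the graph of f with the sphere of parameter t above
    u. Unlike membership of a characteristic, this is a closed condition in u
    and t jointly. *)
Definition contact (f : 'rV[R]_2 -> R) (t : R) (u : 'rV[R]_2) : Prop :=
  [/\ D0 f u = A t * u 0 0 + B t / 2, D1 f u = A t * u 0 1 + C t / 2
    & 2 * f u = A t * (u 0 0 ^+ 2 + u 0 1 ^+ 2) + B t * u 0 0 + C t * u 0 1 + D t].

Lemma contact_curve W U E f t u : graph_on M W U E f -> E u -> I t ->
  c t (lift3 f u) -> contact f t u.
Proof.
move=> G Eu It cu; have [Mu Wu] := graph_lift G Eu.
by have [] := channel_graph ct It cu (graph_local G Mu Wu); rewrite top_lift3 !ptE.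
Qed.

(** A parameter interval about m on which A can be inverted. Twice the radius
    leaves room around the closed interval of radius d, in which the parameters
    of contact_closed range. *)
Definition regular (m d : R) : Prop :=
  0 < d /\ forall t, m - 2 * d <= t <= m + 2 * d -> I° t /\ derive1 A t != 0.

(** Rational centres and radii, so that countably many intervals suffice for the
    Baire property. *)
Lemma regular_rat t : I° t -> derive1 A t != 0 ->
  exists q : rat * rat, regular (ratr q.1) (ratr q.2) /\ `|t - ratr q.1| <= ratr q.2.
Proof.
move=> It At.
have cA1 : {for t, continuous (derive1 A)}.
  apply/differentiable_continuous/derivable1_diffP.
  exact: (@smooth_interior R I A sA t It 1%N).
have /nbhs_ballP[e1 /= e10 H1] := near_neq0 cA1 At.
have oI : open I° by exact: open_interior.
have /nbhs_ballP[e2 /= e20 H2] := open_nbhs_nbhs (conj oI It).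
pose e := Num.min e1 e2.
have e0 : 0 < e by rewrite lt_min e10.
have [d] : exists q : rat, (ratr q : R) \in `]0, (e / 4)[ by apply: rat_in_itvoo; rewrite divr_gt0.
rewrite in_itv/= => /andP[d0 de].
have [m] : exists q : rat, (ratr q : R) \in `](t - ratr d), (t + ratr d)[ by apply: rat_in_itvoo; lra.
rewrite in_itv/= => /andP[mt tm].
exists (m, d) => /=; split; last by rewrite ler_norml; lra.
split => // s sm.
have ts : `|t - s| < e by rewrite ltr_norml; lra.
split; first by apply: H2; rewrite /ball/= (lt_le_trans ts)// ge_min lexx orbT.
by apply: H1; rewrite /ball/= (lt_le_trans ts)// ge_min lexx.
Qed.

Lemma regular_inverse m d : regular m d ->
  exists (g : R -> R) (l r : R),
  [/\ forall t, m - 2 * d < t < m + 2 * d -> l < A t < r /\ g (A t) = t,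
      forall s, l < s < r -> [/\ m - 2 * d < g s < m + 2 * d, A (g s) = s
        & is_derive s 1 g (derive1 A (g s))^-1]
    & forall x t y, m - 2 * d <= x -> x <= t <= y -> y <= m + 2 * d ->
        Num.min (A x) (A y) <= A t <= Num.max (A x) (A y)].
Proof.
move=> [d0 H]; apply: (@monotone_inverse R A (derive1 A)); first lra.
by move=> t /H[It At]; split; [have := derA sA It|].
Qed.

(** The parameter of the sphere in contact is a continuous function of the
    curvature, so contact persists in the limit. *)
Lemma contact_closed W U E f (z : 'rV[R]_2) (e : R) (k : 'rV[R]_2 -> R) m d (e' : R) :
  graph_on M W U E f -> 0 < e' < e -> ball z e `<=` E ->
  (forall u, ball z e u -> {for u, continuous k}) -> regular m d ->
  closed [set u | closed_ball z e' u /\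
     exists t, [/\ `|t - m| <= d, k u = A t & contact f t u]].
Proof.
move=> G /andP[e'0 e'e] BE ck reg u clu; set F := [set _ | _] in clu.
have [_ [oU [df Df]] DU _ _] := G.
have [d0 Hreg] := reg.
have [g [l [r [g1 g2 g3]]]] := regular_inverse reg.
have BB : closed_ball z e' `<=` ball z e.
  move=> w; rewrite closed_ballE// /closed_ball_/= -ball_normE /ball_/= => yx.
  exact: (le_lt_trans yx).
have Bu : closed_ball z e' u.
  apply: closed_ball_closed => V /clu[w [[Bw _] Vw]]; by exists w.
split => //.
have Bu' := BB _ Bu; have cku := ck _ Bu'; have Uu := DU _ (BE _ Bu').
have Fk w : F w -> g (k w) = g (k w) /\ exists t, [/\ `|t - m| <= d, k w = A t, contact f t w & g (k w) = t].
  move=> [_ [t [tm kt co]]]; split => //; exists t; split => //.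
  rewrite kt; have [|_ //] := g1 t; move: tm; rewrite ler_norml; lra.
pose al := Num.min (A (m - d)) (A (m + d)); pose be := Num.max (A (m - d)) (A (m + d)).
have kF w : F w -> al <= k w <= be.
  move=> [_ [t [tm -> _]]]; apply: g3; move: tm; rewrite ?ler_norml; lra.
have ku1 : al <= k u by apply: le_on_closure clu cku _ => w /kF/andP[].
have ku2 : k u <= be.
  rewrite -lerN2; apply: (@le_on_closure R _ F (fun w => - k w) _ u clu).
    exact: continuousN.
  by move=> w /kF/andP[_]; rewrite lerN2.
have [lm _] : l < A (m - d) < r /\ g (A (m - d)) = m - d by apply: g1; lra.
have [lp _] : l < A (m + d) < r /\ g (A (m + d)) = m + d by apply: g1; lra.
have lkr : l < k u < r.
  apply/andP; split.
    by apply: lt_le_trans ku1; rewrite lt_min; lra.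
  by apply: (le_lt_trans ku2); rewrite gt_max; lra.
have [gab Ag dg] := g2 _ lkr.
have cg : {for u, continuous (fun w => g (k w))}.
  by apply: contComp cku; exact: derivable_cont dg.
have Ig : I° (g (k u)) by have [|//] := Hreg (g (k u)); rewrite !ltW; case/andP: gab.
have cS h : smooth_on I h -> {for u, continuous (fun w => h (g (k w)))}.
  move=> sh; apply: (@contComp R _ u h (fun w => g (k w))) => //.
  by apply: derivable_cont (derA sh Ig).
have cA := cS _ sA; have cB := cS _ sB; have cC := cS _ sC; have cD := cS _ sD.
have cx i : {for u, continuous (fun w : 'rV[R]_2 => w 0 i)} by exact: coord_continuous.
have oB : open (ball z e) by exact: ball_open.
have c2 : {for u, continuous (fun _ : 'rV[R]_2 => 2^-1 : R)} by exact: contCst.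
have cf : {for u, continuous f} by apply: differentiable_continuous; exact: df.
have cDi i : {for u, continuous ('D_(delta_mx 0 i) f)}.
  by apply: differentiable_continuous; have [+ _] := Df (delta_mx 0 i); apply.
exists (g (k u)); split => //.
- rewrite ler_norml; apply/andP; split.
    rewrite lerBrDr; apply: (@le_on_closure R _ F (fun w => g (k w)) _ u clu cg) => w Fw.
    by have [_ [t [+ _ _ ->]]] := Fk w Fw; rewrite ler_norml; lra.
  suff : - (m + d) <= - g (k u) by lra.
  apply: (@le_on_closure R _ F (fun w => - g (k w)) _ u clu); first exact: continuousN.
  move=> w Fw.
  by have [_ [t [+ _ _ ->]]] := Fk w Fw; rewrite ler_norml; lra.
- split.
  + apply: (@eq_on_closure R _ (ball z e) F (D0 f)
      (fun w => A (g (k w)) * w 0 0 + B (g (k w)) * 2^-1) u oB Bu' clu (cDi 0)).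
      exact: (contAdd (contMul cA (cx 0)) (contMul cB c2)).
    by move=> w _ /Fk[_ [t [_ _ [E0 _ _] ->]]].
  + apply: (@eq_on_closure R _ (ball z e) F (D1 f)
      (fun w => A (g (k w)) * w 0 1 + C (g (k w)) * 2^-1) u oB Bu' clu (cDi 1)).
      exact: (contAdd (contMul cA (cx 1)) (contMul cC c2)).
    by move=> w _ /Fk[_ [t [_ _ [_ E0 _] ->]]].
  + apply: (@eq_on_closure R _ (ball z e) F (fun w => 2 * f w)
      (fun w => A (g (k w)) * (w 0 0 * w 0 0 + w 0 1 * w 0 1) + B (g (k w)) * w 0 0 + C (g (k w)) * w 0 1 + D (g (k w))) u oB Bu' clu).
    * by apply: contMul cf; exact: contCst.
    * apply: contAdd cD; apply: contAdd (contMul cC (cx 1)); apply: contAdd (contMul cB (cx 0)).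
      by apply: (contMul cA); apply: contAdd; exact: contMul.
    by move=> w _ /Fk[_ [t [_ _ [_ _ E0] ->]]].
Qed.

(** By the Baire property one of the closed sets of contact_closed, or one of
    countably many characteristics, has interior points; a characteristic has
    none. *)
Lemma local_family W U E f y (r0 : R) : graph_on M W U E f -> 0 < r0 ->
  ball y r0 `<=` E ->
  exists (z : 'rV[R]_2) (e : R) (k : 'rV[R]_2 -> R) (m d : R),
  [/\ 0 < e, ball z e `<=` ball y r0, regular m d,
      forall u, ball z e u -> differentiable k u
    & forall u, ball z e u -> exists t, [/\ `|t - m| <= d, k u = A t & contact f t u]].
Proof.
move=> G r00 BE.
have [z [e [k [e0 zy dk kA]]]] := curvature_branches cc ct cM G r00 BE.
have e'0 : 0 < e / 2 by rewrite divr_gt0.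
have e'e : 0 < e / 2 < e by rewrite e'0/=; lra.
have ze : ball z (e / 2) `<=` ball z e by apply: le_ball; lra.
have zE : ball z e `<=` E by move=> u /zy/BE.
pose N1 := [set t | I t /\ (I° t -> derive1 A t = 0)].
pose F1 t := [set u | closed_ball z (e / 2) u /\ c t (lift3 f u)].
have cN1 : countable N1 by exact: critical_countable.
have cF1 t : N1 t -> closed (F1 t) by move=> [It _]; exact: (closed_trace cc G It e'e zE).
pose N2 := [set q : rat * rat * bool | regular (ratr q.1.1) (ratr q.1.2)].
pose F2 (q : rat * rat * bool) := [set u | closed_ball z (e / 2) u /\
  exists t, [/\ `|t - ratr q.1.1| <= ratr q.1.2, k q.2 u = A t & contact f t u]].
have cF2 q : N2 q -> closed (F2 q).
  move=> reg; apply: (contact_closed G e'e zE _ reg) => u Bu.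
  exact/differentiable_continuous/dk.
have cN2 : countable N2 by exact: countableP.
have [|[t [w [e1 [[It _] e10 He1]]]]|[[[m d] b] [w [e1 [reg e10 He1]]]]] :=
  @Baire_two R 'rV[R]_2 _ _ N1 F1 N2 F2 z (e / 2) e'0 cN1 cN2 cF1 cF2.
- move=> u Bu; have Bcu : closed_ball z (e / 2) u by exact: subset_closed_ball.
  have Bu' := ze _ Bu; have Eu := zE _ Bu'.
  have [Mu _] := graph_lift G Eu; have [t It cu] := covered cM Mu.
  have [N1t|nN] := pselect (N1 t); first by left; exists t.
  right.
  have [It' At] : I° t /\ derive1 A t != 0.
    split; first by apply: contrapT => nI; apply: nN; split => // /nI.
    by apply/eqP => A0; apply: nN.
  have [[m d] [reg tm]] := regular_rat It' At.
  have [b kb] := kA u t Bu' It cu.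
  exists (m, d, b) => //; split => //; exists t; split => //.
  exact: (contact_curve G Eu It cu).
- exfalso; apply: (@curve_no_interior R M I c cc t W U E f w e1 G It e10).
    by move=> u /He1[_ /ze/zE].
  by move=> u /He1[[]].
- exists w, e1, (k b), (ratr m), (ratr d); split => //.
  + by move=> u /He1[_ /ze/zy].
  + by move=> u /He1[_ /ze]; exact: dk.
  + by move=> u /He1[[]].
Qed.

End LocalFamily.

(** * The coefficients are affine in the curvature *)

Section Bend.
Context {R : realFieldType}.
Variables (P Q Q' S p q x y k : R).
Hypothesis (eP : P = p * x + k) (eS : S = q * y + k).

Lemma bend_trace : (P + S) / 2 = k + (p * x + q * y) / 2.
Proof. by rewrite eP eS; field. Qed.

Lemma bend_det : Q = p * y -> Q' = q * x -> P * S - Q * Q' = k ^+ 2 + k * (p * x + q * y).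
Proof. by move=> -> ->; rewrite eP eS; ring. Qed.

End Bend.

Section AffineFamily.
Context {R : realType}.
Variables (M : set 'rV[R]_3) (I : set R) (A B C D : R -> R) (c : R -> set 'rV[R]_3).
Hypothesis cc : forall t, I t -> curve_without_endpoints (c t).
Hypothesis ct : forall t, I t -> forall p, c t p ->
  tangent_at M (parabolic_sphere (A t) (B t) (C t) (D t)) p.
Hypothesis cM : M = \bigcup_(t in I) c t.
Hypothesis iI : is_interval I.
Hypothesis sA : smooth_on I A.
Hypothesis sB : smooth_on I B.
Hypothesis sC : smooth_on I C.
Hypothesis sD : smooth_on I D.
Hypothesis aA : analytic_on I A.
Hypothesis Anc : exists s t, [/\ I s, I t & A s != A t].

Lemma graph_ball (f : 'rV[R]_2 -> R) W U E u : graph_on M W U E f -> E u ->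
  forall e, 0 < e -> exists y r, [/\ 0 < r, ball y r `<=` E & ball y r `<=` ball u e].
Proof.
move=> [_ _ _ EE _] Eu e e0.
have [y [Ey uy]] := EE _ Eu _ (nbhsx_ballx u e e0).
have nE : nbhs y E by exact: Ey.
have /nbhs_ballP[r1 /= r10 H1] := nE.
have oB : open (ball u e) by exact: ball_open.
have /nbhs_ballP[r2 /= r20 H2] := open_nbhs_nbhs (conj oB uy).
exists y, (Num.min r1 r2); split; first by rewrite lt_min r10.
  by move=> w Bw; apply: H1; apply: le_ball Bw; rewrite ge_min lexx.
by move=> w Bw; apply: H2; apply: le_ball Bw; rewrite ge_min lexx orbT.
Qed.

Lemma constant_of_gradient (k : 'rV[R]_2 -> R) u e :
  (forall w, ball u e w -> differentiable k w) ->
  (forall w v, ball u e w -> 'D_v k w = 0) ->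
  forall w, ball u e w -> k w = k u.
Proof.
move=> dk Dk w Bw.
have inB s : 0 <= s <= 1 -> ball u e (u + s *: (w - u)).
  move=> /andP[s0 s1]; move: Bw; rewrite -!ball_normE /ball_/= => Bw.
  rewrite opprD addNKr normrN normrZ ger0_norm// distrC.
  by apply: le_lt_trans Bw; rewrite ler_piMl.
have [|s /andP[s0 s1]] := @mean_value R (fun s => k (u + s *: (w - u))) (fun=> 0) 0 1 ltr01.
  move=> s /inB Bs.
  have := @is_derive_line R _ k u (w - u) s (diff_derivable (dk _ Bs)).
  by rewrite Dk.
by rewrite scale0r scale1r addr0 subrKC mul0r => /eqP; rewrite subr_eq0 => /eqP.
Qed.

Variable Z : set 'rV[R]_2.
Hypothesis Z0 : forall v : 'rV[R]_2, ~ (\near v, Z v).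
Hypothesis gM : forall p, M p -> exists2 f, local_graph M p f &
  Z (pt2 (htrace f (top p) / 2) (hdet f (top p))).
Hypothesis Mn0 : M !=set0.

Lemma curvature_relation W U E f u : graph_on M W U E f -> E u ->
  Z (pt2 (htrace f u / 2) (hdet f u)).
Proof.
move=> G Eu; have [Mu Wu] := graph_lift G Eu.
have [f' lf' +] := gM Mu.
have lf := graph_local G Mu Wu.
have H i j := local_graph_hess (delta_mx 0 i) (delta_mx 0 j) Mu lf' lf.
rewrite top_lift3 in H *.
have eT : htrace f' u = htrace f u := f_equal2 (fun x y => x + y) (H 0 0) (H 1 1).
have eD : hdet f' u = hdet f u := f_equal2 (fun x y => x - y)
  (f_equal2 (fun x y => x * y) (H 0 0) (H 1 1)) (f_equal2 (fun x y => x * y) (H 0 1) (H 1 0)).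
by rewrite eT eD.
Qed.

(** On the disc of local_family, with the spheres parametrised by their
    curvature k, centres_constant applies: half the derivatives of B and C by k
    are constant on an interval. *)
Lemma affine_interval : exists (N : set R) (b1 c1 b2 c2 : R),
  [/\ ~ countable N, N `<=` I &
     forall t, N t -> B t / 2 = b1 * A t + c1 /\ C t / 2 = b2 * A t + c2].
Proof.
have [p0 Mp0] := Mn0; have [f /local_graphP[W [U [E [Wp G]]]] _] := gM Mp0.
have [E0 _] := graph_top G Mp0 Wp.
have [y [r0 [r00 BE _]]] := graph_ball G E0 ltr01.
have [z [e [k [m [d [e0 zy reg dk kA]]]]]] :=
  local_family cc ct cM iI sA sB sC sD aA Anc G r00 BE.
have [g [l [r [g1 g2 g3]]]] := regular_inverse sA reg.
have [d0 Hreg] := reg.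
have [_ [oU [df Df]] DU _ _] := G.
have zE : ball z e `<=` E by move=> u /zy/BE.
have zU : ball z e `<=` U by move=> u /zE/DU.
have oV : open (ball z e) by exact: ball_open.
have kab u : ball z e u -> l < k u < r.
  move=> /kA[t [tm -> _]]; have [|//] := g1 t; move: tm; rewrite ler_norml; lra.
have co u : ball z e u -> A (g (k u)) = k u /\ contact A B C D f (g (k u)) u.
  move=> Bu; have [t [tm kt cot]] := kA u Bu.
  have [|_ gt] := g1 t; first by move: tm; rewrite ler_norml; lra.
  by rewrite kt gt.
have Ig s : l < s < r -> I° (g s) /\ derive1 A (g s) != 0.
  by move=> /g2[gab _ _]; apply: Hreg; rewrite !ltW; case/andP: gab.
pose hq (h : R -> R) s := derive1 h (g s) / derive1 A (g s).
pose q' (h : R -> R) t := (derive1 (derive1 h) t * derive1 A t - derive1 h t * derive1 (derive1 A) t)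
   / derive1 A t ^+ 2.
pose hq' (h : R -> R) s := q' h (g s) / derive1 A (g s).
have dF h : smooth_on I h -> forall s, l < s < r -> is_derive s 1 (fun s => h (g s)) (hq h s).
  move=> sh s ls; have [gab _ dg] := g2 s ls; have [Is _] := Ig s ls.
  exact: derComp (derA sh Is) dg.
have der2 h : smooth_on I h -> forall t, I° t ->
    is_derive t 1 (derive1 h) (derive1 (derive1 h) t).
  move=> sh t It; rewrite [X in is_derive _ _ _ X]derive1E; apply: derivableP.
  exact: (@smooth_interior R I h sh t It 1%N).
have cont2 h : smooth_on I h -> forall t, I° t -> {for t, continuous (derive1 (derive1 h))}.
  move=> sh t It; apply/differentiable_continuous/derivable1_diffP.
  exact: (@smooth_interior R I h sh t It 2%N).
have dhq h : smooth_on I h -> forall s, l < s < r -> is_derive s 1 (hq h) (hq' h s).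
  move=> sh s ls; have [gab _ dg] := g2 s ls; have [Is As] := Ig s ls.
  have dq := derDiv (der2 _ sh _ Is) (der2 _ sA _ Is) As.
  exact: (derComp dq dg).
have chq h : smooth_on I h -> forall s, l < s < r -> {for s, continuous (hq' h)}.
  move=> sh s ls; have [gab _ dg] := g2 s ls; have [Is As] := Ig s ls.
  have cg := derivable_cont dg.
  have c1 := derivable_cont (der2 _ sh _ Is); have c2 := cont2 _ sh _ Is.
  have a1 := derivable_cont (der2 _ sA _ Is); have a2 := cont2 _ sA _ Is.
  have cq : {for g s, continuous (q' h)}.
    exact: (contDiv (contSub (contMul c2 a1) (contMul c1 a2)) (contMul a1 a1) (expf_neq0 2 As)).
  exact: (contDiv (contComp cq cg) (contComp a1 cg) As).
have sF h : smooth_on I h -> forall u v, ball z e u ->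
    is_derive (0 : R) 1 (fun s => h (g (k (u + s *: v)))) (hq h (k u) * 'D_v k u).
  by move=> sh u v Bu; exact: (is_derive_k_line dk v Bu (dF _ sh _ (kab _ Bu))).
have kline u v : ball z e u -> is_derive (0 : R) 1 (fun s => k (u + s *: v)) ('D_v k u).
  move=> Bu; have := @is_derive_line R _ k u v 0.
  by rewrite scale0r addr0; apply; exact/diff_derivable/dk.
pose b1 s := 2^-1 * hq B s; pose b2 s := 2^-1 * hq C s; pose dd := hq D.
pose b1' s := 2^-1 * hq' B s; pose b2' s := 2^-1 * hq' C s; pose dd' := hq' D.
have grad u v : ball z e u -> circle b1 b2 dd (k u) u * 'D_v k u = 0.
  move=> Bu.
  have dx := is_derive_coord_line u v 0; have dy := is_derive_coord_line u v 1.
  have dkl := kline u v Bu.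
  have dfl : is_derive (0 : R) 1 (fun s => f (u + s *: v)) ('D_v f u).
    have := @is_derive_line R _ f u v 0.
    by rewrite scale0r addr0; apply; exact/diff_derivable/df/zU.
  have DD := derSub (derAdd (derAdd (derAdd
     (derMul dkl (derAdd (derMul dx dx) (derMul dy dy)))
     (derMul (sF _ sB u v Bu) dx)) (derMul (sF _ sC u v Bu) dy)) (sF _ sD u v Bu)) (derScale 2 dfl).
  have [e1 e10 He] := line_near v oV Bu.
  have := is_derive_right0 e10 DD.
  rewrite /= scale0r addr0.
  have [Ak [k0 k1 k2]] := co u Bu.
  rewrite (derive_coord2 _ (df u (zU u Bu))).
  rewrite k0 k1 Ak /circle /b1 /b2 /dd => <-.
    by field.
  move=> s /andP[s0 se]; rewrite add0r in se.
  have Bs : ball z e (u + s *: v) by apply: He; rewrite ger0_norm.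
  have [Aks [_ _ ->]] := co _ Bs.
  by rewrite Aks; ring.
have cx i u : {for u, continuous (fun w : 'rV[R]_2 => w 0 i)} by exact: coord_continuous.
have Q0 u : ball z e u -> circle b1 b2 dd (k u) u = 0.
  move=> Bu; apply/eqP/negPn/negP => Q.
  have ck := differentiable_continuous (dk u Bu).
  have ku := kab u Bu.
  have cT (h : R -> R) : smooth_on I h -> {for u, continuous (fun w => hq h (k w))}.
    by move=> sh; apply: contComp ck; exact: derivable_cont (dhq _ sh _ ku).
  have c2 : {for u, continuous (fun _ : 'rV[R]_2 => 2^-1 : R)} by exact: contCst.
  have c2' : {for u, continuous (fun _ : 'rV[R]_2 => 2 : R)} by exact: contCst.
  have cC : {for u, continuous (fun w => circle b1 b2 dd (k w) w)}.
    apply: contAdd (cT _ sD).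
    apply: contAdd (contMul (contMul c2' (contMul c2 (cT _ sC))) (cx 1 u)).
    apply: contAdd (contMul (contMul c2' (contMul c2 (cT _ sB))) (cx 0 u)).
    exact: (contAdd (contMul (cx 0 u) (cx 0 u)) (contMul (cx 1 u) (cx 1 u))).
  have /nbhs_ballP[r1 /= r10 H1] := near_neq0 cC Q.
  have /nbhs_ballP[r2 /= r20 H2] := open_nbhs_nbhs (conj oV Bu).
  pose e1 := Num.min r1 r2.
  have e10 : 0 < e1 by rewrite lt_min r10.
  have sub1 : ball u e1 `<=` ball u r1 by apply: le_ball; rewrite ge_min lexx.
  have sub2 : ball u e1 `<=` ball z e.
    by move=> w Bw; apply: H2; apply: le_ball Bw; rewrite ge_min lexx orbT.
  have kc w : ball u e1 w -> k w = k u.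
    apply: constant_of_gradient => [w' /sub2 /dk//|w' v Bw'].
    have := grad w' v (sub2 _ Bw') => /eqP.
    by rewrite mulf_eq0 (negbTE (H1 _ (sub1 _ Bw'))) => /eqP.
  apply: (no_umbilic_ball cc ct cM iI aA Anc G e10
    (k0 := k u) (b0 := B (g (k u)) / 2) (c0 := C (g (k u)) / 2) (y := u)).
    by move=> w /sub2/zE.
  move=> w Bw; have [Akw [-> -> _]] := co w (sub2 _ Bw).
  by rewrite Akw kc.
have HZ u : ball z e u -> Z (pt2 (k u + bend k b1 b2 u / 2) (k u ^+ 2 + k u * bend k b1 b2 u)).
  move=> Bu.
  have hess (i : 'I_2) h v : smooth_on I h ->
      (forall w, ball z e w -> 'D_(delta_mx 0 i) f w = k w * w 0 i + h (g (k w)) / 2) ->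
      'D_v ('D_(delta_mx 0 i) f) u = 'D_v k u * (u 0 i + 2^-1 * hq h (k u)) + k u * v 0 i.
    move=> sh Hf.
    have dx := is_derive_coord_line u v i.
    have dfl : is_derive (0 : R) 1 (fun s => 'D_(delta_mx 0 i) f (u + s *: v)) ('D_v ('D_(delta_mx 0 i) f) u).
      have := @is_derive_line R _ ('D_(delta_mx 0 i) f) u v 0.
      rewrite scale0r addr0; apply; apply: diff_derivable.
      by have [+ _] := Df (delta_mx 0 i); apply; exact: zU.
    have DD := derSub dfl (derAdd (derMul (kline u v Bu) dx) (derScale 2^-1 (sF _ sh u v Bu))).
    have [e1 e10 He] := line_near v oV Bu.
    have := is_derive_right0 e10 DD.
    rewrite /= scale0r addr0 => H; apply/eqP; rewrite -subr_eq0; apply/eqP.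
    rewrite -[RHS]H; first by ring.
    move=> s /andP[s0 se]; rewrite add0r in se.
    have Bs : ball z e (u + s *: v) by apply: He; rewrite ger0_norm.
    by rewrite Hf//; ring.
  have f0 w : ball z e w -> D0 f w = k w * w 0 0 + B (g (k w)) / 2.
    by move=> /co[Ak [-> _ _]]; rewrite Ak.
  have f1 w : ball z e w -> D1 f w = k w * w 0 1 + C (g (k w)) / 2.
    by move=> /co[Ak [_ -> _]]; rewrite Ak.
  have h0 v := hess 0 B v sB f0; have h1 v := hess 1 C v sC f1.
  have e00 : D0 (D0 f) u = D0 k u * (u 0 0 + b1 (k u)) + k u.
    by rewrite (h0 _) mxE /= mulr1.
  have e01 : D1 (D0 f) u = D1 k u * (u 0 0 + b1 (k u)).
    by rewrite (h0 _) mxE /= mulr0 addr0.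
  have e10 : D0 (D1 f) u = D0 k u * (u 0 1 + b2 (k u)).
    by rewrite (h1 _) mxE /= mulr0 addr0.
  have e11 : D1 (D1 f) u = D1 k u * (u 0 1 + b2 (k u)) + k u.
    by rewrite (h1 _) mxE /= mulr1.
  have := curvature_relation G (zE _ Bu).
  have -> : htrace f u / 2 = k u + bend k b1 b2 u / 2 := bend_trace e00 e11.
  have -> : hdet f u = k u ^+ 2 + k u * bend k b1 b2 u := bend_det e00 e11 e10 e01.
  by [].
have Vn0 : ball z e !=set0 by exists z; exact: ballxx.
have db1 s (ls : l < s < r) := derScale 2^-1 (dhq _ sB s ls).
have db2 s (ls : l < s < r) := derScale 2^-1 (dhq _ sC s ls).
have cst2 (s : R) : {for s, continuous (fun _ : R => 2^-1 : R)} by exact: contCst.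
have cb1 s (ls : l < s < r) := contMul (cst2 s) (chq _ sB s ls).
have cb2 s (ls : l < s < r) := contMul (cst2 s) (chq _ sC s ls).
have [l' [r' [lr' H]]] := @centres_constant R (ball z e) k l r b1 b2 dd b1' b2' dd' oV dk kab
  db1 db2 (dhq _ sD) cb1 cb2 (chq _ sD) Q0 Z Z0 HZ Vn0.
have sl' s : l' <= s <= r' -> l < s < r by move=> /H[].
have ls1 : l' <= l' <= r' by rewrite lexx ltW.
have cst_int (F F' : R -> R) : (forall s, l' <= s <= r' -> is_derive s 1 F (F' s)) ->
    (forall s, l' <= s <= r' -> F' s = 0) -> forall s, l' <= s <= r' -> F s = F l'.
  move=> dF0 F0 s /andP[ls sr]; have [->//|sn] := eqVneq s l'.
  have lts : l' < s by rewrite lt_neqAle eq_sym sn.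
  have [|t /andP[lt ts]] := @mean_value R F F' l' s lts.
    by move=> t /andP[lt ts]; apply: dF0; rewrite lt (le_trans ts).
  by rewrite F0 ?mul0r ?(ltW lt) ?(le_trans (ltW ts))// => /eqP; rewrite subr_eq0 => /eqP.
have affine h (bb : R -> R) (bb' : R -> R) : smooth_on I h ->
    (forall s, l < s < r -> is_derive s 1 bb (bb' s)) -> (forall s, bb s = 2^-1 * hq h s) ->
    (forall s, l' <= s <= r' -> bb' s = 0) ->
    exists b0 c0, forall s, l' <= s <= r' -> h (g s) / 2 = b0 * s + c0.
  move=> sh dbb bbE bb0.
  have bc := cst_int _ _ (fun s ls => dbb s (sl' s ls)) bb0.
  have dG s : l' <= s <= r' -> is_derive s 1 (fun s => 2^-1 * h (g s) - bb l' * s) (bb s - bb l').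
    move=> ls; have := derSub (derScale 2^-1 (dF _ sh s (sl' s ls))) (derScale (bb l') (is_derive_id s 1)).
    by rewrite mulr1 -bbE.
  have G0 s : l' <= s <= r' -> bb s - bb l' = 0 by move=> /bc ->; rewrite subrr.
  have := cst_int _ _ dG G0 => GG.
  exists (bb l'), (2^-1 * h (g l') - bb l' * l') => s /GG E'.
  by rewrite -E'; ring.
have [B0 [C0 HB]] := affine B b1 b1' sB db1 (fun=> erefl) (fun s ls => let: And3 _ x _ := H s ls in x).
have [B0' [C0' HC]] := affine C b2 b2' sC db2 (fun=> erefl) (fun s ls => let: And3 _ _ x := H s ls in x).
exists (g @` [set s | l' <= s <= r']), B0, C0, B0', C0'; split.
- move=> cN; apply: (@segment_uncountable R l' r' (A @` (g @` [set s | l' <= s <= r'])) lr').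
    by move=> s ls; exists (g s); [exists s|have [_ ->] := g2 s (sl' s ls)].
  exact: sub_countable (card_image_le _ _) cN.
- by move=> _ [s ls <-]; apply: interior_subset; have [] := Ig s (sl' s ls).
- move=> _ [s ls <-]; have [_ -> _] := g2 s (sl' s ls).
  by split; [exact: HB|exact: HC].
Qed.

Hypothesis aB : analytic_on I B.
Hypothesis aC : analytic_on I C.

(** The relation of affine_interval holds on an uncountable set of parameters,
    and nonzero analytic functions have countably many zeros. *)
Lemma affine_relation : exists b1 c1 b2 c2 : R, forall t, I t ->
  B t / 2 = b1 * A t + c1 /\ C t / 2 = b2 * A t + c2.
Proof.
have [N [b1 [c1 [b2 [c2 [cN NI H]]]]]] := affine_interval.
exists b1, c1, b2, c2 => t It.
have E h (b0 c0 : R) : analytic_on I h -> (forall t, N t -> h t / 2 = b0 * A t + c0) ->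
    h t / 2 = b0 * A t + c0.
  move=> ah Hh; apply/eqP/negPn/negP => ne; apply: cN.
  have al := analytic_on_lin 2^-1 (- b0) (- c0) ah aA.
  have nz : exists2 t, I t & 2^-1 * h t + - b0 * A t + - c0 != 0.
    exists t => //; apply: contra ne => /eqP E0; apply/eqP; lra.
  apply: sub_countable (analytic_zeros_countable iI al nz).
  apply: subset_card_le => s Ns; split; first exact: NI.
  by have := Hh s Ns; lra.
by split; apply: E => // s /H[].
Qed.

End AffineFamily.

(** * Radial gradients *)

Section RadialGradient.
Context {R : realType}.
Variables (U E : set 'rV[R]_2) (f : 'rV[R]_2 -> R) (b1 c1 b2 c2 : R).
Hypothesis oU : open U.
Hypothesis Cf : Cr 3 U f.
Hypothesis EU : E `<=` U.
Hypothesis EE : E `<=` closure E°.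
Hypothesis rad : forall u, E u ->
  (u 0 0 + b1) * (D1 f u - c2) - (u 0 1 + b2) * (D0 f u - c1) = 0.

Lemma diff1 i u : U u -> differentiable ('D_(delta_mx 0 i) f) u.
Proof. by move=> Uu; have [_ /(_ (delta_mx 0 i))[+ _]] := Cf; apply. Qed.

Lemma diff2 i j u : U u -> differentiable ('D_(delta_mx 0 i) ('D_(delta_mx 0 j) f)) u.
Proof.
move=> Uu; have [_ /(_ (delta_mx 0 j))[_ /(_ (delta_mx 0 i))[+ _]]] := Cf; apply.
exact: Uu.
Qed.

Lemma cont3 i j l u : U u ->
  {for u, continuous ('D_(delta_mx 0 l) ('D_(delta_mx 0 i) ('D_(delta_mx 0 j) f)))}.
Proof.
move=> Uu; have [_ /(_ (delta_mx 0 j))[_ /(_ (delta_mx 0 i))[_ /(_ (delta_mx 0 l))]]] := Cf.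
by apply.
Qed.

Lemma mixed2 u : U u -> D0 (D1 f) u = D1 (D0 f) u.
Proof. by move=> Uu; apply: (Cr_Schwarz _ _ oU) Uu; exact: (Cr_le _ Cf). Qed.

Lemma mixed3 i u : U u -> 'D_(delta_mx 0 i) (D0 (D1 f)) u = 'D_(delta_mx 0 i) (D1 (D0 f)) u.
Proof. by move=> Uu; apply: near_eq_derive; exact: (near_open oU Uu mixed2). Qed.

Lemma Schwarz1 i u : U u ->
  D0 (D1 ('D_(delta_mx 0 i) f)) u = D1 (D0 ('D_(delta_mx 0 i) f)) u.
Proof.
by move=> Uu; apply: (Cr_Schwarz _ _ oU) Uu; have [_ /(_ (delta_mx 0 i))] := Cf.
Qed.

Lemma derive_line_eq0 (F : 'rV[R]_2 -> R) (V : set 'rV[R]_2) (u v : 'rV[R]_2) l : open V -> V u ->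
  (forall w, V w -> F w = 0) -> is_derive (0 : R) 1 (fun s => F (u + s *: v)) l -> l = 0.
Proof.
move=> oV Vu F0 dF; have [e e0 He] := line_near v oV Vu.
apply: (is_derive_right0 e0 dF) => s /andP[s0 se]; rewrite add0r in se.
by apply: F0; apply: He; rewrite ger0_norm.
Qed.

Lemma line_at0 (F : 'rV[R]_2 -> R) (u v : 'rV[R]_2) : differentiable F u ->
  is_derive (0 : R) 1 (fun s => F (u + s *: v)) ('D_v F u).
Proof.
move=> dF; have := @is_derive_line R _ F u v 0; rewrite scale0r addr0; apply.
exact: diff_derivable.
Qed.

Lemma line_coord (u v : 'rV[R]_2) i (b : R) :
  is_derive (0 : R) 1 (fun s => (u + s *: v) 0 i + b) (v 0 i).
Proof. by have := derAdd (is_derive_coord_line u v i) (derCst 0 b); rewrite addr0. Qed.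

Lemma continuous_coord (u : 'rV[R]_2) i (b : R) : {for u, continuous (fun w : 'rV[R]_2 => w 0 i + b)}.
Proof. by apply: contAdd; [exact: coord_continuous|exact: contCst]. Qed.

Let ang0 (u : 'rV[R]_2) : R := (u 0 0 + b1) * D0 (D1 f) u + (D1 f u - c2) - (u 0 1 + b2) * D0 (D0 f) u.
Let ang1 (u : 'rV[R]_2) : R := (u 0 0 + b1) * D1 (D1 f) u - (D0 f u - c1) - (u 0 1 + b2) * D1 (D0 f) u.

Lemma angular_interior (u v : 'rV[R]_2) : E° u ->
  v 0 0 * ang0 u + v 0 1 * ang1 u = 0.
Proof.
move=> Eu; have Uu : U u by apply: EU; exact: interior_subset.
have oE : open E° by exact: open_interior.
have dx := line_coord u v 0 b1; have dy := line_coord u v 1 b2.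
have d0 := derSub (line_at0 v (diff1 0 Uu)) (derCst 0 c1).
have d1 := derSub (line_at0 v (diff1 1 Uu)) (derCst 0 c2).
have DD := derSub (derMul dx d1) (derMul dy d0).
rewrite scale0r addr0 in DD.
rewrite (derive_coord2 v (diff1 0 Uu)) (derive_coord2 v (diff1 1 Uu)) in DD.
have H := derive_line_eq0 (F := fun w => (w 0 0 + b1) * (D1 f w - c2) - (w 0 1 + b2) * (D0 f w - c1))
  oE Eu (fun w Ew => rad (interior_subset Ew)) DD.
have alg (v0 v1 X Y e0 e1 P Q Q' S : R) :
    v0 * e1 + X * (v0 * Q' + v1 * S - 0) - (v1 * e0 + Y * (v0 * P + v1 * Q - 0)) =
    v0 * (X * Q' + e1 - Y * P) + v1 * (X * S - e0 - Y * Q) by ring.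
exact: (etrans (esym (alg _ _ _ _ _ _ _ _ _ _)) H).
Qed.

Lemma ang0_interior (u : 'rV[R]_2) : E° u -> ang0 u = 0.
Proof. by move=> /(angular_interior (delta_mx 0 0)); rewrite !mxE/= mul1r mul0r addr0. Qed.

Lemma ang1_interior (u : 'rV[R]_2) : E° u -> ang1 u = 0.
Proof. by move=> /(angular_interior (delta_mx 0 1)); rewrite !mxE/= mul1r mul0r add0r. Qed.

(** The derivative of rad, extended from the interior of E to all of E by
    continuity. It says that the Hessian maps the rotation field to the gradient
    turned by a right angle. *)
Lemma angular_hessian (u : 'rV[R]_2) : E u ->
  (u 0 0 + b1) * D0 (D1 f) u + (D1 f u - c2) - (u 0 1 + b2) * D0 (D0 f) u = 0 /\
  (u 0 0 + b1) * D1 (D1 f) u - (D0 f u - c1) - (u 0 1 + b2) * D1 (D0 f) u = 0.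
Proof.
move=> Eu; have Uu := EU Eu.
have c2' i j : {for u, continuous ('D_(delta_mx 0 i) ('D_(delta_mx 0 j) f))}.
  exact/differentiable_continuous/diff2.
have c1' i : {for u, continuous ('D_(delta_mx 0 i) f)}.
  exact/differentiable_continuous/diff1.
have cx (i : 'I_2) (b : R) := @continuous_coord u i b.
have c0 : {for u, continuous (fun _ : 'rV[R]_2 => 0 : R)} by exact: contCst.
have k1 : {for u, continuous (fun _ : 'rV[R]_2 => c1)} by exact: contCst.
have k2 : {for u, continuous (fun _ : 'rV[R]_2 => c2)} by exact: contCst.
split.
- apply: (eq_on_closure oU Uu (EE Eu) _ c0 (fun y _ Ey => ang0_interior Ey)).
  exact: (contSub (contAdd (contMul (cx 0 b1) (c2' 0 1)) (contSub (c1' 1) k2)) (contMul (cx 1 b2) (c2' 0 0))).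
- apply: (eq_on_closure oU Uu (EE Eu) _ c0 (fun y _ Ey => ang1_interior Ey)).
  exact: (contSub (contSub (contMul (cx 0 b1) (c2' 1 1)) (contSub (c1' 0) k1)) (contMul (cx 1 b2) (c2' 1 0))).
Qed.

(** The rotation field annihilates f up to a linear function by rad, and
    commutes with the Laplacian. *)
Lemma angular_trace (u : 'rV[R]_2) : E u ->
  (u 0 0 + b1) * D1 (htrace f) u - (u 0 1 + b2) * D0 (htrace f) u = 0.
Proof.
have trE (w v : 'rV[R]_2) : U w ->
    'D_v (htrace f) w = 'D_v (D0 (D0 f)) w + 'D_v (D1 (D1 f)) w.
  move=> Uw; apply: deriveD.
  - exact: (diff_derivable (diff2 0 0 Uw)).
  - exact: (diff_derivable (diff2 1 1 Uw)).
move=> Eu; have Uu := EU Eu.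
rewrite (trE u _ Uu) (trE u _ Uu).
have c3 (i j l : 'I_2) := @cont3 i j l u Uu.
have cx (i : 'I_2) (b : R) := @continuous_coord u i b.
have c0 : {for u, continuous (fun _ : 'rV[R]_2 => 0 : R)} by exact: contCst.
pose F (w : 'rV[R]_2) : R := (w 0 0 + b1) * (D1 (D0 (D0 f)) w + D1 (D1 (D1 f)) w) -
   (w 0 1 + b2) * (D0 (D0 (D0 f)) w + D0 (D1 (D1 f)) w).
have cF : {for u, continuous F}.
  exact: (contSub (contMul (cx 0 b1) (contAdd (c3 0 0 1) (c3 1 1 1))) (contMul (cx 1 b2) (contAdd (c3 0 0 0) (c3 1 1 0)))).
suff F0 (w : 'rV[R]_2) : U w -> E° w -> F w = 0 by exact: (eq_on_closure oU Uu (EE Eu) cF c0 F0).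
move=> Uw Ew.
have oE : open E° by exact: open_interior.
pose e0 : 'rV[R]_2 := delta_mx 0 0; pose e1 : 'rV[R]_2 := delta_mx 0 1.
have H0 : (w 0 0 + b1) * D0 (D0 (D1 f)) w + 2 * D0 (D1 f) w - (w 0 1 + b2) * D0 (D0 (D0 f)) w = 0.
  have dx := line_coord w e0 0 b1; have dy := line_coord w e0 1 b2.
  have DD := derSub (derAdd (derMul dx (line_at0 e0 (diff2 0 1 Uw)))
     (derSub (line_at0 e0 (diff1 1 Uw)) (derCst 0 c2))) (derMul dy (line_at0 e0 (diff2 0 0 Uw))).
  rewrite scale0r addr0 in DD.
  have H := derive_line_eq0 (F := ang0) oE Ew ang0_interior DD.
  have alg (X Y e P T3 v0 v1 S3 : R) : v0 = 1 -> v1 = 0 ->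
      v0 * e + X * T3 + (e - 0) - (v1 * P + Y * S3) = X * T3 + 2 * e - Y * S3.
    by move=> -> ->; ring.
  have w0 : e0 0 0 = 1 by rewrite mxE.
  have w1 : e0 0 1 = 0 by rewrite mxE.
  exact: (etrans (esym (alg _ _ _ _ _ _ _ _ w0 w1)) H).
have H1 : (w 0 0 + b1) * D1 (D1 (D1 f)) w - 2 * D1 (D0 f) w - (w 0 1 + b2) * D1 (D1 (D0 f)) w = 0.
  have dx := line_coord w e1 0 b1; have dy := line_coord w e1 1 b2.
  have DD := derSub (derSub (derMul dx (line_at0 e1 (diff2 1 1 Uw)))
     (derSub (line_at0 e1 (diff1 0 Uw)) (derCst 0 c1))) (derMul dy (line_at0 e1 (diff2 1 0 Uw))).
  rewrite scale0r addr0 in DD.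
  have H := derive_line_eq0 (F := ang1) oE Ew ang1_interior DD.
  have alg (X Y e P T3 v0 v1 S3 : R) : v0 = 0 -> v1 = 1 ->
      v0 * P + X * T3 - (e - 0) - (v1 * e + Y * S3) = X * T3 - 2 * e - Y * S3.
    by move=> -> ->; ring.
  have w0 : e1 0 0 = 0 by rewrite mxE.
  have w1 : e1 0 1 = 1 by rewrite mxE.
  exact: (etrans (esym (alg _ _ _ _ _ _ _ _ w0 w1)) H).
have S1 : D1 (D1 (D0 f)) w = D0 (D1 (D1 f)) w
  by exact: (esym (etrans (Schwarz1 1 Uw) (mixed3 1 Uw))).
have S0 : D0 (D0 (D1 f)) w = D1 (D0 (D0 f)) w
  by exact: (etrans (mixed3 0 Uw) (Schwarz1 0 Uw)).
have alg (X Y T0 T0' T1 T1' Q Q' z0 z3 : R) : T0 = T0' -> Q = Q' -> T1 = T1' ->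
    X * T0 + 2 * Q - Y * z0 = 0 -> X * z3 - 2 * Q' - Y * T1 = 0 ->
    X * (T0' + z3) - Y * (z0 + T1') = 0.
  move=> <- <- <- h0 h1.
  rewrite -[RHS](addr0 0) -{1}h0 -h1.
  by ring.
exact: alg S0 (mixed2 Uw) S1 H0 H1.
Qed.

End RadialGradient.

(** * Turns about an isotropic axis *)

Section Turn.
Context {R : realType}.
Implicit Types (p q : 'rV[R]_3) (th : R).

(** The rotation about the vertical axis over - (b1, b2), followed by the
    vertical shift which keeps z - c1 x - c2 y. It preserves the spheres with B
    / 2 = b1 A + c1 and C / 2 = b2 A + c2. *)
Definition axial_turn (b1 c1 b2 c2 th : R) (p : 'rV[R]_3) : 'rV[R]_3 :=
  let x := p 0 0 + b1 in let y := p 0 1 + b2 in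
  let x' := cos th * x - sin th * y in let y' := sin th * x + cos th * y in
  pt3 (x' - b1) (y' - b2) (p 0 2 + c1 * (x' - x) + c2 * (y' - y)).

Variables (b1 c1 b2 c2 : R).
Local Notation turn := (axial_turn b1 c1 b2 c2).

Lemma turn0 p : turn 0 p = p.
Proof. by apply: rV3P; rewrite !ptE ?cos0 ?sin0; ring. Qed.

Lemma turnD th th' p : turn th (turn th' p) = turn (th + th') p.
Proof. by apply: rV3P; rewrite !ptE cosD sinD; ring. Qed.

Lemma turn_axis th p : p 0 0 + b1 = 0 -> p 0 1 + b2 = 0 -> turn th p = p.
Proof.
move=> x0 y0; apply: rV3P; rewrite !ptE x0 y0 !mulr0 ?addr0 ?subr0 ?sub0r.
- by rewrite -(addrK b1 (p 0 0)) x0 sub0r.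
- by rewrite -(addrK b2 (p 0 1)) y0 sub0r.
- by rewrite ?(subr0, subrr, mulr0, addr0).
Qed.

Lemma is_derive_turn (th : R) p :
  is_derive th 1 (fun s => turn s p)
    (let x' := turn th p 0 0 + b1 in let y' := turn th p 0 1 + b2 in
     pt3 (- y') x' (c2 * x' - c1 * y')).
Proof.
have dc : is_derive th 1 cos (- sin th) := is_derive_cos th.
have ds : is_derive th 1 sin (cos th) := is_derive_sin th.
have st (F G : R -> R) l l' : (forall s, F s = G s) -> is_derive th 1 F l -> l = l' -> is_derive th 1 G l'.
  by move=> /funext -> + <-.
set x := p 0 0 + b1; set y := p 0 1 + b2.
have dX : is_derive th 1 (fun s : R => cos s * x - sin s * y) (- (sin th * x + cos th * y)).
  have H := derSub (derMul dc (derCst th x)) (derMul ds (derCst th y)).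
  by apply: (st _ _ _ _ (fun=> erefl) H); ring.
have dY : is_derive th 1 (fun s : R => sin s * x + cos s * y) (cos th * x - sin th * y).
  have H := derAdd (derMul ds (derCst th x)) (derMul dc (derCst th y)).
  by apply: (st _ _ _ _ (fun=> erefl) H); ring.
apply/is_derive_rV => i.
elim/forall_I3: i.
- apply: (st _ _ _ _ _ (derSub dX (derCst th b1))) => [s|]; rewrite !ptE//.
  by rewrite /x /y; ring.
- apply: (st _ _ _ _ _ (derSub dY (derCst th b2))) => [s|]; rewrite !ptE//.
  by rewrite /x /y; ring.
- apply: (st _ _ _ _ _ (derAdd (derAdd (derCst th (p 0 2)) (derScale c1 (derSub dX (derCst th x))))
     (derScale c2 (derSub dY (derCst th y))))) => [s|]; rewrite !ptE//.
  by rewrite /x /y; ring.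
Qed.

Lemma continuous_turn p : continuous (fun s => turn s p).
Proof.
move=> th; apply: differentiable_continuous; apply/derivable1_diffP.
by have [] := is_derive_turn th p.
Qed.

Lemma turn_norm th p :
  (turn th p 0 0 + b1) ^+ 2 + (turn th p 0 1 + b2) ^+ 2 = (p 0 0 + b1) ^+ 2 + (p 0 1 + b2) ^+ 2.
Proof.
rewrite !ptE !subrK; have := cos2Dsin2 th; set k := cos th; set s := sin th => H.
set x := p 0 0 + b1; set y := p 0 1 + b2.
have -> : (k * x - s * y) ^+ 2 + (s * x + k * y) ^+ 2 = (k ^+ 2 + s ^+ 2) * (x ^+ 2 + y ^+ 2) by ring.
by rewrite H mul1r.
Qed.

(** Rotation invariance propagates from small angles to all angles, the line
    of angles being connected. *)
Lemma turn_all (Q : set 'rV[R]_3) p : Q p ->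
  (forall q, Q q -> exists2 d : R, 0 < d & forall th, `|th| < d -> Q (turn th q)) ->
  closed [set th | Q (turn th p)] -> forall th, Q (turn th p).
Proof.
move=> Qp op cl th.
pose T := [set th : R | Q (turn th p)].
have cT : connected [set: R].
  by apply/connected_intervalP => x y _ _ z _.
suff TE : T = setT by have : T th by rewrite TE.
apply: cT.
- by exists 0; rewrite /T/= turn0.
- exists T; last by rewrite setTI.
  rewrite openE => s /= Ts; have [d d0 Hd] := op _ Ts.
  apply/nbhs_ballP; exists d => //= z; rewrite /ball/= => sz.
  by rewrite /T/= -(subrK s z) -turnD; apply: Hd; rewrite distrC.
- by exists T; [exact: cl|rewrite setTI].
Qed.

Lemma angle_exists (x y : R) : x ^+ 2 + y ^+ 2 = 1 -> exists th, cos th = x /\ sin th = y.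
Proof.
move=> H; have x1 : -1 <= x <= 1 by nra.
have [y0|y0] := leP 0 y.
- exists (acos x); split; first exact: acosK.
  by rewrite sin_acos// -H addrC addKr sqrtr_sqr ger0_norm.
- exists (- acos x); split; first by rewrite cosN acosK.
  by rewrite sinN sin_acos// -H addrC addKr sqrtr_sqr ltr0_norm// opprK.
Qed.

(** The angle is that of the complex quotient of the two planar positions. *)
Lemma turn_between p q : (p 0 0 + b1) ^+ 2 + (p 0 1 + b2) ^+ 2 != 0 ->
  (q 0 0 + b1) ^+ 2 + (q 0 1 + b2) ^+ 2 = (p 0 0 + b1) ^+ 2 + (p 0 1 + b2) ^+ 2 ->
  exists th, turn th p 0 0 = q 0 0 /\ turn th p 0 1 = q 0 1.
Proof.
set x := p 0 0 + b1; set y := p 0 1 + b2; set x' := q 0 0 + b1; set y' := q 0 1 + b2.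
set r := x ^+ 2 + y ^+ 2 => r0 e.
have [] := @angle_exists ((x * x' + y * y') / r) ((x * y' - y * x') / r).
  have alg (i : R) : ((x * x' + y * y') * i) ^+ 2 + ((x * y' - y * x') * i) ^+ 2 =
    (x ^+ 2 + y ^+ 2) * (x' ^+ 2 + y' ^+ 2) * i ^+ 2 by ring.
  by rewrite alg e -/r -expr2 exprVn divff// sqrf_eq0.
move=> th [ct st]; exists th; rewrite !ptE -/x -/y ct st; split.
- apply: (addIr b1); rewrite subrK -/x'.
  have alg (i : R) : (x * x' + y * y') * i * x - (x * y' - y * x') * i * y =
    (x ^+ 2 + y ^+ 2) * i * x' by ring.
  by rewrite alg -/r divff// mul1r.
- apply: (addIr b2); rewrite subrK -/y'.
  have alg (i : R) : (x * y' - y * x') * i * x + (x * x' + y * y') * i * y =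
    (x ^+ 2 + y ^+ 2) * i * y' by ring.
  by rewrite alg -/r divff// mul1r.
Qed.

End Turn.

(** * Characteristics and rotations *)

(** The first two equations say that (v0, v1) is an eigenvector of the Hessian
    with eigenvalue a, the other two that (- y, x) is one. If a is a simple
    eigenvalue they are parallel. *)
Lemma eigen_directions (R : realFieldType) (P Q S a x y v0 v1 : R) :
  v0 * P + v1 * Q = a * v0 -> v0 * Q + v1 * S = a * v1 ->
  x * Q + a * y - y * P = 0 -> x * S - a * x - y * Q = 0 ->
  (P + S - 2 * a) * (v0 * x + v1 * y) = 0.
Proof.
move=> h1 h2 h3 h4.
have := congr1 (fun z => z * x) h1.
have := congr1 (fun z => z * y) h2.
have := congr1 (fun z => z * v0) h4.
have := congr1 (fun z => z * v1) h3.
by lra.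
Qed.

Lemma constant_of_derive0 (R : realType) (F : R -> R) (e : R) :
  (forall s : R, `|s| < e -> is_derive s 1 F 0) -> forall s, `|s| < e -> F s = F 0.
Proof.
move=> dF s se; have [->//|s0] := eqVneq s 0.
have [sp|sn] := ltP 0 s.
- have Hab z : 0 <= z <= s -> `|z| < e.
    by move=> /andP[z0 zs]; rewrite ger0_norm// (le_lt_trans zs)// (le_lt_trans (ler_norm s)).
  have [z zab] := mean_value sp (fun z Hz => dF z (Hab z Hz)).
  by rewrite mul0r => /eqP; rewrite subr_eq0 => /eqP.
- have sn' : s < 0 by rewrite lt_neqAle s0.
  have Hab z : s <= z <= 0 -> `|z| < e.
    by move=> /andP[zs z0]; rewrite ler0_norm//; rewrite ltr0_norm// in se; lra.
  have [z zab] := mean_value sn' (fun z Hz => dF z (Hab z Hz)).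
  by rewrite mul0r => /eqP; rewrite subr_eq0 => /eqP.
Qed.

Section RotationStep.
Context {R : realType}.
Variables (M : set 'rV[R]_3) (I : set R) (A B C D : R -> R) (c : R -> set 'rV[R]_3).
Hypothesis cc : forall t, I t -> curve_without_endpoints (c t).
Hypothesis ct : forall t, I t -> forall p, c t p ->
  tangent_at M (parabolic_sphere (A t) (B t) (C t) (D t)) p.
Hypothesis cM : M = \bigcup_(t in I) c t.
Variables (b1 c1 b2 c2 : R).
Hypothesis rel : forall t, I t -> B t / 2 = b1 * A t + c1 /\ C t / 2 = b2 * A t + c2.
Local Notation turn := (axial_turn b1 c1 b2 c2).

Lemma radial_gradient t W U E f u : graph_on M W U E f -> E u -> I t ->
  c t (lift3 f u) -> D0 f u - c1 = A t * (u 0 0 + b1) /\ D1 f u - c2 = A t * (u 0 1 + b2).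
Proof.
move=> G Eu It cu; have [e0 e1 _] := contact_curve ct G Eu It cu.
have [rB rC] := rel It; rewrite e0 e1 rB rC; split; ring.
Qed.

Lemma radial W U E f u : graph_on M W U E f -> E u ->
  (u 0 0 + b1) * (D1 f u - c2) - (u 0 1 + b2) * (D0 f u - c1) = 0.
Proof.
move=> G Eu; have [Mu _] := graph_lift G Eu.
have [t It cu] := covered cM Mu; have [-> ->] := radial_gradient G Eu It cu; ring.
Qed.

Lemma sphere_height t p : I t -> c t p ->
  2 * p 0 2 = A t * ((p 0 0 + b1) ^+ 2 + (p 0 1 + b2) ^+ 2) + 2 * (c1 * p 0 0 + c2 * p 0 1)
    + (D t - A t * (b1 ^+ 2 + b2 ^+ 2)).
Proof.
move=> It cp; have [_ + _] := ct It cp; rewrite /parabolic_sphere/= => ->.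
have [rB rC] := rel It.
have -> : B t = 2 * (b1 * A t + c1) by rewrite -rB mulrC divfK.
have -> : C t = 2 * (b2 * A t + c2) by rewrite -rC mulrC divfK.
ring.
Qed.

(** On a sphere of the family z - c1 x - c2 y depends only on the distance to
    the axis, so the top view of a turned point determines its height. *)
Lemma turn_unique t p q th : I t -> c t p -> c t q ->
  turn th p 0 0 = q 0 0 -> turn th p 0 1 = q 0 1 -> turn th p = q.
Proof.
move=> It cp cq e0 e1; apply: rV3P => //.
have hp := sphere_height It cp; have hq := sphere_height It cq.
have N := turn_norm b1 c1 b2 c2 th p.
rewrite -e0 -e1 N in hq; rewrite [LHS]ptE.
have := e0; have := e1; rewrite !ptE => _ _.
move: hp hq; rewrite !ptE; lra.
Qed.

(** The Hessian has eigenvalue A t both along the characteristic and along the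
    rotations, so the two directions agree unless the point is umbilic. *)
Lemma curve_dichotomy t W U E f g (v : R -> 'rV[R]_3) (e s : R) :
  graph_on M W U E f -> I t -> (forall s : R, `|s| < e -> c t (g s) /\ is_derive s 1 g (v s)) ->
  `|s| < e -> W (g s) ->
  (htrace f (top (g s)) - 2 * A t) *
  (v s 0 0 * (g s 0 0 + b1) + v s 0 1 * (g s 0 1 + b2)) = 0.
Proof.
move=> G It Hg se Ws; have [cs ds] := Hg _ se.
have e0 : 0 < e - `|s| by rewrite subr_gt0.
have dg : is_derive (0 : R) 1 (fun r => g (s + r)) (v s).
  have d := derAdd (derCst 0 s) (is_derive_id (0 : R) 1).
  apply/is_derive_rV => i; have ds' : is_derive (s + 0) 1 (fun r => g r 0 i) (v s 0 i).
    by rewrite addr0; move/is_derive_rV : ds.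
  by have := derComp ds' d; rewrite add0r mulr1.
have cg r : 0 <= r < e - `|s| -> c t (g (s + r)).
  move=> /andP[r0 re]; apply: (proj1 (Hg _ _)); apply: (le_lt_trans (ler_normD _ _)).
  by rewrite (ger0_norm r0) addrC -ltrBrDr.
have Ms := channel_sub ct It cs.
have [Eu fu] := graph_top G Ms Ws.
have := channel_eigen ct G It e0 dg cg; rewrite addr0 => /(_ Ws)[_ w0 w1].
have [_ [oU Cf] EU EE _] := G.
have [a0 a1] := angular_hessian oU Cf EU EE (fun u Eu => radial G Eu) Eu.
have cu : c t (lift3 f (top (g s))) by rewrite lift3_top.
have [r0 r1] := radial_gradient G Eu It cu.
have mx := mixed2 oU Cf (EU _ Eu).
rewrite r1 in a0; rewrite r0 in a1.
have p0 : top (g s) 0 0 = g s 0 0 by rewrite ptE.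
have p1 : top (g s) 0 1 = g s 0 1 by rewrite ptE.
rewrite p0 p1 in a0 a1; rewrite mx in a0 w1.
rewrite /htrace.
exact: eigen_directions w0 w1 a0 a1.
Qed.

(** The distance to the axis is constant along the curve. Unless it is zero, the
    polar angle has a nonzero derivative at 0, hence takes all small values. *)
Lemma circular_arc t g (v : R -> 'rV[R]_3) (e : R) : I t -> 0 < e ->
  (forall s : R, `|s| < e -> c t (g s) /\ is_derive s 1 g (v s)) ->
  {for (0 : R), continuous v} -> (v 0 0 0 != 0 \/ v 0 0 1 != 0) ->
  (forall s : R, `|s| < e -> v s 0 0 * (g s 0 0 + b1) + v s 0 1 * (g s 0 1 + b2) = 0) ->
  exists2 d : R, 0 < d & forall th, `|th| < d -> c t (turn th (g 0)).
Proof.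
move=> It e0 Hg cv v0 orth.
set p := g 0; set x := p 0 0 + b1; set y := p 0 1 + b2.
have e00 : `|0 : R| < e by rewrite normr0.
have [cp dp] := Hg _ e00.
have [xy0|xy0] := eqVneq (x ^+ 2 + y ^+ 2) 0.
  exists 1 => // th _; rewrite turn_axis// -/x -/y; apply/eqP.
  - by move/eqP : xy0; rewrite paddr_eq0 ?sqr_ge0// !sqrf_eq0 => /andP[].
  - by move/eqP : xy0; rewrite paddr_eq0 ?sqr_ge0// !sqrf_eq0 => /andP[].
have dg i (s b : R) : `|s| < e -> is_derive s 1 (fun s => g s 0 i + b) (v s 0 i).
  move=> /Hg[_ /is_derive_rV /(_ i) ds].
  by have := derAdd ds (derCst s b); rewrite addr0.
pose N (s : R) := (g s 0 0 + b1) * (g s 0 0 + b1) + (g s 0 1 + b2) * (g s 0 1 + b2).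
have dN (s : R) : `|s| < e -> is_derive s 1 N 0.
  move=> se; have H := derAdd (derMul (dg 0 s b1 se) (dg 0 s b1 se)) (derMul (dg 1 s b2 se) (dg 1 s b2 se)).
  have := orth _ se; set a := v s 0 0; set b := v s 0 1 => o0.
  rewrite (_ : 0 = a * (g s 0 0 + b1) + (g s 0 0 + b1) * a +
    (b * (g s 0 1 + b2) + (g s 0 1 + b2) * b)); first exact: H.
  by rewrite -[LHS](addr0 0) -{1}o0 -o0; ring.
have Nc := constant_of_derive0 dN.
pose h (s : R) := (g s 0 1 + b2) * x - (g s 0 0 + b1) * y.
pose k (s : R) := (g s 0 0 + b1) * x + (g s 0 1 + b2) * y.
have dh (s : R) : `|s| < e -> is_derive s 1 h (v s 0 1 * x - v s 0 0 * y).
  move=> se; have := derSub (derMul (dg 1 s b2 se) (derCst s x)) (derMul (dg 0 s b1 se) (derCst s y)).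
  by rewrite !mulr0 !addr0.
have dk (s : R) : `|s| < e -> is_derive s 1 k (v s 0 0 * x + v s 0 1 * y).
  move=> se; have := derAdd (derMul (dg 0 s b1 se) (derCst s x)) (derMul (dg 1 s b2 se) (derCst s y)).
  by rewrite !mulr0 !addr0.
(* h and k are r^2 times the sine and the cosine of the polar angle from p *)
have h'0 : v 0 0 1 * x - v 0 0 0 * y != 0.
  apply/eqP => E1; have E2 := orth _ e00; rewrite -/p -/x -/y in E2.
  have a0 : v 0 0 0 * (x ^+ 2 + y ^+ 2) = 0.
    have -> : v 0 0 0 * (x ^+ 2 + y ^+ 2) = (v 0 0 0 * x + v 0 0 1 * y) * x - (v 0 0 1 * x - v 0 0 0 * y) * y by ring.
    by rewrite E1 E2 !mul0r subrr.
  have a1 : v 0 0 1 * (x ^+ 2 + y ^+ 2) = 0.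
    have -> : v 0 0 1 * (x ^+ 2 + y ^+ 2) = (v 0 0 0 * x + v 0 0 1 * y) * y + (v 0 0 1 * x - v 0 0 0 * y) * x by ring.
    by rewrite E1 E2 !mul0r addr0.
  move/eqP : a0; move/eqP : a1; rewrite !mulf_eq0 (negbTE xy0) !orbF => /eqP a1 /eqP a0.
  by case: v0; rewrite ?a0 ?a1 eqxx.
have cv' i : {for (0 : R), continuous (fun s => v s 0 i)}.
  by apply: (@continuous_comp _ _ _ v (fun q : 'rV[R]_3 => q 0 i)); [exact: cv|exact: coord_continuous].
have ch' : {for (0 : R), continuous (fun s => v s 0 1 * x - v s 0 0 * y)}.
  by apply: contSub; apply: contMul; [exact: cv'|exact: contCst|exact: cv'|exact: contCst].
have ck : {for (0 : R), continuous k} by apply: derivable_cont; exact: dk.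
have k00 : 0 < k 0 by rewrite /k -/p -/x -/y -!expr2 lt_def xy0 addr_ge0 ?sqr_ge0.
have [e1 e10 He1] : exists2 e1 : R, 0 < e1 & forall s, `|s| < e1 -> v s 0 1 * x - v s 0 0 * y != 0 /\ 0 < k s.
  have nh := near_neq0 ch' h'0.
  have nk := near_continuous ck k00.
  have : \forall s \near (0 : R), v s 0 1 * x - v s 0 0 * y != 0 /\ 0 < k s.
    near=> s; split; first by near: s; exact: nh.
    have H : `|k 0 - k s| < k 0 by near: s; exact: nk.
    by move: H; rewrite ltr_norml => /andP[]; lra.
  move=> /nbhs_ballP[e1 /= e10 He1]; exists e1 => // s se; apply: He1.
  by rewrite /ball/= sub0r normrN.
pose a := Num.min e e1 / 2.
have a0 : 0 < a by rewrite divr_gt0// lt_min e0 e10.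
have ae : a < e /\ a < e1.
  have m0 : 0 < Num.min e e1 by rewrite lt_min e0 e10.
  have m1 : Num.min e e1 <= e by rewrite ge_min lexx.
  have m2 : Num.min e e1 <= e1 by rewrite ge_min lexx orbT.
  by rewrite /a; split; lra.
have Ha s : - a <= s <= a -> `|s| < e /\ `|s| < e1.
  by rewrite -ler_norml => /le_lt_trans H; split; apply: H; case: ae.
have aa : - a < a by lra.
have [|inv [l [r [lr Hinv _]]]] := @monotone_inverse R h (fun s => v s 0 1 * x - v s 0 0 * y) _ _ aa.
  by move=> s /Ha[se s1]; split; [exact: dh|have [] := He1 _ s1].
have [h0 _] : l < h 0 < r /\ inv (h 0) = 0 by apply: lr; rewrite a0 oppr_lt0 a0.
have hz : h 0 = 0 by rewrite /h -/p -/x -/y mulrC subrr.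
rewrite hz in h0.
pose rr := x ^+ 2 + y ^+ 2.
have rr0 : 0 < rr by rewrite lt_def xy0 addr_ge0 ?sqr_ge0.
have : \forall th \near (0 : R), l < sin th * rr < r /\ 0 < cos th.
  have cs : {for (0 : R), continuous (fun th : R => sin th * rr)}.
    by apply: contMul; [exact: continuous_sin|exact: contCst].
  have n1 := near_continuous cs (_ : 0 < Num.min (- l) r).
  have m0 : 0 < Num.min (- l) r by rewrite lt_min oppr_gt0; case/andP: h0 => -> ->.
  have n2 := near_continuous (@continuous_cos R 0) (ltr01 : 0 < (1:R)).
  near=> th; split.
  - have H : `|sin 0 * rr - sin th * rr| < Num.min (- l) r by near: th; exact: (n1 m0).
    rewrite sin0 mul0r sub0r normrN lt_min !ltr_norml opprK in H.
    by case/andP : H => /andP[-> _] /andP[_ ->].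
  - have H : `|cos 0 - cos th| < 1 by near: th; exact: n2.
    by rewrite cos0 ltr_norml in H; case/andP : H; lra.
move=> /nbhs_ballP[d /= d0 Hd]; exists d => // th thd.
have [] : l < sin th * rr < r /\ 0 < cos th by apply: Hd; rewrite /ball/= sub0r normrN.
move=> /Hinv[sab hs _] cth; set s := inv _ in sab hs.
have [se s1] : `|s| < e /\ `|s| < e1.
  by apply: Ha; case/andP : sab => /ltW -> /ltW ->.
have [_ ks0] := He1 _ s1.
have [cs _] := Hg _ se.
have ns : N s = rr by rewrite Nc// /N -/p -/x -/y /rr !expr2.
have kE : k s = cos th * rr.
  have hk : h s ^+ 2 + k s ^+ 2 = rr ^+ 2.
    have -> : h s ^+ 2 + k s ^+ 2 = N s * rr by rewrite /h /k /N /rr; ring.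
    by rewrite ns expr2.
  have : k s ^+ 2 = (cos th * rr) ^+ 2.
    by rewrite [RHS]exprMn cos2sin2 -[LHS](addKr (h s ^+ 2)) hk hs; ring.
  by move=> /eqP; rewrite eqrXn2 ?ltW// => [/eqP//|]; rewrite mulr_gt0.
have rrn : rr != 0 by rewrite gt_eqF.
rewrite (turn_unique It cp cs) //.
- rewrite ptE -/x -/y; apply: (addIr b1); rewrite subrK; apply: (mulIf rrn).
  have -> : (cos th * x - sin th * y) * rr = (cos th * rr) * x - (sin th * rr) * y by ring.
  by rewrite -kE -hs /h /k /rr; ring.
- rewrite ptE -/x -/y; apply: (addIr b2); rewrite subrK; apply: (mulIf rrn).
  have -> : (sin th * x + cos th * y) * rr = (sin th * rr) * x + (cos th * rr) * y by ring.
  by rewrite -kE -hs /h /k /rr; ring.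
Unshelve. all: by end_near.
Qed.

End RotationStep.

(** * Umbilic regions *)

Lemma near_radius (R : realType) (t : R) (P : R -> Prop) : (\forall s \near t, P s) ->
  exists2 e : R, 0 < e & forall s, `|s - t| < e -> P s.
Proof.
move=> /nbhs_ballP[e /= e0 He]; exists e => // s se; apply: He.
by rewrite /ball/= distrC.
Qed.

Lemma near0_radius (R : realType) (P : R -> Prop) : (\forall s \near (0 : R), P s) ->
  exists2 e : R, 0 < e & forall s, `|s| < e -> P s.
Proof.
by move=> /near_radius[e e0 He]; exists e => // s se; apply: He; rewrite subr0.
Qed.

Section Umbilics.
Context {R : realType}.

Lemma umbilic_hessian (P Q Q' S a : R) : Q = Q' ->
  a ^+ 2 - (P + S) * a + (P * S - Q * Q') = 0 -> P + S = 2 * a ->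
  [/\ P = S, Q' = 0 & Q = 0].
Proof.
move=> <- h1 h2; have E : (P - a) ^+ 2 + Q ^+ 2 = 0.
  have -> : (P - a) ^+ 2 + Q ^+ 2 =
    (P + S - 2 * a) * (P - a) - (a ^+ 2 - (P + S) * a + (P * S - Q * Q)) by ring.
  by rewrite h1 h2 subrr mul0r subrr.
move/eqP : E; rewrite paddr_eq0 ?sqr_ge0// !sqrf_eq0 subr_eq0 => /andP[/eqP pa /eqP ->].
by split => //; rewrite pa in h2 *; lra.
Qed.

(** By Schwarz's theorem the common second derivative has zero gradient. *)
Lemma umbilic_ball (U : set 'rV[R]_2) (f : 'rV[R]_2 -> R) y (r : R) :
  open U -> Cr 3 U f -> ball y r `<=` U -> 0 < r ->
  (forall w, ball y r w -> [/\ D0 (D0 f) w = D1 (D1 f) w, D1 (D0 f) w = 0 & D0 (D1 f) w = 0]) ->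
  exists k b d : R, forall w, ball y r w -> D0 f w = k * w 0 0 + b /\ D1 f w = k * w 0 1 + d.
Proof.
move=> oU Cf BU r0 H.
have oB : open (ball y r : set 'rV[R]_2) by exact: ball_open.
have zero (F : 'rV[R]_2 -> R) (v w : 'rV[R]_2) : ball y r w ->
    (forall z, ball y r z -> F z = 0) -> 'D_v F w = 0.
  move=> Bw F0; have n : \near w, F w = (cst 0 : 'rV[R]_2 -> R) w by exact: near_open oB Bw F0.
  by rewrite (near_eq_derive _ n) derive_cst.
have P0 w : ball y r w -> D0 (D0 (D0 f)) w = 0.
  move=> Bw; have n : \near w, D0 (D0 f) w = D1 (D1 f) w.
    by apply: (near_open oB Bw) => z Bz; have [+ _ _] := H z Bz.
  apply: (etrans (near_eq_derive _ n)); apply: (etrans (Schwarz1 oU Cf 1 (BU _ Bw))).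
  by apply: zero Bw _ => z Bz; have [_ _ +] := H z Bz.
have P1 w : ball y r w -> D1 (D0 (D0 f)) w = 0.
  move=> Bw; apply: (etrans (esym (Schwarz1 oU Cf 0 (BU _ Bw)))).
  by apply: zero Bw _ => z Bz; have [_ + _] := H z Bz.
have Pc w : ball y r w -> D0 (D0 f) w = D0 (D0 f) y.
  move: w; apply: (@constant_of_gradient R (D0 (D0 f)) y r) => z.
    by move=> Bz; exact: (diff2 Cf 0 0 (BU _ Bz)).
  move=> v Bz; rewrite (derive_coord2 _ (diff2 Cf 0 0 (BU _ Bz))) (P0 z Bz) (P1 z Bz).
  by rewrite !mulr0 addr0.
pose k := D0 (D0 f) y.
have lin i : exists b : R, forall w, ball y r w -> 'D_(delta_mx 0 i) f w = k * w 0 i + b.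
  pose G (w : 'rV[R]_2) : R := 'D_(delta_mx 0 i) f w - k * w 0 i.
  suff dG z (v : 'rV[R]_2) : ball y r z -> differentiable G z /\ 'D_v G z = 0.
    exists (G y) => w Bw; rewrite addrC -[LHS](subrK (k * w 0 i)); congr (_ + _).
    apply: (@constant_of_gradient R G y r) (w) Bw => [z Bz|z v Bz]; first by case: (dG z 0 Bz).
    by case: (dG z v Bz).
  move=> Bz.
  have dl : differentiable (fun w : 'rV[R]_2 => k * w 0 i) z.
    by apply: differentiableM; [exact: differentiable_cst|exact: differentiable_coord].
  have d1 := diff1 Cf i (BU _ Bz).
  have dl' : 'D_v (fun w : 'rV[R]_2 => k * w 0 i) z = k * v 0 i.
    rewrite (deriveZ k (diff_derivable (differentiable_coord _ _ _))).
    by rewrite derive_coordinate.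
  split; first exact: differentiableB.
  apply: (etrans (deriveB (diff_derivable d1) (diff_derivable dl))).
  rewrite dl' (derive_coord2 _ d1).
  have [h1 h2 h3] := H z Bz.
  move: i {G dl d1 dl'}; apply: forall_I2.
  - by rewrite h2 (Pc z Bz) mulr0 addr0 mulrC subrr.
  - by rewrite h3 -h1 (Pc z Bz) mulr0 add0r mulrC subrr.
have [b Hb] := lin 0; have [d Hd] := lin 1.
by exists k, b, d => w Bw; split; [exact: Hb|exact: Hd].
Qed.

End Umbilics.

(** * Characteristics are circles *)

Section Rotation.
Context {R : realType}.
Variables (M : set 'rV[R]_3) (I : set R) (A B C D : R -> R) (c : R -> set 'rV[R]_3).
Hypothesis cc : forall t, I t -> curve_without_endpoints (c t).
Hypothesis ct : forall t, I t -> forall p, c t p ->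
  tangent_at M (parabolic_sphere (A t) (B t) (C t) (D t)) p.
Hypothesis cM : M = \bigcup_(t in I) c t.
Hypothesis iI : is_interval I.
Hypothesis sA : smooth_on I A.
Hypothesis aA : analytic_on I A.
Hypothesis Anc : exists s t, [/\ I s, I t & A s != A t].
Hypothesis gM : forall p, M p -> exists f, local_graph M p f.
Variables (b1 c1 b2 c2 : R).
Hypothesis rel : forall t, I t -> B t / 2 = b1 * A t + c1 /\ C t / 2 = b2 * A t + c2.
Local Notation turn := (axial_turn b1 c1 b2 c2).

Definition trace_at (q : 'rV[R]_3) (tau : R) : Prop :=
  exists2 f, local_graph M q f & htrace f (top q) = tau.

Lemma trace_at_unique q f tau : M q -> local_graph M q f -> trace_at q tau ->
  htrace f (top q) = tau.
Proof.
move=> Mq lf [f' lf' <-].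
have e0 := local_graph_hess (delta_mx 0 0) (delta_mx 0 0) Mq lf lf'.
have e1 := local_graph_hess (delta_mx 0 1) (delta_mx 0 1) Mq lf lf'.
exact: (f_equal2 +%R e0 e1).
Qed.

Lemma differentiable_htrace (U : set 'rV[R]_2) (f : 'rV[R]_2 -> R) u : Cr 3 U f -> U u ->
  differentiable (htrace f) u.
Proof.
move=> Cf Uu; have := differentiableD (diff2 Cf 0 0 Uu) (diff2 Cf 1 1 Uu); exact.
Qed.

Lemma char_param t p : I t -> c t p -> exists (g v : R -> 'rV[R]_3) (e : R),
  [/\ 0 < e, g 0 = p, (v 0 0 0 != 0 \/ v 0 0 1 != 0),
   forall s : R, `|s| < e -> {for s, continuous v} &
   forall s : R, `|s| < e -> c t (g s) /\ is_derive s 1 g (v s)].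
Proof.
move=> It cp; have [g [v [e [e0 g0 v0 cv gv]]]] := curve_param (cc It) cp.
exists g, v, e; split => //.
have e00 : `|0 : R| < e by rewrite normr0.
have [_ d0] := gv _ e00.
have Mp := channel_sub ct It cp.
have [f /local_graphP[W [U [E [Wp G]]]]] := gM Mp.
have Hg s : 0 <= s < e -> c t (g s).
  by move=> /andP[s0 se]; apply: (proj1 (gv _ _)); rewrite ger0_norm.
have := channel_eigen ct G It e0 d0 Hg; rewrite g0 => /(_ Wp)[w2 _ _].
apply/orP; rewrite -negb_and; apply/negP => /andP[/eqP x0 /eqP x1].
move/eqP : v0; apply; apply: rV3P; rewrite ?mxE//.
by rewrite w2 x0 x1 !mul0r addr0.
Qed.

Lemma curve_continuous g (v : R -> 'rV[R]_3) (s : R) : is_derive s 1 g (v s) ->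
  {for s, continuous g}.
Proof.
by move=> [dg _]; apply: differentiable_continuous; apply/derivable1_diffP.
Qed.

Lemma near_turn p (W : set 'rV[R]_3) th : open W -> W (turn th p) ->
  \forall s \near th, W (turn s p).
Proof. by move=> oW Wp; apply: (@continuous_turn R b1 c1 b2 c2 p th); exact: open_nbhs_nbhs. Qed.

Lemma is_derive_trace_turn W U E f p (s : R) : graph_on M W U E f ->
  M (turn s p) -> W (turn s p) ->
  is_derive s 1 (fun th => htrace f (top (turn th p))) 0.
Proof.
move=> G Ms Ws; have [Eu _] := graph_top G Ms Ws.
have [_ [oU Cf] EU EE _] := G.
have Uu := EU _ Eu.
have dT := differentiable_htrace Cf Uu.
have st (F : R -> R) l : is_derive s 1 F l -> l = 0 -> is_derive s 1 F 0 by move=> + <-.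
apply: (st _ _ (is_derive_along (is_derive_top (is_derive_turn b1 c1 b2 c2 s p)) dT)).
have E0 := angular_trace oU Cf EU EE (fun u Eu => radial ct cM rel G Eu) Eu.
rewrite (derive_coord2 _ dT).
move: E0; set X := D0 _ _; set Y := D1 _ _; move: X Y => X Y.
rewrite /top !pt2_0 !pt2_1 pt3_0 pt3_1.
set x := _ + b1; set y := _ + b2; move: x y => x y E0.
by apply: etrans E0; ring.
Qed.

(** Away from umbilics the characteristics are circular arcs, along which the
    trace is constant; so they stay away from umbilics and close up. *)
Lemma nonumbilic_circle t p tau : I t -> c t p -> trace_at p tau -> tau != 2 * A t ->
  forall th, c t (turn th p) /\ trace_at (turn th p) tau.
Proof.
move=> It cp tp tA.
apply: (@turn_all R b1 c1 b2 c2 [set q | c t q /\ trace_at q tau] p).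
- by split.
- move=> q [cq tq]; have Mq := channel_sub ct It cq.
  have [f lf] := gM Mq; have [W [U [E [Wq G]]]] := (local_graphP M q f).1 lf.
  have [oW [oU Cf] EU EE _] := G.
  have [Eu _] := graph_top G Mq Wq.
  have tf := trace_at_unique Mq lf tq.
  have [g [v [e [e0 g0 v0 cv gv]]]] := char_param It cq.
  have e00 : `|0 : R| < e by rewrite normr0.
  have [_ dg0] := gv _ e00.
  have cg := curve_continuous dg0.
  have ctr : {for (0 : R), continuous (fun s => htrace f (top (g s)) - 2 * A t)}.
    refine (contSub _ (@contCst _ _ _ _)).
    apply: (continuous_comp (f := fun s => top (g s)) (g := htrace f)).
      by apply: (continuous_comp cg); exact: continuous_top.
    by apply: differentiable_continuous; apply: (differentiable_htrace Cf); rewrite g0; exact: EU.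
  have tr0 : htrace f (top (g 0)) - 2 * A t != 0 by rewrite g0 tf subr_eq0.
  have n1 := near_neq0 ctr tr0.
  have n2 : \forall s \near (0 : R), W (g s) by apply: cg; rewrite g0; exact: open_nbhs_nbhs.
  have [e1 e10 He1] : exists2 e1 : R, 0 < e1 & forall s, `|s| < e1 ->
      htrace f (top (g s)) - 2 * A t != 0 /\ W (g s).
    have : \forall s \near (0 : R), htrace f (top (g s)) - 2 * A t != 0 /\ W (g s).
      by near=> s; split; near: s; [exact: n1|exact: n2].
    exact: near0_radius.
  pose e2 := Num.min e e1.
  have e20 : 0 < e2 by rewrite lt_min e0 e10.
  have He2 s : `|s| < e2 -> `|s| < e /\ `|s| < e1 by rewrite lt_min => /andP.
  have gv2 s : `|s| < e2 -> c t (g s) /\ is_derive s 1 g (v s).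
    by move=> /He2[se _]; exact: gv.
  have orth s : `|s| < e2 -> v s 0 0 * (g s 0 0 + b1) + v s 0 1 * (g s 0 1 + b2) = 0.
    move=> /He2[se s1]; have [t0 Ws] := He1 _ s1.
    have /eqP := curve_dichotomy ct cM rel G It gv se Ws.
    by rewrite mulf_eq0 (negbTE t0) => /eqP.
  have [d d0 Hd] := circular_arc ct rel It e20 gv2 (cv _ e00) v0 orth.
  rewrite g0 in Hd.
  have : \forall th \near (0 : R), W (turn th q) by apply: near_turn => //; rewrite turn0.
  move=> /near0_radius[e3 e30 He3].
  exists (Num.min d e3); first by rewrite lt_min d0 e30.
  have Hs s : `|s| < Num.min d e3 -> c t (turn s q) /\ W (turn s q).
    rewrite lt_min => /andP[sd s3]; split; first exact: Hd.
    exact: He3.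
  move=> th thd; have [cth Wth] := Hs _ thd; split; first exact: cth.
  have Mth := channel_sub ct It cth.
  exists f; first exact: (graph_local G Mth Wth).
  have := constant_of_derive0 (F := fun th => htrace f (top (turn th q))) _ thd.
  rewrite turn0 tf; apply => s sd; have [cs Ws] := Hs _ sd.
  exact: is_derive_trace_turn G (channel_sub ct It cs) Ws.
- move=> th cth.
  have [_ _ clc _] := cc It.
  have cturn := @continuous_turn R b1 c1 b2 c2 p.
  have cth' : c t (turn th p).
    have : closed [set s | c t (turn s p)] by exact: (closed_comp (fun s _ => cturn s) clc).
    apply; apply: closure_subset cth => s [cs _]; exact: cs.
  split; first exact: cth'.
  have Mth := channel_sub ct It cth'.
  have [f lf] := gM Mth; have [W [U [E [Wq G]]]] := (local_graphP M _ f).1 lf.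
  have [oW [oU Cf] EU EE _] := G.
  have [Eu _] := graph_top G Mth Wq.
  exists f; first exact: lf.
  have oV : open [set s | W (turn s p)] by exact: (open_comp (fun s _ => cturn s) oW).
  apply: (eq_on_closure (f := fun s => htrace f (top (turn s p))) (g := fun _ => tau) oV Wq cth).
  + apply: (continuous_comp (f := fun s => top (turn s p)) (g := htrace f)).
      by apply: (continuous_comp (cturn th)); exact: continuous_top.
    by apply: differentiable_continuous; apply: (differentiable_htrace Cf); exact: EU.
  + exact: contCst.
  + move=> s Ws [cs ts]; have Ms := channel_sub ct It cs.
    exact: trace_at_unique Ms (graph_local G Ms Ws) ts.
Unshelve. all: by end_near.
Qed.

(** Otherwise the distance to the axis runs through an interval along the curve.
    A point over a small ball which is not umbilic lies on a full circle in its
    characteristic, by nonumbilic_circle, and this circle meets the curve; but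
    there the point is umbilic by curve_dichotomy, and the trace is constant on
    the circle. So all points over the ball are umbilic, against
    no_umbilic_ball. *)
Lemma orthogonal_characteristic t g (v : R -> 'rV[R]_3) (e s0 : R) : I t ->
  (forall s : R, `|s| < e -> {for s, continuous v}) ->
  (forall s : R, `|s| < e -> c t (g s) /\ is_derive s 1 g (v s)) -> `|s0| < e ->
  v s0 0 0 * (g s0 0 0 + b1) + v s0 0 1 * (g s0 0 1 + b2) = 0.
Proof.
move=> It cv gv se0; apply/eqP; apply/negPn/negP => nz.
have [cp dg0] := gv _ se0.
set p := g s0 in cp; have Mp := channel_sub ct It cp.
have [f lf] := gM Mp; have [W [U [E [Wp G]]]] := (local_graphP M p f).1 lf.
have [oW [oU Cf] EU EE _] := G.
have [Eu fu] := graph_top G Mp Wp.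
have cg := curve_continuous dg0.
have cgi i (b : R) : {for s0, continuous (fun s => g s 0 i + b)}.
  refine (contAdd _ (@contCst _ _ _ _)).
  by apply: (@continuous_comp _ _ _ g (fun q : 'rV[R]_3 => q 0 i)); [exact: cg|exact: coord_continuous].
have cvi i : {for s0, continuous (fun s => v s 0 i)}.
  by apply: (@continuous_comp _ _ _ v (fun q : 'rV[R]_3 => q 0 i)); [exact: cv|exact: coord_continuous].
pose h' (s : R) := v s 0 0 * (g s 0 0 + b1) + v s 0 1 * (g s 0 1 + b2).
pose h (s : R) := (g s 0 0 + b1) ^+ 2 + (g s 0 1 + b2) ^+ 2.
have ch' : {for s0, continuous h'} by apply: contAdd; apply: contMul.
have dh (s : R) : `|s| < e -> is_derive s 1 h (2 * h' s).
  move=> /gv[_ /is_derive_rV ds].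
  have d i (b : R) : is_derive s 1 (fun s => g s 0 i + b) (v s 0 i).
    by have := derAdd (ds i) (derCst s b); rewrite addr0.
  have H := derAdd (derMul (d 0 b1) (d 0 b1)) (derMul (d 1 b2) (d 1 b2)).
  rewrite (_ : 2 * h' s = v s 0 0 * (g s 0 0 + b1) + (g s 0 0 + b1) * v s 0 0 +
    (v s 0 1 * (g s 0 1 + b2) + (g s 0 1 + b2) * v s 0 1)); first exact: H.
  by rewrite /h'; ring.
have ch : {for s0, continuous h} by apply: derivable_cont; exact: dh.
have h0 : h s0 != 0.
  apply: contraNneq nz; rewrite /h => /eqP; rewrite paddr_eq0 ?sqr_ge0// !sqrf_eq0.
  by move=> /andP[/eqP -> /eqP ->]; rewrite !mulr0 addr0.
(* Psi (w, s) is the point over w turned to the vertical line of g s. Close to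
   p it lies in W, where the surface meets every vertical line only once. *)
pose Psi (z : 'rV[R]_2 * R) : 'rV[R]_3 := pt3 (g z.2 0 0) (g z.2 0 1)
  (f z.1 + c1 * (g z.2 0 0 - z.1 0 0) + c2 * (g z.2 0 1 - z.1 0 1)).
have cPsi : {for (top p, s0), continuous Psi}.
  have c1z i : {for (top p, s0), continuous (fun z : 'rV[R]_2 * R => z.1 0 i)}.
    by apply: (@continuous_comp _ _ _ fst (fun q : 'rV[R]_2 => q 0 i)); [exact: cvg_fst|exact: coord_continuous].
  have c2z i : {for (top p, s0), continuous (fun z : 'rV[R]_2 * R => g z.2 0 i)}.
    apply: (@continuous_comp _ _ _ snd (fun s => g s 0 i)); first exact: cvg_snd.
    by apply: (@continuous_comp _ _ _ g (fun q : 'rV[R]_3 => q 0 i)); [exact: cg|exact: coord_continuous].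
  have cf : {for (top p, s0), continuous (fun z : 'rV[R]_2 * R => f z.1)}.
    apply: (@continuous_comp _ _ _ fst f); first exact: cvg_fst.
    by apply: (Cr_cont Cf); exact: EU.
  apply: continuous_rV => i; elim/forall_I3: i.
  - by apply: continuous_at_ext (c2z 0) => z; rewrite ptE.
  - by apply: continuous_at_ext (c2z 1) => z; rewrite ptE.
  - apply: continuous_at_ext (contAdd (contAdd cf (contMul (@contCst _ _ _ c1) (contSub (c2z 0) (c1z 0))))
      (contMul (@contCst _ _ _ c2) (contSub (c2z 1) (c1z 1)))) => z.
    by rewrite ptE.
have WPsi : W (Psi (top p, s0)).
  by rewrite /Psi /= -/p !ptE !subrr !mulr0 !addr0 fu (_ : pt3 _ _ _ = p)//; apply: rV3P; rewrite ptE.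
have [[N1 N2] [/= n1 n2] HPsi] : nbhs (top p, s0) [set z | W (Psi z)].
  by apply: cPsi; exact: open_nbhs_nbhs.
have near0 : \forall s \near s0, [/\ h' s != 0, W (g s), h s != 0, N2 s & `|s| < e].
  have m1 := near_neq0 ch' nz.
  have m2 : \forall s \near s0, W (g s) by apply: cg; exact: open_nbhs_nbhs.
  have m3 := near_neq0 ch h0.
  have m4 : \forall s \near s0, `|s| < e.
    have : {for s0, continuous (fun s : R => `|s|)} by exact: norm_continuous.
    by move=> /(_ [set x | x < e]); apply; exact: lt_nbhsl.
  near=> s; split; near: s; [exact: m1|exact: m2|exact: m3|exact: n2|exact: m4].
have [a0 a00 Ha0] := near_radius near0.
pose a := a0 / 2.
have a_gt0 : 0 < a by rewrite divr_gt0.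
have Ha s : s0 - a <= s <= s0 + a -> [/\ h' s != 0, W (g s), h s != 0, N2 s & `|s| < e].
  move=> H; apply: Ha0; rewrite ltr_distl.
  by rewrite /a in H; case/andP : H => H1 H2; apply/andP; split; lra.
have aa : s0 - a < s0 + a by lra.
have [|inv [l [r [lr Hinv _]]]] := @monotone_inverse R h (fun s => 2 * h' s) _ _ aa.
  by move=> s /Ha[nh _ _ _ se]; split; [exact: dh|rewrite mulf_neq0// pnatr_eq0].
have [hlr _] : l < h s0 < r /\ inv (h s0) = s0 by apply: lr; apply/andP; split; lra.
pose nn (w : 'rV[R]_2) := (w 0 0 + b1) ^+ 2 + (w 0 1 + b2) ^+ 2.
have cnn : {for top p, continuous nn}.
  have cx i (b : R) : {for top p, continuous (fun w : 'rV[R]_2 => (w 0 i + b) ^+ 2)}.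
    by apply: continuous_at_ext (contMul (@continuous_coord R (top p) i b) (@continuous_coord R (top p) i b)) => w; rewrite expr2.
  exact: contAdd (cx 0 b1) (cx 1 b2).
have nnp : nn (top p) = h s0 by rewrite /nn !ptE.
have near1 : \forall w \near top p, l < nn w < r /\ N1 w.
  have m1 : \forall w \near top p, l < nn w
    by move: (cnn [set x | l < x]); apply; apply: lt_nbhsr; rewrite nnp; case/andP : hlr.
  have m2 : \forall w \near top p, nn w < r
    by move: (cnn [set x | x < r]); apply; apply: lt_nbhsl; rewrite nnp; case/andP : hlr.
  by near=> w; split; [apply/andP; split; near: w; [exact: m1|exact: m2]|near: w; exact: n1].
have [rho rho0' Hrho] := (nbhs_ballP _ _).1 near1.
have rho0 : 0 < rho by exact: rho0'.
have umb w t' : ball (top p) rho w -> E w -> I t' -> c t' (lift3 f w) -> htrace f w = 2 * A t'.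
  move=> Bw Ew It' cw; apply/eqP; apply: contrapT => /negP tA.
  have [nw Nw] := Hrho _ Bw.
  have [Mw Ww] := graph_lift G Ew.
  have trw : trace_at (lift3 f w) (htrace f w).
    by exists f; [exact: (graph_local G Mw Ww)|rewrite top_lift3].
  have full := nonumbilic_circle It' cw trw tA.
  have [/andP[/ltW sl /ltW sr] hs _] := Hinv _ nw.
  set s := inv _ in sl sr hs.
  have [h's Wgs hs0 N2s se] : [/\ h' s != 0, W (g s), h s != 0, N2 s & `|s| < e] by apply: Ha; rewrite sl sr.
  have [cs _] := gv _ se.
  have Ms := channel_sub ct It cs.
  have [th [th0 th1]] : exists th, turn th (lift3 f w) 0 0 = g s 0 0 /\ turn th (lift3 f w) 0 1 = g s 0 1.
    apply: turn_between; first by rewrite !ptE -/(nn w) -hs.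
    by rewrite -/(h s) hs !ptE.
  have [cth trth] := full th.
  have Mth := channel_sub ct It' cth.
  have Wth : W (turn th (lift3 f w)).
    have := HPsi (w, s) (conj Nw N2s); rewrite /= (_ : Psi (w, s) = turn th (lift3 f w))//.
    apply: rV3P; rewrite /Psi /=.
    + by rewrite pt3_0 th0.
    + by rewrite pt3_1 th1.
    + by rewrite [LHS]pt3_2 -th0 -th1 !ptE; ring.
  have E1 : turn th (lift3 f w) = g s.
    apply: rV3P => //.
    rewrite -(graph_top G Mth Wth).2 -(graph_top G Ms Wgs).2; congr (f _).
    by rewrite /top th0 th1.
  rewrite E1 in cth trth.
  have tgs := trace_at_unique Ms (graph_local G Ms Wgs) trth.
  have /eqP := curve_dichotomy ct cM rel G It gv se Wgs.
  rewrite mulf_eq0 (negbTE h's) orbF subr_eq0 tgs => /eqP tE.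
  move: tA; rewrite tE; apply/negP; rewrite negbK; apply/eqP; congr (2 * _).
  have [Es fs] := graph_top G Ms Wgs.
  have lgs : lift3 f (top (g s)) = g s by rewrite lift3_top.
  have [|x1 y1] := radial_gradient ct rel G Es It; first by rewrite lgs.
  have [|x2 y2] := radial_gradient ct rel G Es It'; first by rewrite lgs.
  rewrite x1 in x2; rewrite y1 in y2; move: x2 y2; rewrite /top !pt2_0 !pt2_1.
  have [X0|X0] := eqVneq (g s 0 0 + b1) 0; last by move=> /(mulIf X0).
  have [Y0|Y0] := eqVneq (g s 0 1 + b2) 0; last by move=> _ /(mulIf Y0).
  by move: hs0; rewrite /h X0 Y0 expr0n/= addr0 eqxx.
have [y [r' [r'0 BE Brho]]] := graph_ball G Eu rho0.
have BU : ball y r' `<=` U by apply: subset_trans BE _.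
have um w : ball y r' w -> [/\ D0 (D0 f) w = D1 (D1 f) w, D1 (D0 f) w = 0 & D0 (D1 f) w = 0].
  move=> Bw; have Ew := BE _ Bw; have [Mw _] := graph_lift G Ew.
  have [t' It' cw] := covered cM Mw.
  exact: (umbilic_hessian (mixed2 oU Cf (BU _ Bw)) (curvature_root cc ct G It' Ew cw)
    (umb w t' (Brho _ Bw) Ew It' cw)).
have [k0 [b0 [d0 H0]]] := umbilic_ball oU Cf BU r'0 um.
exact: (no_umbilic_ball cc ct cM iI aA Anc G r'0 BE H0).
Unshelve. all: by end_near.
Qed.

(** A characteristic is closed and, by circular_arc, contains with each point an
    arc of its circle about the axis. *)
Lemma characteristic_turn t p : I t -> c t p -> forall th, c t (turn th p).
Proof.
move=> It cp; apply: (@turn_all R b1 c1 b2 c2 (c t) p).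
- exact: cp.
- move=> q cq; have [g [v [e [e0 <- v0 cv gv]]]] := char_param It cq.
  have e00 : `|0 : R| < e by rewrite normr0.
  apply: (circular_arc ct rel It e0 gv (cv _ e00) v0) => s se.
  exact: (orthogonal_characteristic It cv gv se).
- have [_ _ clc _] := cc It.
  exact: (closed_comp (fun s _ => @continuous_turn R b1 c1 b2 c2 p s) clc).
Qed.

Lemma turn_invariant p th : M p -> M (turn th p).
Proof.
move=> Mp; have [t It cp] := covered cM Mp.
exact: (channel_sub ct It (characteristic_turn It cp th)).
Qed.

End Rotation.

(** * Affine images and graphs as surfaces *)

Section AffineImage.
Context {R : realType}.

Lemma surface_affine (M : set 'rV[R]_3) (A A' : 'M[R]_3) (b b' : 'rV[R]_3) :
  (forall p, (p *m A' + b') *m A + b = p) -> (forall p, (p *m A + b) *m A' + b' = p) ->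
  surface M -> surface [set p | M (p *m A + b)].
Proof.
move=> AA' A'A [[p0 Mp0] cM sM].
have Craff k (U : set 'rV[R]_3) (psi : 'rV[R]_3 -> 'rV[R]_3) i : open U ->
    (forall i, Cr k U (fun y => psi y 0 i)) -> Cr k U (fun y => (psi y *m A' + b') 0 i).
  move=> oU Cpsi; apply: (Cr_ext (f := fun y => \sum_j psi y 0 j * A' j i + b' 0 i)) => //.
    by move=> y _; rewrite !mxE.
  apply: Cr_add => //; last exact: Cr_cst.
  by apply: Cr_sum => // j; apply: Cr_mul => //; exact: Cr_cst.
have caff : continuous (fun p : 'rV[R]_3 => p *m A' + b').
  move=> p; apply: continuous_rV => i.
  by apply: (@Craff 0 setT id) => //; [exact: openT|move=> j; exact: Cr_coord].
have caff' : continuous (fun p : 'rV[R]_3 => p *m A + b).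
  move=> p; apply: continuous_rV => i.
  apply: (@continuous_at_ext _ _ (fun p : 'rV[R]_3 => \sum_j p 0 j * A j i + b 0 i)).
    by move=> y; rewrite !mxE.
  suff : Cr 0 setT (fun p : 'rV[R]_3 => \sum_j p 0 j * A j i + b 0 i) by apply.
  apply: Cr_add; [exact: openT| |exact: Cr_cst].
  by apply: Cr_sum => [|j]; [exact: openT|apply: Cr_mul; [exact: openT|exact: Cr_coord|exact: Cr_cst]].
split.
- by exists (p0 *m A' + b'); rewrite /= AA'.
- rewrite (_ : [set p | _] = (fun p => p *m A' + b') @` M).
    apply: (connected_continuous_connected cM); exact: continuous_subspaceT.
  apply/seteqP; split => p /=; first by move=> Mp; exists (p *m A + b).
  by move=> [q Mq <-]; rewrite AA'.
- move=> p /= Mp; have [h [W [W' [phi [psi [hb Wp [[oW oW'] H1 H2 H3 H4]]]]]]] := sM _ Mp.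
  exists h, [set q | W (q *m A + b)], W', (fun q => phi (q *m A + b)), (fun y => psi y *m A' + b').
  split; [exact: hb|exact: Wp|split].
  + by split; [apply: open_comp oW => q _; exact: caff'|exact: oW'].
  + by move=> q /= Wq; have [? ->] := H1 _ Wq; rewrite A'A.
  + by move=> y W'y; rewrite /= AA'; exact: H2.
  + move=> i; split; last first.
      apply: (Craff 3%N W' psi i oW') => j.
      by have [_ +] := H3 j.
    by have [CW _] := H3 i; exact: (Cr_affine A b CW).
  + by move=> q /= Wq; exact: H4.
Qed.

Definition mx3 (rows : seq (seq R)) : 'M[R]_3 := \matrix_(i < 3, j < 3) (nth [::] rows i)`_j.

Lemma mul_mx3 (p : 'rV[R]_3) rows j : (p *m mx3 rows) 0 j =
  p 0 0 * (nth [::] rows 0)`_j + p 0 1 * (nth [::] rows 1)`_j + p 0 2 * (nth [::] rows 2)`_j.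
Proof.
have l1 : lift ord0 ord0 = 1 :> 'I_3 by exact/val_inj.
have l2 : lift ord0 (lift ord0 ord0) = 2 :> 'I_3 by exact/val_inj.
by rewrite mxE !big_ord_recl big_ord0 l1 l2 !mxE addr0 addrA.
Qed.

(** The shear p |-> (x - b1, y - b2, z + c1 x + c2 y) conjugates the rotations
    about the z-axis to the turns. *)
Lemma turn_isotropic_rotational (M : set 'rV[R]_3) (b1 c1 b2 c2 : R) : surface M ->
  (forall p th, M p -> M (axial_turn b1 c1 b2 c2 th p)) -> isotropic_rotational M.
Proof.
move=> sM tM.
pose Phi := isotropic_congruence false 0 c1 c2 (- b1) (- b2) 0.
pose Psi (p : 'rV[R]_3) : 'rV[R]_3 :=
  pt3 (p 0 0 + b1) (p 0 1 + b2) (p 0 2 - c1 * (p 0 0 + b1) - c2 * (p 0 1 + b2)).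
have PhiE p : Phi p = pt3 (p 0 0 - b1) (p 0 1 - b2) (c1 * p 0 0 + c2 * p 0 1 + p 0 2).
  by rewrite /Phi /isotropic_congruence cos0 sin0; apply: rV3P; rewrite !ptE ?expr0; ring.
have PhiK p : Phi (Psi p) = p by rewrite PhiE; apply: rV3P; rewrite !ptE; ring.
have PsiK p : Psi (Phi p) = p by rewrite PhiE; apply: rV3P; rewrite !ptE; ring.
have turnE p th : axial_turn b1 c1 b2 c2 th (Phi p) = Phi (rotation th p).
  by rewrite !PhiE; apply: rV3P; rewrite !ptE; ring.
exists [set p | M (Phi p)], false, 0, c1, c2, (- b1), (- b2), 0; split.
- pose mA := mx3 [:: [:: 1; 0; c1]; [:: 0; 1; c2]; [:: 0; 0; 1]].
  pose mA' := mx3 [:: [:: 1; 0; - c1]; [:: 0; 1; - c2]; [:: 0; 0; 1]].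
  pose w := pt3 (- b1) (- b2) 0; pose w' := pt3 b1 b2 (- c1 * b1 - c2 * b2).
  have linPhi p : Phi p = p *m mA + w.
    by rewrite PhiE; apply: rV3P; rewrite [in RHS]mxE mul_mx3 !ptE /=; ring.
  have linPsi p : Psi p = p *m mA' + w'.
    by apply: rV3P; rewrite [in RHS]mxE mul_mx3 !ptE /=; ring.
  rewrite (_ : [set p | M (Phi p)] = [set p | M (p *m mA + w)]).
    by apply: (@surface_affine M mA mA' w w' _ _ sM) => p; [rewrite -linPsi -linPhi|rewrite -linPhi -linPsi].
  by apply/seteqP; split => p /=; rewrite linPhi.
- have rotM th p : M (Phi p) -> M (Phi (rotation th p)) by move=> Mp; rewrite -turnE; exact: tM.
  move=> th; apply/seteqP; split => p /=; first by move=> [q Mq <-]; exact: rotM.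
  move=> Mp; exists (rotation (- th) p); first exact: rotM.
  have := cos2Dsin2 th; rewrite /rotation cosN sinN => H.
  apply: rV3P; rewrite !ptE //.
  + rewrite -[RHS]mul1r -H; ring.
  + rewrite -[RHS]mul1r -H; ring.
- apply/seteqP; split => p /=; first by move=> Mp; exists (Psi p); [rewrite PhiK|exact: PhiK].
  by move=> [q Mq <-].
Qed.

End AffineImage.

Section GraphSurface.
Context {R : realType}.

Lemma connected_setT_rV n : connected [set: 'rV[R]_n].
Proof.
pose seg (x : 'rV[R]_n) := (fun s : R => s *: x) @` setT.
rewrite (_ : setT = \bigcup_(x in setT) seg x).
  apply: bigcup_connected.
    by exists 0 => x _; exists 0 => //; rewrite scale0r.
  move=> x _; apply: connected_continuous_connected.
    by apply/connected_intervalP => a b _ _ z _.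
  by apply: continuous_subspaceT => s; exact: scalel_continuous.
apply/seteqP; split => x // _; exists x => //; exists 1 => //; exact: scale1r.
Qed.

Lemma graph_surface (G : 'rV[R]_2 -> R) : Cr 3 setT (fun p : 'rV[R]_3 => G (top p)) ->
  continuous G -> surface [set p : 'rV[R]_3 | p 0 2 = G (top p)].
Proof.
move=> CG cG.
have E : [set p : 'rV[R]_3 | p 0 2 = G (top p)] = lift3 G @` setT.
  apply/seteqP; split => p /=; first by move=> pG; exists (top p) => //; exact: lift3_top.
  by move=> [u _ <-]; rewrite top_lift3 ptE.
have oT : open [set: 'rV[R]_3] by exact: openT.
split.
- by rewrite E; exists (lift3 G 0); exists 0.
- rewrite E; apply: (connected_continuous_connected (@connected_setT_rV 2)).
  by apply: continuous_subspaceT => u; apply: continuous_lift3; exact: cG.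
- move=> p _; exists false, setT, setT,
    (fun q : 'rV[R]_3 => pt3 (q 0 0) (q 0 1) (q 0 2 - G (top q))),
    (fun q : 'rV[R]_3 => pt3 (q 0 0) (q 0 1) (q 0 2 + G (top q))).
  have topE (q : 'rV[R]_3) z : top (pt3 (q 0 0) (q 0 1) z) = top q by rewrite /top !ptE.
  split; [by []|by []|split].
  + by [].
  + by move=> q _; split => //; apply: rV3P; rewrite ?topE !ptE ?subrK.
  + by move=> q _; split => //; apply: rV3P; rewrite ?topE !ptE ?addrK.
  + have st (F : 'rV[R]_3 -> R) F' : (forall q, F' q = F q) -> Cr 3 setT F -> Cr 3 setT F'.
      by move=> /funext ->.
    have CN : Cr 3 setT (fun q : 'rV[R]_3 => - 1 * G (top q)).
      exact: (Cr_mul oT (@Cr_cst R 3 3 setT (-1)) CG).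
    move=> i; elim/forall_I3: i; split.
    * by apply: (st _ _ _ (@Cr_coord R _ 3 setT 0)) => q; rewrite ptE.
    * by apply: (st _ _ _ (@Cr_coord R _ 3 setT 0)) => q; rewrite ptE.
    * by apply: (st _ _ _ (@Cr_coord R _ 3 setT 1)) => q; rewrite ptE.
    * by apply: (st _ _ _ (@Cr_coord R _ 3 setT 1)) => q; rewrite ptE.
    * by apply: (st _ _ _ (Cr_add oT (@Cr_coord R _ 3 setT 2) CN)) => q; rewrite ptE mulN1r.
    * by apply: (st _ _ _ (Cr_add oT (@Cr_coord R _ 3 setT 2) CG)) => q; rewrite ptE.
  + move=> q _; split => [/= qG|[/(_ 2 isT) + _]].
      split => // i; elim/forall_I3: i => // _; rewrite ptE qG subrr//.
    by rewrite ptE => /eqP; rewrite subr_eq0 => /eqP.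
Qed.

End GraphSurface.

(** * Constant principal curvatures *)

(** With constant trace and determinant, and equal mixed third derivatives, the
    third derivatives solve a homogeneous linear system whose determinant is the
    discriminant of the Hessian. *)
Lemma constant_eigenvalues_rigid (R : realFieldType) (P Q S px py qx qy sx sy : R) :
  py = qx -> sx = qy -> px + sx = 0 -> py + sy = 0 ->
  px * S + P * sx - (qx * Q + Q * qx) = 0 ->
  py * S + P * sy - (qy * Q + Q * qy) = 0 ->
  (S - P) ^+ 2 + 4 * Q ^+ 2 != 0 -> [/\ px = 0, py = 0 & qx = 0] /\ [/\ qy = 0, sx = 0 & sy = 0].
Proof.
move=> <- <- hx hy; have -> : sx = - px by rewrite -(addKr px sx) hx addr0.
have -> : sy = - py by rewrite -(addKr py sy) hy addr0.
move=> h1 h2 d0.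
have px0 : px = 0.
  apply: (mulIf d0); rewrite mul0r.
  have -> : px * ((S - P) ^+ 2 + 4 * Q ^+ 2) =
    (S - P) * (px * S + P * - px - (py * Q + Q * py)) +
    2 * Q * (py * S + P * - py - (- px * Q + Q * - px)) by ring.
  by rewrite h1 h2 !mulr0 addr0.
have py0 : py = 0.
  apply: (mulIf d0); rewrite mul0r.
  have -> : py * ((S - P) ^+ 2 + 4 * Q ^+ 2) =
    (S - P) * (py * S + P * - py - (- px * Q + Q * - px)) -
    2 * Q * (px * S + P * - px - (py * Q + Q * py)) by ring.
  by rewrite h1 h2 !mulr0 subr0.
by rewrite px0 py0 oppr0.
Qed.

Lemma discriminantE (R : realFieldType) (P Q S tau d : R) :
  P + S - tau = 0 -> P * S - Q * Q - d = 0 -> (S - P) ^+ 2 + 4 * Q ^+ 2 = tau ^+ 2 - 4 * d.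
Proof. by move=> /eqP + /eqP; rewrite !subr_eq0 => /eqP <- /eqP <-; ring. Qed.

Lemma equal_eigenvalues (R : realFieldType) (P Q S tau : R) :
  P + S - tau = 0 -> (S - P) ^+ 2 + 4 * Q ^+ 2 = 0 -> [/\ P = tau / 2, Q = 0 & S = tau / 2].
Proof.
move=> h1 /eqP; have q0 : 0 <= 4 * Q ^+ 2 by rewrite mulr_ge0 ?sqr_ge0.
rewrite (paddr_eq0 (sqr_ge0 _) q0) sqrf_eq0 (mulf_eq0 4) sqrf_eq0 subr_eq0 pnatr_eq0/=.
by move=> /andP[/eqP SP /eqP ->]; split => //; subst S; lra.
Qed.

Section ConstantEigenvalues.
Context {R : realType}.
Variables (U E : set 'rV[R]_2) (f : 'rV[R]_2 -> R) (k t1 t2 : R).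
Hypothesis oU : open U.
Hypothesis Cf : Cr 3 U f.
Hypothesis EU : E `<=` U.
Hypothesis EE : E `<=` closure E°.
Hypothesis eig : forall u, E u ->
  (htrace f u = t1 \/ htrace f u = t2) /\ hdet f u = k * (htrace f u - k).

(** A continuous function with two values. *)
Lemma trace_locally_constant u : E° u -> \forall w \near u, htrace f w = htrace f u /\ E w.
Proof.
move=> Eu; have Uu := EU (interior_subset Eu).
have nE : \forall w \near u, E w by exact: Eu.
have [t12|t12] := eqVneq t1 t2.
  apply: filterS nE => w Ew; split; last exact: Ew.
  have [+ _] := eig Ew; have [+ _] := eig (interior_subset Eu).
  move: (htrace f w) (htrace f u) => x y.
  by rewrite t12 => -[->|->] [->|->].
have d0 : 0 < `|t1 - t2| by rewrite normr_gt0 subr_eq0.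
have ch : {for u, continuous (htrace f)}.
  by apply: differentiable_continuous; exact: (differentiable_htrace Cf Uu).
have nc := near_continuous ch d0.
near=> w.
have Ew : E w by near: w; exact: nE.
have dw : `|htrace f u - htrace f w| < `|t1 - t2| by near: w; exact: nc.
split; last exact: Ew.
have [hw _] := eig Ew; have [hu _] := eig (interior_subset Eu).
move: dw hw hu; move: (htrace f w) (htrace f u) => x y dw.
by move=> [xE|xE] [yE|yE]; subst x y => //; move: dw; rewrite ?ltxx // distrC ltxx.
Unshelve. all: by end_near.
Qed.

Lemma zero_derivative_near (F : 'rV[R]_2 -> R) (u v : 'rV[R]_2) (a : R) :
  (\near u, F u = a) -> 'D_v F u = 0.
Proof.
move=> n; have n' : \near u, F u = (cst a : 'rV[R]_2 -> R) u by exact: n.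
by apply: (etrans (near_eq_derive _ n')); exact: derive_cst.
Qed.

(** The discriminant is constant near u. If it is not zero,
    constant_eigenvalues_rigid applies; if it is zero, the Hessian is tau / 2
    times the identity near u. *)
Lemma third_derivatives_interior i j l u : E° u ->
  'D_(delta_mx 0 l) ('D_(delta_mx 0 i) ('D_(delta_mx 0 j) f)) u = 0.
Proof.
move=> Eu; have Uu := EU (interior_subset Eu).
have loc := trace_locally_constant Eu.
set tau := htrace f u in loc.
have [e e0 He] : exists2 e : R, 0 < e & forall w, ball u e w -> htrace f w = tau /\ E w.
  by have [e e0 He] := (nbhs_ballP _ _).1 loc; exists e.
have Bu : ball u e u by exact: ballxx.
have oB : open (ball u e : set 'rV[R]_2) by exact: ball_open.
have tr w : ball u e w -> D0 (D0 f) w + D1 (D1 f) w - tau = 0.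
  by move=> /He[h _]; apply/eqP; rewrite subr_eq0; apply/eqP.
have det w : ball u e w -> D0 (D0 f) w * D1 (D1 f) w - D0 (D1 f) w * D0 (D1 f) w - k * (tau - k) = 0.
  move=> Bw; have [h Ew] := He _ Bw; have [_ hd] := eig Ew.
  apply/eqP; rewrite subr_eq0; apply/eqP; rewrite h in hd; rewrite -hd /hdet.
  by rewrite (mixed2 oU Cf (EU Ew)).
have dtr (m : 'I_2) : 'D_(delta_mx 0 m) (D0 (D0 f)) u + 'D_(delta_mx 0 m) (D1 (D1 f)) u = 0.
  have DD := derSub (derAdd (line_at0 (delta_mx 0 m) (diff2 Cf 0 0 Uu)) (line_at0 (delta_mx 0 m) (diff2 Cf 1 1 Uu))) (derCst 0 tau).
  exact: (etrans (esym (subr0 _)) (derive_line_eq0 (F := fun w => D0 (D0 f) w + D1 (D1 f) w - tau) oB Bu tr DD)).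
have ddet (m : 'I_2) : 'D_(delta_mx 0 m) (D0 (D0 f)) u * D1 (D1 f) u + D0 (D0 f) u * 'D_(delta_mx 0 m) (D1 (D1 f)) u
   - ('D_(delta_mx 0 m) (D0 (D1 f)) u * D0 (D1 f) u + D0 (D1 f) u * 'D_(delta_mx 0 m) (D0 (D1 f)) u) = 0.
  have L (i' j' : 'I_2) := line_at0 (delta_mx 0 m) (diff2 Cf i' j' Uu).
  have DD := derSub (derSub (derMul (L 0 0) (L 1 1)) (derMul (L 0 1) (L 0 1))) (derCst 0 (k * (tau - k))).
  rewrite scale0r addr0 in DD.
  exact: (etrans (esym (subr0 _)) (derive_line_eq0
    (F := fun w => D0 (D0 f) w * D1 (D1 f) w - D0 (D1 f) w * D0 (D1 f) w - k * (tau - k)) oB Bu det DD)).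
have S1 : D0 (D1 (D1 f)) u = D1 (D0 (D1 f)) u := Schwarz1 oU Cf 1 Uu.
have S0 : D1 (D0 (D0 f)) u = D0 (D0 (D1 f)) u.
  exact: (esym (etrans (mixed3 oU Cf 0 Uu) (Schwarz1 oU Cf 0 Uu))).
have all0 : [/\ D0 (D0 (D0 f)) u = 0, D1 (D0 (D0 f)) u = 0 & D0 (D0 (D1 f)) u = 0] /\
   [/\ D1 (D0 (D1 f)) u = 0, D0 (D1 (D1 f)) u = 0 & D1 (D1 (D1 f)) u = 0].
  pose P0 := D0 (D0 f) u; pose Q0 := D0 (D1 f) u; pose SS0 := D1 (D1 f) u.
  have [disc|disc] := eqVneq ((SS0 - P0) ^+ 2 + 4 * Q0 ^+ 2) 0; last first.
    exact: (constant_eigenvalues_rigid S0 S1 (dtr 0) (dtr 1) (ddet 0) (ddet 1) disc).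
  have disc0 : tau ^+ 2 - 4 * (k * (tau - k)) = 0.
    exact: (etrans (esym (discriminantE (tr _ Bu) (det _ Bu))) disc).
  have umb w : ball u e w -> [/\ D0 (D0 f) w = tau / 2, D0 (D1 f) w = 0 & D1 (D1 f) w = tau / 2].
    move=> Bw; have h := discriminantE (tr _ Bw) (det _ Bw).
    exact: (equal_eigenvalues (tr _ Bw) (etrans h disc0)).
  have z1 (m : 'I_2) : 'D_(delta_mx 0 m) (D0 (D0 f)) u = 0.
    have n w : ball u e w -> D0 (D0 f) w = tau / 2 by move=> /umb[h _ _]; exact: h.
    exact: (zero_derivative_near _ (near_open oB Bu n)).
  have z2 (m : 'I_2) : 'D_(delta_mx 0 m) (D0 (D1 f)) u = 0.
    have n w : ball u e w -> D0 (D1 f) w = 0 by move=> /umb[_ h _]; exact: h.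
    exact: (zero_derivative_near _ (near_open oB Bu n)).
  have z3 (m : 'I_2) : 'D_(delta_mx 0 m) (D1 (D1 f)) u = 0.
    have n w : ball u e w -> D1 (D1 f) w = tau / 2 by move=> /umb[_ _ h]; exact: h.
    exact: (zero_derivative_near _ (near_open oB Bu n)).
  by split; split; [exact: z1|exact: z1|exact: z2|exact: z2|exact: z3|exact: z3].
have [[a1 a2 a3] [a4 a5 a6]] := all0.
move: l i j; apply: forall_I2; apply: forall_I2; apply: forall_I2.
- exact: a1.
- exact: a3.
- exact: (etrans (esym (mixed3 oU Cf 0 Uu)) a3).
- exact: a5.
- exact: a2.
- exact: a4.
- exact: (etrans (esym (mixed3 oU Cf 1 Uu)) a4).
- exact: a6.
Qed.

Lemma third_derivatives_zero i j (v u : 'rV[R]_2) : E u ->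
  'D_v ('D_(delta_mx 0 i) ('D_(delta_mx 0 j) f)) u = 0.
Proof.
move=> Eu; have Uu := EU Eu.
have z l : 'D_(delta_mx 0 l) ('D_(delta_mx 0 i) ('D_(delta_mx 0 j) f)) u = 0.
  have c0 : {for u, continuous (fun _ : 'rV[R]_2 => 0 : R)} by exact: contCst.
  pose F : 'rV[R]_2 -> R := 'D_(delta_mx 0 l) ('D_(delta_mx 0 i) ('D_(delta_mx 0 j) f)).
  have cF : {for u, continuous F} by exact: (@cont3 R U f Cf i j l u Uu).
  have F0 (w : 'rV[R]_2) : U w -> E° w -> F w = 0.
    by move=> _ Ew; exact: (third_derivatives_interior i j l Ew).
  exact: (eq_on_closure oU Uu (EE Eu) cF c0 F0).
by rewrite (derive_coord2 _ (diff2 Cf i j Uu)) (z 0) (z 1) !mulr0 addr0.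
Qed.

End ConstantEigenvalues.

(** * Jets along paths *)

Lemma connected_clopen (T : topologicalType) (M P : set T) (p0 : T) : connected M ->
  (forall p, M p -> \forall q \near p, M q -> (P p <-> P q)) -> M p0 -> P p0 ->
  forall q, M q -> P q.
Proof.
move=> cM loc Mp0 Pp0; suff E : M `&` P = M by move=> q; rewrite -{1}E => -[].
apply: cM; first by exists p0.
- exists [set q | M q -> P q]°; first exact: open_interior.
  apply/seteqP; split => q [Mq]; last by move=> /interior_subset/(_ Mq).
  by move=> Pq; split => //; apply: filterS (loc q Mq) => z H /H[+ _]; apply.
- exists (~` [set q | M q -> ~ P q]°); first by apply: open_closedC; exact: open_interior.
  apply/seteqP; split => q [Mq].
    by move=> Pq; split => // /interior_subset/(_ Mq).
  move=> nP; split => //; apply: contrapT => Pq; apply: nP.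
  by apply: filterS (loc q Mq) => z H /H[_ +] => /[apply].
Qed.

Lemma constant_of_derive0_on (R : realType) (F : R -> R) :
  (forall s : R, 0 <= s <= 1 -> is_derive s 1 F 0) ->
  forall a b : R, 0 <= a <= 1 -> 0 <= b <= 1 -> F a = F b.
Proof.
move=> dF; have lt (a b : R) : 0 <= a <= 1 -> 0 <= b <= 1 -> a < b -> F a = F b.
  move=> /andP[a0 a1] /andP[b0 b1] ab.
  have [|z zab] := @mean_value R F (fun _ => 0) a b ab.
    by move=> s /andP[as_ sb]; apply: dF; rewrite (le_trans a0 as_) (le_trans sb b1).
  by rewrite mul0r => /eqP; rewrite subr_eq0 => /eqP.
move=> a b Ha Hb; have [ab|ba|->//] := ltgtP a b; first exact: lt.
by rewrite (lt b a).
Qed.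

(** A surface is locally connected by smooth paths: straight segments of a
    chart of the half-space. *)
Lemma path_in_surface (R : realType) (M W0 : set 'rV[R]_3) p : submanifold (Cr 3) true 2 M ->
  M p -> open W0 -> W0 p ->
  \forall q \near p, M q -> exists (g v : R -> 'rV[R]_3), [/\ g 0 = p, g 1 = q &
    forall s : R, 0 <= s <= 1 -> [/\ M (g s), W0 (g s) & is_derive s 1 g (v s)]].
Proof.
move=> sM Mp oW0 W0p; have [h [W [W' [phi [psi [hb Wp chart]]]]]] := sM p Mp.
have [[oW oW'] H1 H2 H3 H4] := chart.
have [W'p psip] := H1 p Wp.
have cphi q : W q -> {for q, continuous phi}.
  by move=> Wq; apply: differentiable_continuous; exact: (chart_differentiable chart Wq).
have cpsi y : W' y -> {for y, continuous psi}.
  by move=> Wy; apply: differentiable_continuous; exact: (chart_inv_differentiable chart Wy).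
have nV : \forall y \near phi p, W' y /\ W0 (psi y).
  have n1 : \forall y \near phi p, W' y by exact: open_nbhs_nbhs.
  have n2 : \forall y \near phi p, W0 (psi y).
    by apply: (cpsi _ W'p); rewrite psip; exact: open_nbhs_nbhs.
  by near=> y; split; near: y; [exact: n1|exact: n2].
have [r r0' HB] := (nbhs_ballP _ _).1 nV.
have r0 : 0 < r by exact: r0'.
have nW : \forall q \near p, W q by exact: open_nbhs_nbhs.
have nB : \forall q \near p, ball (phi p) r (phi q).
  by apply: (cphi p Wp); exact: nbhsx_ballx.
near=> q => Mq.
have Wq : W q by near: q; exact: nW.
have Bq : ball (phi p) r (phi q) by near: q; exact: nB.
have [_ psiq] := H1 q Wq.
pose L (s : R) := phi p + s *: (phi q - phi p).
have BL (s : R) : 0 <= s <= 1 -> ball (phi p) r (L s).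
  move=> /andP[s0 s1]; move: Bq; rewrite -ball_normE /ball_/= /L opprD addNKr normrN normrZ distrC.
  by apply: le_lt_trans; rewrite ger0_norm// ler_piMl.
exists (fun s => psi (L s)), (fun s => 'D_(phi q - phi p) psi (L s)); split.
- by rewrite /L scale0r addr0.
- by rewrite /L scale1r addrC subrK.
- move=> s s01; have [W's W0s] := HB _ (BL s s01).
  split; [|exact: W0s|exact: chart_line chart _ _ _ W's].
  apply: (chart_mem chart W's); have [sp1 sp2] := (H4 p Wp).1 Mp; have [sq1 sq2] := (H4 q Wq).1 Mq.
  have E i : L s 0 i = (1 - s) * phi p 0 i + s * phi q 0 i by rewrite /L !mxE; ring.
  case/andP : s01 => s0 s1; split => [i i2|ht].
    by rewrite E sp1// sq1// !mulr0 addr0.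
  by rewrite E addr_ge0// mulr_ge0// ?subr_ge0//; [exact: sp2|exact: sq2].
Unshelve. all: by end_near.
Qed.

Section Jets.
Context {R : realType}.
Variables (P Q S l m d : R).

(** The coefficients are those of the quadratic polynomial which osculates f at
    u, expanded at the origin instead of u; so they do not change with u if f is
    quadratic. *)
Definition jet (f : 'rV[R]_2 -> R) u : Prop :=
  [/\ D0 (D0 f) u = P, D0 (D1 f) u = Q & D1 (D1 f) u = S] /\ [/\ D0 f u = P * u 0 0 + Q * u 0 1 + l, D1 f u = Q * u 0 0 + S * u 0 1 + m
    & f u = (P * (u 0 0 * u 0 0) + 2 * Q * (u 0 0 * u 0 1) + S * (u 0 1 * u 0 1)) / 2 +
       l * u 0 0 + m * u 0 1 + d].

Variables (U E : set 'rV[R]_2) (f : 'rV[R]_2 -> R).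
Hypothesis oU : open U.
Hypothesis Cf : Cr 3 U f.
Hypothesis EU : E `<=` U.
Hypothesis third : forall i j (v u : 'rV[R]_2), E u ->
  'D_v ('D_(delta_mx 0 i) ('D_(delta_mx 0 j) f)) u = 0.
Variables (g w : R -> 'rV[R]_2).
Hypothesis gE : forall s : R, 0 <= s <= 1 -> E (g s) /\ is_derive s 1 g (w s).

(** The coefficients have zero derivative along the path, the second derivatives
    by hypothesis and then the lower ones in turn. *)
Lemma jet_path (a b : R) : 0 <= a <= 1 -> 0 <= b <= 1 -> jet f (g a) -> jet f (g b).
Proof.
move=> Ha Hb [[p1 p2 p3] [q1 q2 q3]].
have st (F : R -> R) (s x : R) : is_derive s 1 F x -> x = 0 -> is_derive s 1 F 0 by move=> + <-.
have H2 (i j : 'I_2) (s : R) : 0 <= s <= 1 ->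
    'D_(delta_mx 0 i) ('D_(delta_mx 0 j) f) (g s) = 'D_(delta_mx 0 i) ('D_(delta_mx 0 j) f) (g a).
  pose F (s : R) : R := 'D_(delta_mx 0 i) ('D_(delta_mx 0 j) f) (g s).
  have dF (z : R) : 0 <= z <= 1 -> is_derive z 1 F 0.
    move=> Hz; have [Ez dz] := gE Hz.
    exact: (st F z _ (is_derive_along dz (diff2 Cf i j (EU Ez))) (third i j (w z) Ez)).
  by move=> Hs; exact: (constant_of_derive0_on dF Hs Ha).
have eP (s : R) : 0 <= s <= 1 -> D0 (D0 f) (g s) = P by move=> Hs; exact: (etrans (H2 0 0 s Hs) p1).
have eQ (s : R) : 0 <= s <= 1 -> D0 (D1 f) (g s) = Q by move=> Hs; exact: (etrans (H2 0 1 s Hs) p2).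
have eS (s : R) : 0 <= s <= 1 -> D1 (D1 f) (g s) = S by move=> Hs; exact: (etrans (H2 1 1 s Hs) p3).
have eQ' (s : R) : 0 <= s <= 1 -> D1 (D0 f) (g s) = Q.
  by move=> Hs; have [Es _] := gE Hs; exact: (etrans (esym (mixed2 oU Cf (EU Es))) (eQ s Hs)).
have dg i (s : R) : 0 <= s <= 1 -> is_derive s 1 (fun s => g s 0 i) (w s 0 i).
  by move=> /gE[_ /is_derive_rV].
have G0 (s : R) : 0 <= s <= 1 -> D0 f (g s) = P * g s 0 0 + Q * g s 0 1 + l.
  pose F (s : R) : R := D0 f (g s) - (P * g s 0 0 + Q * g s 0 1 + l).
  have dF (z : R) : 0 <= z <= 1 -> is_derive z 1 F 0.
    move=> Hz; have [Ez dz] := gE Hz; have d1 := diff1 Cf 0 (EU Ez).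
    apply: (st F z _ (derSub (is_derive_along dz d1)
      (derAdd (derAdd (derScale P (dg 0 z Hz)) (derScale Q (dg 1 z Hz))) (derCst z l)))).
    by rewrite (derive_coord2 _ d1) (eP z Hz) (eQ' z Hz); ring.
  have Fa : F a = 0 by rewrite /F q1 subrr.
  by move=> Hs; apply: subr0_eq; exact: (etrans (constant_of_derive0_on dF Hs Ha) Fa).
have G1 (s : R) : 0 <= s <= 1 -> D1 f (g s) = Q * g s 0 0 + S * g s 0 1 + m.
  pose F (s : R) : R := D1 f (g s) - (Q * g s 0 0 + S * g s 0 1 + m).
  have dF (z : R) : 0 <= z <= 1 -> is_derive z 1 F 0.
    move=> Hz; have [Ez dz] := gE Hz; have d1 := diff1 Cf 1 (EU Ez).
    apply: (st F z _ (derSub (is_derive_along dz d1)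
      (derAdd (derAdd (derScale Q (dg 0 z Hz)) (derScale S (dg 1 z Hz))) (derCst z m)))).
    by rewrite (derive_coord2 _ d1) (eQ z Hz) (eS z Hz); ring.
  have Fa : F a = 0 by rewrite /F q2 subrr.
  by move=> Hs; apply: subr0_eq; exact: (etrans (constant_of_derive0_on dF Hs Ha) Fa).
split; split; [exact: eP|exact: eQ|exact: eS|exact: G0|exact: G1|].
pose q (u : 'rV[R]_2) := (P * (u 0 0 * u 0 0) + 2 * Q * (u 0 0 * u 0 1) + S * (u 0 1 * u 0 1)) / 2 +
       l * u 0 0 + m * u 0 1 + d.
pose F (s : R) : R := f (g s) - q (g s).
suff dF (z : R) : 0 <= z <= 1 -> is_derive z 1 F 0.
  have Fa : F a = 0 by rewrite /F q3 subrr.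
  by apply: subr0_eq; exact: (etrans (constant_of_derive0_on dF Hb Ha) Fa).
move=> Hz; have [Ez dz] := gE Hz.
have d1 : differentiable f (g z) by have [+ _] := Cf; apply; exact: EU.
have x := dg 0 z Hz; have y := dg 1 z Hz.
have dq := derAdd (derAdd (derMul (derAdd (derAdd (derScale P (derMul x x))
  (derScale (2 * Q) (derMul x y))) (derScale S (derMul y y))) (derCst z 2^-1))
  (derScale l x)) (derAdd (derScale m y) (derCst z d)).
have dq' : is_derive z 1 (fun s => q (g s)) (w z 0 0 * (P * g z 0 0 + Q * g z 0 1 + l) +
   w z 0 1 * (Q * g z 0 0 + S * g z 0 1 + m)).
  have st' (F1 G : R -> R) (r r' : R) : (forall s : R, F1 s = G s) -> is_derive z 1 F1 r -> r = r' -> is_derive z 1 G r'.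
    by move=> /funext -> + <-.
  apply: (st' _ _ _ _ _ dq) => [s|]; first by rewrite /q -[RHS]addrA.
  by field.
apply: (st F z _ (derSub (is_derive_along dz d1) dq')).
by rewrite (derive_coord2 _ d1) (G0 z Hz) (G1 z Hz) subrr.
Qed.

End Jets.

(** * Constant radius *)

Section Quadrics.
Context {R : realType}.

(** The hypothesis says that k is an eigenvalue; a row of the adjugate of H - k
    is an eigenvector unless it vanishes. *)
Lemma eigenvector_angle (P Q S k : R) : (P - k) * (S - k) = Q * Q ->
  exists phi, P * cos phi + Q * sin phi = k * cos phi /\ Q * cos phi + S * sin phi = k * sin phi.
Proof.
move=> H; have [v0 [v1 [nz e0 e1]]] : exists v0 v1 : R,
    [/\ v0 ^+ 2 + v1 ^+ 2 != 0, P * v0 + Q * v1 = k * v0 & Q * v0 + S * v1 = k * v1].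
  have [QP|QP] := eqVneq (Q ^+ 2 + (k - P) ^+ 2) 0; last first.
    exists Q, (k - P); split => //; first by ring.
    have -> : Q * Q + S * (k - P) = Q * Q - (P - k) * (S - k) + k * (k - P) by ring.
    by rewrite H subrr add0r.
  move/eqP : QP; rewrite paddr_eq0 ?sqr_ge0// !sqrf_eq0 subr_eq0 => /andP[/eqP Q0 /eqP kP].
  exists 1, 0; rewrite expr1n expr0n/= addr0 oner_eq0 Q0 kP; split => //; ring.
pose r := Num.sqrt (v0 ^+ 2 + v1 ^+ 2).
have n0 : 0 <= v0 ^+ 2 + v1 ^+ 2 by rewrite addr_ge0 ?sqr_ge0.
have r0 : r != 0 by rewrite sqrtr_eq0 -ltNge lt_def nz n0.
have [|phi [cE sE]] := @angle_exists R (v0 / r) (v1 / r).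
  by rewrite !exprMn -mulrDl exprVn sqr_sqrtr// divff.
by exists phi; rewrite cE sE !mulrA -!mulrDl e0 e1.
Qed.

Lemma principal_axes (P Q S k a b : R) : a ^+ 2 + b ^+ 2 = 1 ->
  P * a + Q * b = k * a -> Q * a + S * b = k * b ->
  [/\ P = k * a ^+ 2 + (P + S - k) * b ^+ 2, Q = (k - (P + S - k)) * (a * b)
    & S = k * b ^+ 2 + (P + S - k) * a ^+ 2].
Proof.
move=> n e0 e1; split.
- apply: subr0_eq; rewrite -[LHS](_ : P * (1 - (a ^+ 2 + b ^+ 2)) + a * (P * a + Q * b - k * a) -
    b * (Q * a + S * b - k * b) = _); last by ring.
  by rewrite n e0 e1 !subrr !mulr0 addr0 subr0.
- apply: subr0_eq; rewrite -[LHS](_ : Q * (1 - (a ^+ 2 + b ^+ 2)) + b * (P * a + Q * b - k * a) +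
    a * (Q * a + S * b - k * b) = _); last by ring.
  by rewrite n e0 e1 !subrr !mulr0 !addr0.
- apply: subr0_eq; rewrite -[LHS](_ : S * (1 - (a ^+ 2 + b ^+ 2)) - a * (P * a + Q * b - k * a) +
    b * (Q * a + S * b - k * b) = _); last by ring.
  by rewrite n e0 e1 !subrr !mulr0 subr0 addr0.
Qed.

Lemma rotate_back (a b X Y : R) : a ^+ 2 + b ^+ 2 = 1 ->
  a * (a * X + b * Y) - b * (a * Y - b * X) = X /\ b * (a * X + b * Y) + a * (a * Y - b * X) = Y.
Proof.
move=> n; split.
- by transitivity ((a ^+ 2 + b ^+ 2) * X); [ring|rewrite n mul1r].
- by transitivity ((a ^+ 2 + b ^+ 2) * Y); [ring|rewrite n mul1r].
Qed.

(** In principal axes, and up to a linear function, the quadric is 2 z = k x^2 +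
    o y^2. Division of z by k gives x^2 the coefficient 1, as the invariance
    under parabolic_rotation 0 requires. *)
Lemma quadric_parabolic_rotational (P Q S l m d k : R) : k != 0 ->
  (P - k) * (S - k) = Q * Q ->
  exists2 N : set 'rV[R]_3, parabolic_rotational N &
  [set p : 'rV[R]_3 | p 0 2 = (P * (p 0 0 * p 0 0) + 2 * Q * (p 0 0 * p 0 1) + S * (p 0 1 * p 0 1)) / 2 +
       l * p 0 0 + m * p 0 1 + d] `<=` N.
Proof.
move=> k0 H; have [phi [e0 e1]] := eigenvector_angle H.
have n := cos2Dsin2 phi.
have [EP EQ ES] := principal_axes n e0 e1.
move: (P + S - k) EP EQ ES => o EP EQ ES.
clear e0 e1; set a := cos phi in n EP EQ ES; set b := sin phi in n EP EQ ES.
pose G (u : 'rV[R]_2) := (u 0 0 * u 0 0 + o / k * (u 0 1 * u 0 1)) * 2^-1.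
pose M0 := [set p : 'rV[R]_3 | p 0 2 = G (top p)].
have oT n' : open [set: 'rV[R]_n'] by exact: openT.
exists (isotropic_congruence false phi (l * a + m * b) (m * a - l * b) 0 0 d @` (z_scaling k @` M0)).
  exists M0, 0, k, false, phi, (l * a + m * b), (m * a - l * b), 0, 0, d; split => //.
  - apply: graph_surface.
      apply: (Cr_ext (f := fun p : 'rV[R]_3 => (p 0 0 * p 0 0 + o / k * (p 0 1 * p 0 1)) * 2^-1) (oT 3)).
        by move=> p _; rewrite /G !ptE.
      have C (n' : nat) i := @Cr_coord R n' 3 setT i.
      exact: (Cr_mul (oT 3) (Cr_add (oT 3) (Cr_mul (oT 3) (C 3 0) (C 3 0))
        (Cr_mul (oT 3) (@Cr_cst R 3 3 setT (o / k)) (Cr_mul (oT 3) (C 3 1) (C 3 1)))) (@Cr_cst R 3 3 setT 2^-1)).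
    have c i (u : 'rV[R]_2) : {for u, continuous (fun u : 'rV[R]_2 => u 0 i)} by exact: coord_continuous.
    move=> u; exact: (contMul (contAdd (contMul (c 0 u) (c 0 u)) (contMul (@contCst _ _ u (o / k)) (contMul (c 1 u) (c 1 u))))
       (@contCst _ _ u 2^-1)).
  - have inv t p : M0 p -> M0 (parabolic_rotation 0 t p).
      by rewrite /M0 /G /= !ptE => ->; move: (o / k) => r; field.
    move=> t; apply/seteqP; split => p; first by move=> [q Mq <-]; exact: inv.
    move=> Mp; exists (parabolic_rotation 0 (- t) p); first exact: inv.
    by rewrite /parabolic_rotation; apply: rV3P; rewrite !ptE ?subrK// sqrrN; field.
move=> p /= pz.
pose x := a * p 0 0 + b * p 0 1; pose y := a * p 0 1 - b * p 0 0.
exists (z_scaling k (pt3 x y (G (pt2 x y)))).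
  by exists (pt3 x y (G (pt2 x y))) => //; rewrite /M0 /= /top !ptE.
have [E0 E1] : a * x - b * y = p 0 0 /\ b * x + a * y = p 0 1 := rotate_back _ _ n.
apply: rV3P; rewrite /isotropic_congruence /z_scaling -/a -/b !ptE ?expr0 ?mul1r ?addr0 //.
rewrite pz /G !ptE.
have -> : k * ((x * x + o / k * (y * y)) / 2) = (k * (x * x) + o * (y * y)) / 2 by field.
have L : l * p 0 0 + m * p 0 1 = (l * a + m * b) * x + (m * a - l * b) * y by rewrite -E0 -E1; ring.
by rewrite -[in RHS](addrA _ (l * _)) L EP EQ ES /x /y; field.
Qed.

End Quadrics.

Lemma eigenvalue_factors (R : realFieldType) (P Q Q' S k : R) : Q = Q' ->
  P * S - Q * Q' = k * (P + S - k) -> (P - k) * (S - k) = Q * Q.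
Proof. by move=> <- H; apply: subr0_eq; rewrite -(subrr (k * (P + S - k))) -{1}H; ring. Qed.

Section ConstantRadius.
Context {R : realType}.
Variables (M : set 'rV[R]_3) (I : set R) (A B C D : R -> R) (c : R -> set 'rV[R]_3).
Hypothesis cc : forall t, I t -> curve_without_endpoints (c t).
Hypothesis ct : forall t, I t -> forall p, c t p ->
  tangent_at M (parabolic_sphere (A t) (B t) (C t) (D t)) p.
Hypothesis cM : M = \bigcup_(t in I) c t.
Hypothesis sM : surface M.
Hypothesis gM : forall p, M p -> exists f, local_graph M p f.
Variables (k t1 t2 : R).
Hypothesis eigM : forall p f, M p -> local_graph M p f ->
  (htrace f (top p) = t1 \/ htrace f (top p) = t2) /\ hdet f (top p) = k * (htrace f (top p) - k).

Lemma eigenvalues_on_graph W U E f u : graph_on M W U E f -> E u ->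
  (htrace f u = t1 \/ htrace f u = t2) /\ hdet f u = k * (htrace f u - k).
Proof.
move=> G Eu; have [Mu Wu] := graph_lift G Eu.
by have := eigM Mu (graph_local G Mu Wu); rewrite top_lift3.
Qed.

(** The gradient is that of the sphere and the value is the height, which do not
    depend on the graph. *)
Lemma jet_unique P Q S l m d f f' q : M q -> local_graph M q f -> local_graph M q f' ->
  jet P Q S l m d f (top q) -> jet P Q S l m d f' (top q).
Proof.
move=> Mq lf lf' [[p1 p2 p3] [q1 q2 q3]].
have H i j := local_graph_hess (delta_mx 0 i) (delta_mx 0 j) Mq lf' lf.
have [t It cq] := covered cM Mq.
have [a0 a1 _] := channel_graph ct It cq lf.
have [a0' a1' _] := channel_graph ct It cq lf'.
have [W [U [E [Wq G]]]] := (local_graphP M q f).1 lf.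
have [W' [U' [E' [Wq' G']]]] := (local_graphP M q f').1 lf'.
have [_ fq] := graph_top G Mq Wq; have [_ fq'] := graph_top G' Mq Wq'.
split; split.
- exact: (etrans (H 0 0) p1).
- exact: (etrans (H 0 1) p2).
- exact: (etrans (H 1 1) p3).
- exact: (etrans (etrans a0' (esym a0)) q1).
- exact: (etrans (etrans a1' (esym a1)) q2).
- exact: (etrans (etrans fq' (esym fq)) q3).
Qed.

(** With constant principal curvatures the second-order jet does not change
    along the surface. *)
Lemma constant_radius_quadric : exists P Q S l m d : R,
  (P - k) * (S - k) = Q * Q /\
  forall p, M p -> p 0 2 = (P * (p 0 0 * p 0 0) + 2 * Q * (p 0 0 * p 0 1) + S * (p 0 1 * p 0 1)) / 2 +
       l * p 0 0 + m * p 0 1 + d.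
Proof.
have [[p0 Mp0] conM subM] := sM.
have [f0 lf0] := gM Mp0.
pose P := D0 (D0 f0) (top p0); pose Q := D0 (D1 f0) (top p0); pose S := D1 (D1 f0) (top p0).
pose l := D0 f0 (top p0) - (P * top p0 0 0 + Q * top p0 0 1).
pose m := D1 f0 (top p0) - (Q * top p0 0 0 + S * top p0 0 1).
pose q0 := (P * (top p0 0 0 * top p0 0 0) + 2 * Q * (top p0 0 0 * top p0 0 1) +
  S * (top p0 0 1 * top p0 0 1)) / 2 + l * top p0 0 0 + m * top p0 0 1.
pose d := f0 (top p0) - q0.
pose T : set 'rV[R]_3 := [set q | exists2 f, local_graph M q f & jet P Q S l m d f (top q)].
have T0 : T p0.
  exists f0; first exact: lf0.
  split; split; [by []|by []|by []| | |].
  - by rewrite /l addrC subrK.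
  - by rewrite /m addrC subrK.
  - by rewrite -/q0 /d addrC subrK.
have loc p : M p -> \forall q \near p, M q -> (T p <-> T q).
  move=> Mp; have [f lf] := gM Mp.
  have [W [U [E [Wp G]]]] := (local_graphP M p f).1 lf.
  have [oW [oU Cf] EU EE _] := G.
  have third := third_derivatives_zero oU Cf EU EE (fun u Eu => eigenvalues_on_graph G Eu).
  have paths := path_in_surface subM Mp oW Wp.
  have H01 : is_true ((0 : R) <= (0 : R) <= (1 : R)) by rewrite lexx ler01.
  have H11 : is_true ((0 : R) <= (1 : R) <= (1 : R)) by rewrite lexx ler01.
  apply: filterS paths => q + Mq => /(_ Mq)[g [v [g0 g1 gs]]].
  have gE (s : R) : 0 <= s <= 1 -> E ((top \o g) s) /\ is_derive s 1 (top \o g) (top (v s)).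
    move=> /gs[Ms Ws ds]; split; first by have [] := graph_top G Ms Ws.
    exact: is_derive_top.
  have J a b Ha Hb := @jet_path R P Q S l m d U E f oU Cf EU third (top \o g) (fun s => top (v s)) gE a b Ha Hb.
  have [Mq' Wq _] := gs 1 H11; rewrite g1 in Mq' Wq.
  have lfq := graph_local G Mq' Wq.
  split => -[f' lf' jf'].
  - exists f; first exact: lfq.
    have := jet_unique Mp lf' lf jf'; have := J 0 1 H01 H11; rewrite /= g0 g1; exact.
  - exists f; first exact: lf.
    have := jet_unique Mq' lf' lfq jf'; have := J 1 0 H11 H01; rewrite /= g0 g1; exact.
have TM := connected_clopen conM loc Mp0 T0.
exists P, Q, S, l, m, d; split.
- have [_] := eigM Mp0 lf0.
  have [W [U [E [Wp G]]]] := (local_graphP M p0 f0).1 lf0.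
  have [_ [oU Cf] EU _ _] := G; have [Ep _] := graph_top G Mp0 Wp.
  have mx := mixed2 oU Cf (EU _ Ep).
  exact: eigenvalue_factors mx.
- move=> p Mp; have [f lf [_ [_ _ fE]]] := TM p Mp.
  have [W [U [E [Wp G]]]] := (local_graphP M p f).1 lf.
  have [_ fp] := graph_top G Mp Wp.
  by rewrite -fp fE /top !ptE.
Qed.

End ConstantRadius.

(** * Conclusion *)

Section Conclusion.
Context {R : realType}.

Lemma nonconstant_radius_rotational (M : set 'rV[R]_3) (I : set R) (A B C D : R -> R) (Z : set 'rV[R]_2) :
  surface M -> smooth_sphere_family I A B C D ->
  [/\ analytic_on I A, analytic_on I B & analytic_on I C] -> envelope I A B C D M ->
  (exists s t, [/\ I s, I t & A s != A t]) -> (forall v : 'rV[R]_2, ~ (\near v, Z v)) ->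
  (forall p, M p -> exists k1 k2 : R, principal_curvatures M p k1 k2 /\
     Z (pt2 (mean_curvature k1 k2) (gaussian_curvature k1 k2))) ->
  isotropic_rotational M.
Proof.
move=> sM [iI _ [sA sB sC sD] _] [aA aB aC] [c [cc ct cM]] Anc Z0 HZ.
have gM p : M p -> exists2 f, local_graph M p f & Z (pt2 (htrace f (top p) / 2) (hdet f (top p))).
  move=> Mp; have [k1 [k2 [pc Zp]]] := HZ p Mp; have [f [lf _]] := pc.
  by exists f; [exact: lf|]; have [<- <-] := principal_curvatures_hess Mp lf pc.
have gM' p : M p -> exists f, local_graph M p f by move=> /gM[f lf _]; exists f.
have [Mn0 _ _] := sM.
have [b1 [c1 [b2 [c2 rel]]]] := affine_relation cc ct cM iI sA sB sC sD aA Anc Z0 gM Mn0 aB aC.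
apply: (@turn_isotropic_rotational R M b1 c1 b2 c2 sM) => p th Mp.
exact: (turn_invariant cc ct cM iI aA Anc gM' rel th Mp).
Qed.

(** The local equation of the curve would vanish identically near v. *)
Lemma analytic_curve_interior (Z : set 'rV[R]_2) : analytic_curve Z ->
  forall v : 'rV[R]_2, ~ (\near v, Z v).
Proof.
move=> aZ v nZ; have [U [g [[oU Uv] _ ng HU]]] := aZ v (nbhs_singleton nZ).
apply: ng; have nU : \forall w \near v, U w by exact: open_nbhs_nbhs.
by near=> w; apply: (HU w _).1; near: w.
Unshelve. all: by end_near.
Qed.

(** The relation fixes the square of the first coordinate when the second is
    given. *)
Lemma ratio_curve_interior (a : R) : a != 0 -> forall v : 'rV[R]_2,
  ~ (\near v, [set w : 'rV[R]_2 | (1 + a) ^+ 2 * w 0 1 = 4 * a * w 0 0 ^+ 2] v).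
Proof.
move=> a0 v nZ.
set Z := [set w : 'rV[R]_2 | _] in nZ.
have [e e0 He] := line_near (delta_mx 0 0) (open_interior Z) (nZ : Z° v).
have e2 : `|e / 2| < e by rewrite gtr0_norm ?divr_gt0//; lra.
have e2' : `|- (e / 2)| < e by rewrite normrN.
have h1 := interior_subset (He _ e2).
have h2 := interior_subset (He _ e2').
have h0 := interior_subset nZ.
move: h0 h1 h2; rewrite /Z /= !mxE /= !mulr1 !mulr0 !addr0.
move: (v 0 0) (v 0 1) => x y h0; rewrite h0 => h1 h2.
have : 4 * a * (2 * (e / 2) ^+ 2) = 0.
  have -> : 4 * a * (2 * (e / 2) ^+ 2) = 4 * a * (x + e / 2) ^+ 2 + 4 * a * (x - e / 2) ^+ 2 - 2 * (4 * a * x ^+ 2) by ring.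
  by rewrite -h1 -h2; ring.
apply/eqP; apply: mulf_neq0; first by apply: mulf_neq0 => //; rewrite pnatr_eq0.
apply: mulf_neq0; first by rewrite pnatr_eq0.
by apply: expf_neq0; rewrite gt_eqF ?divr_gt0.
Qed.

Lemma ratio_curve (a k1 k2 : R) : k1 * k2 != 0 -> k1 / k2 = a \/ k2 / k1 = a ->
  (1 + a) ^+ 2 * (k1 * k2) = 4 * a * ((k1 + k2) / 2) ^+ 2.
Proof.
rewrite mulf_eq0 negb_or => /andP[n1 n2] [] <-; field.
- by rewrite n2.
- by rewrite n1.
Qed.

(** One of the curvatures is k, so the other is a k or k / a. *)
Lemma ratio_sum (a k k1 k2 : R) : a != 0 -> k1 * k2 != 0 -> k1 / k2 = a \/ k2 / k1 = a ->
  k ^+ 2 - (k1 + k2) * k + k1 * k2 = 0 ->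
  (k1 + k2 = k + a * k \/ k1 + k2 = k + k / a) /\ k1 * k2 = k * (k1 + k2 - k).
Proof.
move=> a0; rewrite mulf_eq0 negb_or => /andP[n1 n2] ra H; split; last first.
  by apply: subr0_eq; rewrite -[RHS]H; ring.
have {}ra : k1 = a * k2 \/ k2 = a * k1.
  by case: ra => <-; [left|right]; rewrite divfK.
have : (k1 - k) * (k2 - k) = 0 by rewrite -H; ring.
move/eqP; rewrite mulf_eq0 !subr_eq0 => /orP[/eqP <-|/eqP <-]; case: ra => E.
- by right; rewrite [X in _ = _ + X / a]E mulrAC divff// mul1r.
- by left; rewrite E.
- by left; rewrite E addrC.
- by right; rewrite [X in _ = _ + X / a]E mulrAC divff// mul1r addrC.
Qed.

End Conclusion.

Theorem theorem11 (R : realType) :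
  (forall M : set 'rV[R]_3,
     analytic_isotropic_channel M -> weingarten M ->
     isotropic_rotational M \/ isotropic_pipe M)
  /\
  (forall (M : set 'rV[R]_3) (a : R), a != 0 ->
     analytic_isotropic_channel M -> constant_ratio M a ->
     (exists S : set 'rV[R]_3, isotropic_rotational S /\ M `<=` S) \/
     (exists S : set 'rV[R]_3, parabolic_rotational S /\ M `<=` S)).
Proof.
split.
- move=> M [[sM _] [I [A [B [C [D [fam [aA aB aC aD] env]]]]]]] [_ [F [aF HF]]].
  have [Anc|Ac] := pselect (exists s t, [/\ I s, I t & A s != A t]).
    left; apply: (nonconstant_radius_rotational sM fam _ env Anc (analytic_curve_interior aF)) => //.
    move=> p Mp; have [k1 [k2 [pc Fk]]] := HF p Mp; exists k1, k2; split; first exact: pc.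
    by rewrite /mkset pt2_0 pt2_1.
  right; split => //; exists I, A, B, C, D; split => //.
  by move=> s t Is It; congr (_^-1); apply: contrapT => /eqP st; apply: Ac; exists s, t.
- move=> M a a0 [[sM _] [I [A [B [C [D [fam [aA aB aC aD] env]]]]]]] [_ ratio].
  have [Anc|Ac] := pselect (exists s t, [/\ I s, I t & A s != A t]).
    left; exists M; split => //.
    apply: (nonconstant_radius_rotational sM fam _ env Anc (ratio_curve_interior a0)) => //.
    move=> p Mp; have [k1 [k2 [pc K0 ra]]] := ratio p Mp; exists k1, k2; split; first exact: pc.
    by rewrite /mkset pt2_0 pt2_1; exact: ratio_curve.
  right; have [c [cc ct cM]] := env; have [_ _ _ A0] := fam.
  have [[p0 Mp0] _ _] := sM; have [t0 It0 _] := covered cM Mp0.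
  have Ak t : I t -> A t = A t0.
    by move=> It; apply: contrapT => /eqP st; apply: Ac; exists t, t0.
  have gM p : M p -> exists f, local_graph M p f.
    by move=> Mp; have [k1 [k2 [[f [lf _]] _ _]]] := ratio p Mp; exists f.
  set k := A t0 in Ak.
  have eigM p f : M p -> local_graph M p f ->
      (htrace f (top p) = k + a * k \/ htrace f (top p) = k + k / a) /\
      hdet f (top p) = k * (htrace f (top p) - k).
    move=> Mp lf; have [k1 [k2 [pc K0 ra]]] := ratio p Mp.
    have [W [U [E [Wp G]]]] := (local_graphP M p f).1 lf.
    have [Ep fp] := graph_top G Mp Wp.
    have [t It cp] := covered cM Mp.
    have cp' : c t (lift3 f (top p)) by rewrite lift3_top.
    have := curvature_root cc ct G It Ep cp'; rewrite (Ak t It).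
    have [<- <-] := principal_curvatures_hess Mp lf pc.
    exact: ratio_sum.
  have [P [Q [S [l [m [d [PQS MQ]]]]]]] := constant_radius_quadric ct cM sM gM eigM.
  have [N pN QN] := quadric_parabolic_rotational l m d (A0 _ It0) PQS.
  by exists N; split => // p /MQ; exact: QN.
Qed.
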